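(* Let $d\ge1$ and let $A,B$ be real symmetric positive definite $d\times d$ matrices with $B\ne A^{-1}$. (i) If $B^{-1}-A$ is not semi-positive definite, there exists $\lambda_0>0$ such that any $f\in L^2(\mathbb{R}^d)$ satisfying $$|f(x)|\lesssim e^{-(\frac12-\lambda)\langle Ax,x\rangle}\quad\text{and}\quad|\widehat f(\xi)|\lesssim e^{-(\frac12-\lambda)\langle B\xi,\xi\rangle}\qquad( * )$$ for some $\lambda<\lambda_0$ is necessarily null. On the other hand, there exist non-trivial $f\in L^2(\mathbb{R}^d)$ satisfying $( * )$ for $\lambda=\lambda_0$. (ii) If $B^{-1}-A$ is semi-positive definite, the set $\mathcal{V}$ of functions $f\in L^2(\mathbb{R}^d)$ satisfying $$|f(x)|\lesssim e^{-\frac12\langle Ax,x\rangle}\quad\text{and}\quad|\widehat f(\xi)|\lesssim e^{-\frac12\langle B\xi,\xi\rangle},$$ but for which, for some $h>0$, $$\sup_{\alpha\in\mathbb{N}^d}\frac{|H_A(f,\alpha)|}{h^{|\alpha|}}=\infty,$$ is non-trivial (i.e. contains a non-zero function). The set $\mathcal{V}$ is dense in $L^2(\mathbb{R}^d)$ if and only if $B^{-1}-A$ is positive definite.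
   Context: $\langle\cdot,\cdot\rangle$ is the Euclidean inner product on $\mathbb{R}^d$ and $|\cdot|$ the Euclidean norm. Semi-positive definite means positive semidefinite. The Fourier transform is $\widehat f(\xi)=(2\pi)^{-d/2}\int_{\mathbb{R}^d}f(x)e^{-i\langle x,\xi\rangle}dx$. For $\alpha\in\mathbb{N}^d$ ($0\in\mathbb{N}$), $|\alpha|=\alpha_1+\dots+\alpha_d$. The Hermite functions are $h_\alpha(x)=(-1)^{|\alpha|}\pi^{-d/4}(2^{|\alpha|}\alpha!)^{-1/2}e^{\frac12|x|^2}\partial^\alpha[e^{-|x|^2}]$; the $A$-skewed Hermite functions are $h_{A,\alpha}(x)=(\det A)^{1/4}h_\alpha(A^{1/2}x)$, an orthonormal basis of $L^2(\mathbb{R}^d)$; and $H_A(f,\alpha)=(f,h_{A,\alpha})_{L^2}$. The symbol $\lesssim$ means ''$\le$ up to a positive multiplicative constant'' independent of $x,\xi$. Pointwise bounds on $L^2$ functions are understood almost everywhere. *)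

(* Defs.v *)
From HB Require Import structures.
From mathcomp Require Import all_boot all_order all_algebra.
From mathcomp Require Import all_classical all_reals all_analysis.
From mathcomp Require Import complex.

Set Implicit Arguments.
Unset Strict Implicit.
Unset Printing Implicit Defensive.
Import Order.TTheory GRing.Theory Num.Theory.
Import numFieldNormedType.Exports.

Local Open Scope classical_set_scope.
Local Open Scope ring_scope.

Section EuclideanSpace.
Variable R : realType.

Definition dotv n (x y : 'cV[R]_n) : R := \sum_(i < n) x i 0 * y i 0.

Definition semiposdefmx n (M : 'M[R]_n) : Prop :=
  M^T = M /\ forall x : 'cV[R]_n, 0 <= dotv (M *m x) x.

Definition posdefmx n (M : 'M[R]_n) : Prop :=
  M^T = M /\ forall x : 'cV[R]_n, x != 0 -> 0 < dotv (M *m x) x.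

(* The positive semidefinite square root, which exists and is unique for a
   positive semidefinite M; junk value 0 when there is none. *)
Definition sqrtmx n (M : 'M[R]_n) : 'M[R]_n :=
  xget 0 [set S : 'M[R]_n | semiposdefmx S /\ S *m S = M].

End EuclideanSpace.

Section measurable_cV.
Variables (R : realType) (n : nat).

Let coord (i : 'I_n) (x : 'cV[R]_n) : measurableTypeR R := x i 0.

Let cV_set0 : g_sigma_preimage coord set0.
Proof. exact: sigma_algebra0. Qed.

Let cV_setC A : g_sigma_preimage coord A -> g_sigma_preimage coord (~` A).
Proof. exact: sigma_algebraC. Qed.

Let cV_bigcup (F : _^nat) : (forall i, g_sigma_preimage coord (F i)) ->
  g_sigma_preimage coord (\bigcup_i (F i)).
Proof. exact: sigma_algebra_bigcup. Qed.

(* R^n carries the sigma-algebra generated by the coordinates, i.e. the Borel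
   one, in the same way as the library's instance for n.-tuple. *)
HB.instance Definition _ := @isMeasurable.Build default_measure_display
  'cV[R]_n (g_sigma_preimage coord) cV_set0 cV_setC cV_bigcup.

Lemma measurable_coord (i : 'I_n) :
  measurable_fun [set: 'cV[R]_n] (fun x : 'cV[R]_n => x i 0).
Proof.
move=> _ Y mY; rewrite setTI; apply: sub_sigma_algebra => /=.
rewrite -bigcup_seq/=; exists i => /=; first by rewrite mem_index_enum.
by exists Y => //; rewrite setTI.
Qed.

Lemma measurable_fun_coordP d (T : measurableType d) (f : T -> 'cV[R]_n) :
  (forall i, measurable_fun [set: T] (fun t => f t i 0)) ->
  measurable_fun [set: T] f.
Proof.
move=> mf; pose G A := measurable (f @^-1` A).
suff sub : @measurable _ 'cV[R]_n `<=` G.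
  by move=> _ A mA; rewrite setTI; exact: sub.
apply: smallest_sub.
  split; rewrite /G.
  - by rewrite preimage_set0.
  - by move=> A mA; rewrite setTD preimage_setC; exact: measurableC.
  - by move=> F mF; rewrite preimage_bigcup; exact: bigcupT_measurable.
rewrite -bigcup_seq => A [i _ [B mB <-]]; rewrite /G setTI.
by have := mf i measurableT B mB; rewrite setTI.
Qed.

End measurable_cV.

Section LebesgueMeasure.
Variable R : realType.

Definition consv n (p : measurableTypeR R * 'cV[R]_n) : 'cV[R]_n.+1 :=
  \col_i oapp (fun j => p.2 j 0) p.1 (unlift ord0 i).

Definition unconsv n (x : 'cV[R]_n.+1) : measurableTypeR R * 'cV[R]_n :=
  (x ord0 0, \col_i x (lift ord0 i) 0).

Lemma consvK n : cancel (@consv n) (@unconsv n).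
Proof.
case=> t v; congr (_, _); first by rewrite mxE unlift_none.
by apply/colP => i; rewrite !mxE liftK.
Qed.

Lemma measurable_consv n : measurable_fun setT (@consv n).
Proof.
apply: measurable_fun_coordP => i.
under eq_fun do rewrite mxE.
case: (unliftP ord0 i) => [j _|_] /=; last exact: measurable_fst.
apply: (@measurableT_comp _ _ _ _ _ _ (fun x : 'cV[R]_n => x j 0)) => //.
exact: measurable_coord.
Qed.

Lemma measurable_unconsv n : measurable_fun setT (@unconsv n).
Proof.
apply/measurable_fun_pairP; split; first exact: measurable_coord.
apply: measurable_fun_coordP => i.
under eq_fun do rewrite /= mxE.
exact: measurable_coord.
Qed.

Section step.
Variables (n : nat) (mu : {sigma_finite_measure set 'cV[R]_n -> \bar R}).

Definition lebesgue_step : set 'cV[R]_n.+1 -> \bar R :=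
  pushforward (@lebesgue_measure R \x mu)%E (@consv n).

Let lebesgue_step0 : lebesgue_step set0 = 0%E.
Proof. by rewrite /lebesgue_step /pushforward preimage_set0 measure0. Qed.

Let lebesgue_step_ge0 A : (0 <= lebesgue_step A)%E.
Proof. by rewrite /lebesgue_step /pushforward; apply: measure_ge0. Qed.

Let lebesgue_step_sigma_additive : semi_sigma_additive lebesgue_step.
Proof.
move=> F mF tF mUF; rewrite /lebesgue_step /pushforward preimage_bigcup.
apply: measure_semi_sigma_additive.
- by move=> k; rewrite -[X in measurable X]setTI; exact: measurable_consv.
- apply/trivIsetP => /= i j _ _ ij; rewrite -preimage_setI.
  by move/trivIsetP : tF => /(_ _ _ _ _ ij) ->//; rewrite preimage_set0.
- rewrite -preimage_bigcup -[X in measurable X]setTI.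
  exact: measurable_consv.
Qed.

HB.instance Definition _ := isMeasure.Build _ _ _ lebesgue_step
  lebesgue_step0 lebesgue_step_ge0 lebesgue_step_sigma_additive.

Let lebesgue_step_sigma_finite : sigma_finite setT lebesgue_step.
Proof.
have /sigma_finiteP[F [FT Fnd Foo]] := sigma_finiteT (@lebesgue_measure R).
have /sigma_finiteP[G [GT Gnd Goo]] := sigma_finiteT mu.
exists (fun k => @unconsv n @^-1` (F k `*` G k)).
  apply/esym; rewrite -subTset => x _.
  have [i _ Fi] : (\bigcup_i F i) (unconsv x).1 by rewrite -FT.
  have [j _ Gj] : (\bigcup_i G i) (unconsv x).2 by rewrite -GT.
  exists (maxn i j) => //; split.
  - by move: Fi; exact/subsetPset/Fnd/leq_maxl.
  - by move: Gj; exact/subsetPset/Gnd/leq_maxr.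
move=> k; have [mFk Fk] := Foo k; have [mGk Gk] := Goo k; split.
  rewrite -[X in measurable X]setTI; apply: measurable_unconsv => //.
  exact: measurableX.
rewrite /lebesgue_step /pushforward -comp_preimage.
rewrite (_ : _ \o _ = id); last by apply/funext => p; exact: consvK.
by rewrite preimage_id product_measure1E// lte_mul_pinfty// ge0_fin_numE.
Qed.

HB.instance Definition _ := Measure_isSigmaFinite.Build _ _ _
  lebesgue_step lebesgue_step_sigma_finite.

End step.

Fixpoint lebesgueRn n : {sigma_finite_measure set 'cV[R]_n -> \bar R} :=
  if n is m.+1 then lebesgue_step (lebesgueRn m) else \d_(0 : 'cV[R]_0).

Lemma lebesgueRn_box n (A : 'I_n -> set (measurableTypeR R)) :
  (forall i, measurable (A i)) ->
  lebesgueRn n [set x | forall i, A i (x i 0)]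
  = (\prod_(i < n) lebesgue_measure (A i))%E.
Proof.
elim: n A => [A _|n IH A mA].
  rewrite big_ord0 /= diracE.
  by rewrite mem_set// => -[].
rewrite big_ord_recl -IH// -product_measure1E//; last first.
  set B := (X in measurable X).
  have -> : B =
      \bigcap_i ((fun x : 'cV[R]_n => x i 0) @^-1` A (lift ord0 i)).
    by apply/seteqP; split => [x Ax i _|x Ax i]; [exact: Ax|exact: (Ax i I)].
  apply: fin_bigcap_measurable => // i _.
  rewrite -[X in measurable X]setTI; exact: (measurable_coord i measurableT (mA (lift ord0 i))).
rewrite /= /lebesgue_step /pushforward; congr (_ _).
apply/seteqP; split => -[t v] /= => [Ax|[At Av] i].
  split=> [|i]; first by have := Ax ord0; rewrite mxE unlift_none.
  by have := Ax (lift ord0 i); rewrite mxE liftK.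
by rewrite mxE; case: (unliftP ord0 i) => [j ->|->] /=.
Qed.

End LebesgueMeasure.

Section ComplexFunctions.
Variables (R : realType) (d : nat).
Implicit Types (f g : 'cV[R]_d -> R[i]) (x xi : 'cV[R]_d).

Local Notation mu := (@lebesgueRn R d).

Definition cabs (z : R[i]) : R := ComplexField.Normc.normc z.

Definition cintegral f : R[i] :=
  Complex (\int[mu]_x complex.Re (f x))%R (\int[mu]_x complex.Im (f x))%R.

Definition L2norm f : \bar R := Lnorm mu 2%:E (fun x => (cabs (f x))%:E).

(* Elements of L^2(R^d) are represented by Borel functions; equality in L^2 is
   equality almost everywhere. *)
Definition inL2 f : Prop :=
  [/\ measurable_fun setT (fun x => complex.Re (f x)),
      measurable_fun setT (fun x => complex.Im (f x)) &
      (L2norm f < +oo)%E].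

Definition ae_null f : Prop := {ae mu, forall x, f x = 0}.

Definition dense_in_L2 (V : set ('cV[R]_d -> R[i])) : Prop :=
  forall g, inL2 g -> forall e : R, 0 < e ->
    exists2 f, V f & (L2norm (fun x => (f x - g x)%R) < e%:E)%E.

Definition innerL2 f g : R[i] := cintegral (fun x => f x * (g x)^*%C).

Definition expNi (t : R) : R[i] := Complex (cos t) (- sin t).

(* This integral is the Fourier transform of an integrable f, in particular of
   any measurable f with gaussian_decay c A f, c > 0 and A positive definite. *)
Definition fourier f xi : R[i] :=
  ((2 * pi) `^ (- (d%:R / 2)))%:C%C *
  cintegral (fun x => f x * expNi (dotv x xi)).

Definition gaussian_decay (c : R) (M : 'M[R]_d) f : Prop :=
  exists2 C : R, 0 < C &
    {ae mu, forall x, cabs (f x) <= C * expR (- c * dotv (M *m x) x)}.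

End ComplexFunctions.

Section Hermite.
Variables (R : realType) (d : nat).

Definition mlength (a : {ffun 'I_d -> nat}) : nat := (\sum_(i < d) a i)%N.

Definition mfactorial (a : {ffun 'I_d -> nat}) : nat := (\prod_(i < d) (a i)`!)%N.

Definition partial (i : 'I_d) (g : 'cV[R]_d -> R) : 'cV[R]_d -> R :=
  'D_(delta_mx i 0) g.

Definition mpartial (a : {ffun 'I_d -> nat}) (g : 'cV[R]_d -> R) :
    'cV[R]_d -> R :=
  foldr (fun i => iter (a i) (partial i)) g (enum 'I_d).

Definition hermite (a : {ffun 'I_d -> nat}) (x : 'cV[R]_d) : R :=
  (-1) ^+ mlength a * pi `^ (- (d%:R / 4))
  * ((2 ^ mlength a * mfactorial a)%N%:R) `^ (- 2^-1)
  * expR (2^-1 * dotv x x)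
  * mpartial a (fun y => expR (- dotv y y)) x.

Definition skewed_hermite (A : 'M[R]_d) (a : {ffun 'I_d -> nat})
    (x : 'cV[R]_d) : R :=
  (\det A) `^ (4^-1) * hermite a (sqrtmx A *m x).

Definition hermite_coef (A : 'M[R]_d) (f : 'cV[R]_d -> R[i])
    (a : {ffun 'I_d -> nat}) : R[i] :=
  innerL2 f (fun x => (skewed_hermite A a x)%:C%C).

End Hermite.

Definition slow_hermite (R : realType) (d : nat) (A B : 'M[R]_d) :
    set ('cV[R]_d -> R[i]) :=
  [set f | [/\ inL2 f, gaussian_decay 2^-1 A f,
      gaussian_decay 2^-1 B (fourier f) &
      exists2 h : R, 0 < h &
        ereal_sup [set (cabs (hermite_coef A f a) / h ^+ mlength a)%:E
                  | a in [set: {ffun 'I_d -> nat}]] = +oo%E]].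

(* Main.v *)
Require Import Defs.
From mathcomp Require Import all_boot all_order all_algebra.
From mathcomp Require Import all_classical all_reals all_analysis.
From mathcomp Require Import complex measurable_realfun.
From mathcomp Require Import ring lra zify.

(** Everything rests on one observation about lines. Let [|f| <= C e^(-c <A x, x>)], let [w] satisfy
    [<A^-1 w, w> = 4 c], and suppose that on the line [eta + t w] the transform of [f] is
    [O(e^(-t^2))]. By Fubini ([slice_gaussE]) the two Laplace transforms
      [Phi(s) = \int F(eta + t w) e^(-s t^2) dt] and
      [Psi(u) = \int f(x) e^(-i <x, eta>) e^(-u <x, w>^2 / 4) dx],
    where [F(xi)] is the integral of [f(x) e^(-i <x, xi>)], satisfy [Phi(s) = sqrt(pi / s) Psi(1 / s)]
    for [s > 0]. Under the Gaussian weights [t^2] and [<x, w>^2 / 4] both have the chi-square density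
    [u^(-1/2) e^(-u)], so [Phi] and [Psi] are analytic for [Re s > -1]. An auxiliary Gaussian variable
    on each side makes the weights exponential and the relation rational: [s Phi(s) = Psi(1 / s)]
    ([inversion_rel]). It continues to the unit circle minus the point [-1]. After multiplication by
    [(1 + z)^4] the Taylor coefficients of both sides are summable ([summable_laplace]), by
    Cauchy-Schwarz against Laguerre polynomials; one side then has only frequencies [>= 0] on the
    circle and the other only frequencies [<= 3], so [(1 + z)^4 Phi(z)] is a polynomial of degree
    at most [3] ([inversion_rel_polynomial]). Hence [Psi] is governed by a cubic
    ([modulated_gauss_rational]), and it vanishes when the slice decays faster than [e^(-t^2)], since
    the cubic would then have a zero of too high an order ([modulated_gauss_eq0]).

    Part (i). Let [beta] be the largest value of [<B v, v> / <A^-1 v, v>]; it exceeds [1] exactly when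
    [B^-1 - A] is not semidefinite. If [f] and its transform decay at a rate [c] with
    [4 c^2 beta > 1], then along a suitable direction every slice decays faster than the critical
    Gaussian. So [Psi] vanishes for every [eta], which says that a positive Gaussian times [f] has
    zero Fourier transform, and [f = 0] ([hardy_uniqueness], [fourier_injective]). At
    [4 c^2 beta = 1] the Gaussian of matrix [2 c A] satisfies both bounds ([sharp_threshold]).

    Part (ii), existence. The Gaussian of matrix [B^-1] satisfies both bounds. Its Hermite
    coefficients along a coordinate axis of variance [kappa] have size about [|kappa - 1/2|^m] at
    order [2 m], and since [B^-1 <> A] some axis has [kappa <> 1/2] ([axis_var_neq_half],
    [slow_hermite_bound]).

    Density when [B^-1 - A] is positive definite. Then [A^-1 - B] is definite as well, so
    [e^(-<A x, x> / 2)] times any trigonometric polynomial satisfies both bounds; these functions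
    are dense, and a small multiple of the slow Gaussian makes them slow
    ([slow_hermite_dense]).

    Failure of density when [B^-1 - A] has a null vector [v]. With [w = A v] normalised, every slice
    along [w] through a point orthogonal to [v] is exactly critical, so [Psi] is governed by a cubic
    and a fourth difference gives a linear relation between five values of [Psi]
    ([slice_annihilated]). Averaging these relations over all [eta] orthogonal to [v] produces one
    nonzero function of [L^2] orthogonal to the whole set ([annihilator_orthogonal],
    [slow_hermite_not_dense]). *)

Set Implicit Arguments.
Unset Strict Implicit.
Unset Printing Implicit Defensive.
Import Order.TTheory GRing.Theory Num.Theory.
Import numFieldNormedType.Exports.

Local Open Scope classical_set_scope.
Local Open Scope ring_scope.

(** * Modulus and exponential of complex numbers *)

Section ComplexModulus.
Variable R : realType.
Implicit Types (z w : R[i]) (x : R).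

Lemma cabs_ge0 z : 0 <= cabs z.
Proof. by case: z => a b; rewrite /cabs /= sqrtr_ge0. Qed.

Lemma cabs0 : cabs (0 : R[i]) = 0.
Proof. exact: ComplexField.Normc.normc0. Qed.

Lemma cabs1 : cabs (1 : R[i]) = 1.
Proof. exact: ComplexField.Normc.normc1. Qed.

Lemma cabsM z w : cabs (z * w) = cabs z * cabs w.
Proof. exact: ComplexField.Normc.normcM. Qed.

Lemma cabsV z : cabs z^-1 = (cabs z)^-1.
Proof. exact: ComplexField.Normc.normcV. Qed.

Lemma cabsN z : cabs (- z) = cabs z.
Proof. exact: normcN. Qed.

Lemma cabsD z w : cabs (z + w) <= cabs z + cabs w.
Proof. exact: le_normcD. Qed.

Lemma cabsB z w : cabs (z - w) <= cabs z + cabs w.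
Proof. by rewrite -[cabs w]cabsN cabsD. Qed.

Lemma cabs_distC z w : cabs (z - w) = cabs (w - z).
Proof. by rewrite -cabsN opprB. Qed.

Lemma cabs_eq0 z : (cabs z == 0) = (z == 0).
Proof.
by apply/eqP/eqP => [|->]; [exact: ComplexField.Normc.eq0_normc|exact: cabs0].
Qed.

Lemma cabs_gt0 z : (0 < cabs z) = (z != 0).
Proof. by rewrite lt_def cabs_ge0 andbT cabs_eq0. Qed.

Lemma cabsX z n : cabs (z ^+ n) = cabs z ^+ n.
Proof. by elim: n => [|n IH]; rewrite ?expr0 ?cabs1// !exprS cabsM IH. Qed.

Lemma cabs_sum I (r : seq I) (P : pred I) (F : I -> R[i]) :
  cabs (\sum_(i <- r | P i) F i) <= \sum_(i <- r | P i) cabs (F i).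
Proof.
elim/big_rec2: _ => [|i y1 y2 _ IH]; first by rewrite cabs0.
by rewrite (le_trans (cabsD _ _))// lerD2l.
Qed.

Lemma cabsE z : cabs z = Num.sqrt (complex.Re z ^+ 2 + complex.Im z ^+ 2).
Proof. by case: z. Qed.

Lemma cabs_real x : cabs x%:C%C = `|x|.
Proof. by rewrite cabsE /= expr0n addr0 sqrtr_sqr. Qed.

Lemma sqr_cabs z : cabs z ^+ 2 = complex.Re z ^+ 2 + complex.Im z ^+ 2.
Proof. by rewrite cabsE sqr_sqrtr// addr_ge0 ?sqr_ge0. Qed.

Lemma cabs_nat n : cabs (n%:R : R[i]) = n%:R.
Proof.
rewrite (_ : n%:R = (n%:R : R)%:C%C) ?cabs_real ?ger0_norm//.
by rewrite raddfMn.
Qed.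

Lemma Re_le_cabs z : `|complex.Re z| <= cabs z.
Proof. by rewrite cabsE -sqrtr_sqr ler_wsqrtr// lerDl sqr_ge0. Qed.

Lemma Im_le_cabs z : `|complex.Im z| <= cabs z.
Proof. by rewrite cabsE -sqrtr_sqr ler_wsqrtr// lerDr sqr_ge0. Qed.

Lemma cabs_le_ReIm z : cabs z <= `|complex.Re z| + `|complex.Im z|.
Proof.
rewrite -(@ler_pXn2r _ 2) ?nnegrE ?cabs_ge0 ?addr_ge0//.
rewrite sqr_cabs -[complex.Re z ^+ 2]real_normK ?num_real//.
rewrite -[complex.Im z ^+ 2]real_normK ?num_real// sqrrD -addrA lerD2l lerDr mulrn_wge0// mulr_ge0//.
Qed.

Lemma cReD z w : complex.Re (z + w) = complex.Re z + complex.Re w.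
Proof. by case: z w => a b [c d]. Qed.

Lemma cImD z w : complex.Im (z + w) = complex.Im z + complex.Im w.
Proof. by case: z w => a b [c d]. Qed.

Lemma cReN z : complex.Re (- z) = - complex.Re z. Proof. by case: z. Qed.

Lemma cImN z : complex.Im (- z) = - complex.Im z. Proof. by case: z. Qed.

Lemma cReM z w : complex.Re (z * w) =
  complex.Re z * complex.Re w - complex.Im z * complex.Im w.
Proof. by case: z w => a b [c d]. Qed.

Lemma cImM z w : complex.Im (z * w) =
  complex.Re z * complex.Im w + complex.Im z * complex.Re w.
Proof. by case: z w => a b [c d]. Qed.

Lemma Re_sum I (r : seq I) (P : pred I) (F : I -> R[i]) :
  complex.Re (\sum_(i <- r | P i) F i) = \sum_(i <- r | P i) complex.Re (F i).
Proof. by elim/big_rec2: _ => // i y1 y2 _ <-; rewrite cReD. Qed.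

Lemma complexP z w : complex.Re z = complex.Re w ->
  complex.Im z = complex.Im w -> z = w.
Proof. by case: z w => a b [c d] /= -> ->. Qed.

Lemma cReMr z x : complex.Re (z * x%:C%C) = complex.Re z * x.
Proof. by rewrite cReM /=; ring. Qed.

Lemma cImMr z x : complex.Im (z * x%:C%C) = complex.Im z * x.
Proof. by rewrite cImM /=; ring. Qed.

(** Bounds on the real parts of all rotations of [z] bound [cabs z]; this is how estimates of
    real functions and integrals reach complex ones. *)
Lemma cabs_le_rot z x :
  (forall w, cabs w = 1 -> complex.Re (w * z) <= x) -> cabs z <= x.
Proof.
move=> H; have [z0|z0] := eqVneq z 0.
  by rewrite z0 cabs0; have := H 1 cabs1; rewrite z0 mulr0.
have nz : cabs z != 0 by rewrite cabs_eq0.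
have := H (z^*%C * ((cabs z)^-1)%:C%C).
have cz : cabs z^*%C = cabs z by case: (z) => a b; rewrite /cabs /= sqrrN.
rewrite cabsM cabs_real ger0_norm ?invr_ge0 ?cabs_ge0// cz mulfV// => /(_ erefl).
rewrite mulrAC cReMr cReM.
have -> : complex.Re z^*%C * complex.Re z - complex.Im z^*%C * complex.Im z
    = cabs z ^+ 2.
  by rewrite sqr_cabs; case: (z) => a b /=; rewrite mulNr opprK.
by rewrite expr2 -mulrA mulfV// mulr1.
Qed.

Definition cexp z : R[i] :=
  Complex (expR (complex.Re z) * cos (complex.Im z))
          (expR (complex.Re z) * sin (complex.Im z)).

Lemma cexpD z w : cexp (z + w) = cexp z * cexp w.
Proof.
apply: complexP; rewrite ?cReM ?cImM /cexp /= ?cReD ?cImD expRD ?cosD ?sinD; ring.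
Qed.

Lemma cabs_cexp z : cabs (cexp z) = expR (complex.Re z).
Proof.
rewrite cabsE /= !exprMn -mulrDr cos2Dsin2 mulr1 sqrtr_sqr ger0_norm//.
Qed.

Lemma cexp_real x : cexp x%:C%C = (expR x)%:C%C.
Proof. by rewrite /cexp /= cos0 sin0 mulr1 mulr0. Qed.

Lemma cexp0 : cexp 0 = 1. Proof. by rewrite (cexp_real 0) expR0. Qed.

End ComplexModulus.

(** * Taylor remainders of the exponential *)

Section ExponentialRemainder.
Variable R : realType.

Definition exp_rem n (x : R) : R :=
  expR x - \sum_(i < n) x ^+ i / i`!%:R.

Definition cexp_rem n (z : R[i]) : R[i] :=
  cexp z - \sum_(i < n) z ^+ i / i`!%:R.

Lemma sum_expcoeff_recl (K : fieldType) n (x : K) :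
  \sum_(i < n.+1) x ^+ i / i`!%:R = 1 + \sum_(i < n) x ^+ i.+1 / i.+1`!%:R.
Proof.
by rewrite big_ord_recl /= expr0 fact0 divr1.
Qed.

Lemma fact_unit n : n`!%:R != 0 :> R. Proof. by rewrite pnatr_eq0 -lt0n fact_gt0. Qed.
Lemma scaleRE (a b : R) : a *: (b : R^o) = a * b.
Proof. by []. Qed.

Lemma is_derive_expsum n (c : nat -> R) (t : R) :
  is_derive t 1 (fun x : R => \sum_(i < n.+1) x ^+ i * c i / i`!%:R)
    (\sum_(i < n) t ^+ i * c i.+1 / i`!%:R).
Proof.
elim: n => [|n IH].
  rewrite big_ord0 (_ : (fun x => _) = cst (c 0%N)).
    exact: is_derive_cst.
  by apply/funext => x; rewrite big_ord_recl big_ord0 /= expr0 fact0 divr1 mul1r addr0.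
have D := is_deriveX n.+1 (is_derive_id t 1).
have DD := is_deriveD IH (is_deriveZ (c n.+1 / n.+1`!%:R) D).
rewrite (_ : (fun x => _) = (fun x : R => \sum_(i < n.+1) x ^+ i * c i / i`!%:R) +
   (c n.+1 / n.+1`!%:R) \*: (id ^+ n.+1)); last first.
  apply/funext => x; rewrite big_ord_recr/=; congr (_ + _).
  rewrite /= exprfctE.
  by rewrite -[RHS]/(_ * x ^+ n.+1); ring.
apply: (is_derive_eq DD).
rewrite [RHS]big_ord_recr /=; congr (_ + _).
rewrite !scaleRE factS natrM.
have n0 : n.+1%:R != 0 :> R by rewrite pnatr_eq0.
have f0 := fact_unit n.
by move: n0 f0; move: (n.+1%:R : R) (n`!%:R : R) => a b a0 b0; field; rewrite a0 b0.
Qed.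

Lemma exp_rem0 n : exp_rem n.+1 0 = 0.
Proof.
rewrite /exp_rem expR0 sum_expcoeff_recl big1 ?addr0 ?subrr// => i _.
by rewrite expr0n /= mul0r.
Qed.

Lemma is_derive_mull (a t : R) : is_derive t 1 (fun x : R => a * x) a.
Proof. by have := is_deriveZ a (is_derive_id t 1); rewrite scaleRE mulr1. Qed.

Lemma is_derive_exp_rem n (a t : R) :
  is_derive t 1 (fun x : R => exp_rem n.+1 (a * x)) (a * exp_rem n (a * t)).
Proof.
rewrite /exp_rem.
have E : is_derive t 1 (fun x : R => expR (a * x)) (a * expR (a * t)).
  rewrite mulrC.
  apply: (@is_derive1_comp _ expR (fun x : R => a * x) t).
  exact: is_derive_mull.
have S := @is_derive_expsum n (fun i => a ^+ i) t.
have := is_deriveB E S.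
rewrite (_ : (fun x => _) - _ = (fun x => expR (a * x) -
    \sum_(i < n.+1) (a * x) ^+ i / i`!%:R)); last first.
  apply/funext => x; rewrite fctE /=; congr (_ - _); apply: eq_bigr => i _.
  by rewrite exprMn [x ^+ _ * _]mulrC.
move=> H; apply: (is_derive_eq H).
rewrite mulrBr mulr_sumr; congr (_ - _); apply: eq_bigr => i _.
by rewrite exprMn exprS; ring.
Qed.

Lemma is_derive_ge0_le (f df : R -> R) (x : R) : 0 <= x ->
  (forall t : R, is_derive t 1 f (df t)) -> (forall t, 0 <= t -> 0 <= df t) ->
  f 0 <= f x.
Proof.
move=> x0 Df df0; rewrite -subr_ge0.
have [c] : exists2 c, c \in `[0, x] & f x - f 0 = df c * (x - 0).
  apply: MVT_segment => //.
  apply: continuous_subspaceT => t.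
  by apply/differentiable_continuous/derivable1_diffP; have [] := Df t.
rewrite in_itv /= => /andP[c0 _] ->.
by rewrite mulr_ge0 ?df0// subr0.
Qed.

Lemma exp_rem_ge0 n (x : R) : 0 <= x -> 0 <= exp_rem n x.
Proof.
elim: n x => [|n IH] x x0; first by rewrite /exp_rem big_ord0 subr0 expR_ge0.
have := @is_derive_ge0_le (fun t => exp_rem n.+1 (1 * t))
  (fun t => 1 * exp_rem n (1 * t)) x x0 (is_derive_exp_rem n 1).
rewrite mulr0 exp_rem0 mul1r; apply => t t0.
by rewrite !mul1r IH.
Qed.

(** The remainder of order [n] vanishes to order [n] at the origin, in a way
    that is uniform in [n]. *)
Lemma exp_rem_scale n (a x : R) : 0 <= a -> a <= 1 -> 0 <= x ->
  exp_rem n (a * x) <= a ^+ n * exp_rem n x.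
Proof.
move=> a0 a1; elim: n x => [|n IH] x x0.
  rewrite /exp_rem !big_ord0 !subr0 expr0 mul1r ler_expR.
  by rewrite ler_piMl.
rewrite -subr_ge0.
pose f t := a ^+ n.+1 * exp_rem n.+1 (1 * t) - exp_rem n.+1 (a * t).
pose df t := a ^+ n.+1 * (1 * exp_rem n (1 * t)) - a * exp_rem n (a * t).
have f0 : f 0 = 0 by rewrite /f !mulr0 exp_rem0 mulr0 subr0.
rewrite (_ : _ - _ = f x); last by rewrite /f mul1r.
rewrite -{1}f0.
apply: (is_derive_ge0_le x0 (df := df)).
  move=> t; apply: is_deriveB (is_derive_exp_rem n a t).
  by have := is_deriveZ (a ^+ n.+1) (is_derive_exp_rem n 1 t).
move=> t t0; rewrite /df !mul1r exprS -mulrA -mulrBr mulr_ge0// subr_ge0.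
exact: IH.
Qed.

Lemma cReMl (x : R) (z : R[i]) : complex.Re (x%:C%C * z) = x * complex.Re z.
Proof. by rewrite mulrC cReMr mulrC. Qed.

Lemma cImMl (x : R) (z : R[i]) : complex.Im (x%:C%C * z) = x * complex.Im z.
Proof. by rewrite mulrC cImMr mulrC. Qed.

Lemma Re_cexp_ray (w z : R[i]) (x : R) : complex.Re (w * cexp (x%:C%C * z)) =
  complex.Re w * (expR (complex.Re z * x) * cos (complex.Im z * x)) -
  complex.Im w * (expR (complex.Re z * x) * sin (complex.Im z * x)).
Proof. by rewrite cReM {1 2}/cexp cReMl cImMl ![x * _]mulrC. Qed.

Lemma is_derive_Re_rot_cexp (w z : R[i]) (t : R) :
  is_derive t 1 (fun x : R => complex.Re (w * cexp (x%:C%C * z)))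
     (complex.Re (w * z * cexp (t%:C%C * z))).
Proof.
under eq_fun do rewrite Re_cexp_ray.
rewrite Re_cexp_ray cReM cImM.
move: (complex.Re z) (complex.Im z) (complex.Re w) (complex.Im w) => a b u v.
have E : is_derive t 1 (fun x : R => expR (a * x)) (a * expR (a * t)).
  rewrite mulrC; apply: (@is_derive1_comp _ expR (fun x : R => a * x) t).
  exact: is_derive_mull.
have C : is_derive t 1 (fun x : R => cos (b * x)) (- sin (b * t) * b).
  apply: (@is_derive1_comp _ (@cos R) (fun x : R => b * x) t).
  exact: is_derive_mull.
have S : is_derive t 1 (fun x : R => sin (b * x)) (cos (b * t) * b).
  apply: (@is_derive1_comp _ (@sin R) (fun x : R => b * x) t).
  exact: is_derive_mull.
have D := is_deriveB (is_deriveZ u (is_deriveM E C)) (is_deriveZ v (is_deriveM E S)).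
apply: (is_derive_eq D).
by rewrite !scaleRE; ring.
Qed.

Lemma cexp_rem0 n : cexp_rem n.+1 0 = 0.
Proof.
rewrite /cexp_rem cexp0 sum_expcoeff_recl big1 ?addr0 ?subrr// => i _.
by rewrite expr0n /= mul0r.
Qed.

Lemma Re_cexp_rem (w z : R[i]) n (x : R) :
  complex.Re (w * cexp_rem n (x%:C%C * z)) =
  complex.Re (w * cexp (x%:C%C * z)) -
  \sum_(i < n) x ^+ i * complex.Re (w * z ^+ i) / i`!%:R.
Proof.
rewrite /cexp_rem mulrBr cReD cReN mulr_sumr Re_sum; congr (_ - _).
apply: eq_bigr => i _.
rewrite exprMn (_ : w * (_ / _) = (x ^+ i / i`!%:R)%:C%C * (w * z ^+ i)).
  by rewrite cReMl; ring.
rewrite (_ : (i`!%:R)^-1 = ((i`!%:R : R)^-1)%:C%C).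
  by rewrite rmorphM rmorphXn /=; ring.
by rewrite fmorphV rmorph_nat.
Qed.

Lemma is_derive_Re_cexp_rem (w z : R[i]) n (t : R) :
  is_derive t 1 (fun x : R => complex.Re (w * cexp_rem n.+1 (x%:C%C * z)))
     (complex.Re (w * z * cexp_rem n (t%:C%C * z))).
Proof.
under eq_fun do rewrite Re_cexp_rem.
rewrite Re_cexp_rem.
have S := @is_derive_expsum n (fun i => complex.Re (w * z ^+ i)) t.
have D := is_deriveB (is_derive_Re_rot_cexp w z t) S.
apply: (is_derive_eq D); congr (_ - _); apply: eq_bigr => i _.
by rewrite exprS mulrA.
Qed.

(** Along the ray through [z] the remainder of order [n.+1] is the primitive of that of order
    [n], as for the real exponential, so real parts can be compared by induction. *)
Lemma cabs_cexp_rem n (z : R[i]) : cabs (cexp_rem n z) <= exp_rem n (cabs z).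
Proof.
elim: n z => [|n IH] z.
  rewrite /cexp_rem /exp_rem !big_ord0 !subr0 cabs_cexp ler_expR.
  exact: le_trans (ler_norm _) (Re_le_cabs _).
apply: cabs_le_rot => w w1.
pose f (t : R) := exp_rem n.+1 (cabs z * t) -
   complex.Re (w * cexp_rem n.+1 (t%:C%C * z)).
pose df (t : R) := cabs z * exp_rem n (cabs z * t) -
   complex.Re (w * z * cexp_rem n (t%:C%C * z)).
have f0 : f 0 = 0 by rewrite /f mulr0 exp_rem0 mul0r cexp_rem0 mulr0 subrr.
suff : f 0 <= f 1 by rewrite f0 /f mulr1 mul1r subr_ge0.
apply: (is_derive_ge0_le (df := df) ler01) => [t|t t0].
  exact: is_deriveB (is_derive_exp_rem n _ t) (is_derive_Re_cexp_rem w z n t).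
rewrite /df subr_ge0 (le_trans (le_trans (ler_norm _) (Re_le_cabs _)))//.
rewrite !cabsM w1 mul1r ler_wpM2l ?cabs_ge0// (le_trans (IH _))//.
by rewrite cabsM cabs_real ger0_norm// mulrC.
Qed.

End ExponentialRemainder.

(** * Majorants and local analyticity *)

Section Majorants.
Variable R : realType.
Implicit Types (D E : {poly R[i]}) (M N : {poly R}) (t : R[i]) (r x y : R).

(** Cauchy's majorants: coefficientwise domination passes to sums, products and compositions,
    which reduces estimates to evaluations of real polynomials. *)
Definition majorant D M := forall i, cabs D`_i <= M`_i.

Lemma majorant_ge0 D M i : majorant D M -> 0 <= M`_i.
Proof. by move=> H; exact: le_trans (cabs_ge0 _) (H i). Qed.

Lemma majorantD D E M N :
  majorant D M -> majorant E N -> majorant (D + E) (M + N).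
Proof.
by move=> H1 H2 i; rewrite !coefD (le_trans (cabsD _ _))// lerD.
Qed.

Lemma majorantN D M : majorant D M -> majorant (- D) M.
Proof. by move=> H i; rewrite coefN cabsN. Qed.

Lemma majorantM D E M N :
  majorant D M -> majorant E N -> majorant (D * E) (M * N).
Proof.
move=> H1 H2 i; rewrite !coefM (le_trans (cabs_sum _ _ _))// ler_sum// => j _.
by rewrite cabsM ler_pM ?cabs_ge0.
Qed.

Lemma majorantC (c : R[i]) x : cabs c <= x -> majorant c%:P x%:P.
Proof. by move=> H i; rewrite !coefC; case: ifP; rewrite ?cabs0. Qed.

Lemma majorant0 : majorant 0 0.
Proof. by move=> i; rewrite !coef0 cabs0. Qed.

Lemma majorantX : majorant 'X 'X.
Proof. by move=> i; rewrite !coefX cabs_nat. Qed.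

Lemma majorant_exp D M n : majorant D M -> majorant (D ^+ n) (M ^+ n).
Proof.
move=> H; elim: n => [|n IH]; last by rewrite !exprS; exact: majorantM.
by rewrite !expr0; apply: majorantC; rewrite cabs1.
Qed.

Lemma majorant_sum I (s : seq I) (P : pred I) (F : I -> {poly R[i]})
    (G : I -> {poly R}) : (forall i, P i -> majorant (F i) (G i)) ->
  majorant (\sum_(i <- s | P i) F i) (\sum_(i <- s | P i) G i).
Proof.
move=> H; elim/big_rec2: _ => [|i y1 y2 Pi IH]; first exact: majorant0.
by apply: majorantD => //; exact: H.
Qed.

Lemma poly_wide (K : nzRingType) (p : {poly K}) n : (size p <= n)%N ->
  p = \sum_(i < n) (p`_i)%:P * 'X^i.
Proof.
move=> sp; rewrite -[LHS]coefK poly_def (big_ord_widen _ (fun i => p`_i *: 'X^i) sp).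
rewrite big_mkcond /=; apply: eq_bigr => i _; rewrite mul_polyC.
by case: ltnP => // /(nth_default 0) ->; rewrite scale0r.
Qed.

Lemma majorant_comp D E M N :
  majorant D M -> majorant E N -> majorant (D \Po E) (M \Po N).
Proof.
move=> H1 H2; pose n := maxn (size D) (size M).
rewrite (poly_wide (leq_maxl (size D) (size M))) -/n.
rewrite [in X in majorant _ X](poly_wide (leq_maxr (size D) (size M))) -/n.
rewrite !raddf_sum /=; apply: majorant_sum => i _.
rewrite !comp_polyM !comp_polyC !comp_Xn_poly.
by apply: majorantM; [exact/majorantC/H1|exact: majorant_exp].
Qed.

Lemma majorant_horner D M t : majorant D M -> cabs D.[t] <= M.[cabs t].
Proof.
move=> H; pose n := maxn (size D) (size M).
rewrite (horner_coef_wide _ (leq_maxl (size D) (size M))) -/n.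
rewrite (horner_coef_wide _ (leq_maxr (size D) (size M))) -/n.
rewrite (le_trans (cabs_sum _ _ _))// ler_sum// => i _.
by rewrite cabsM cabsX ler_wpM2r ?exprn_ge0 ?cabs_ge0.
Qed.

Lemma majorant_le D M x y : majorant D M -> 0 <= x -> x <= y ->
  M.[x] <= M.[y].
Proof.
move=> H x0 xy; rewrite !horner_coef ler_sum// => i _.
by rewrite ler_wpM2l ?(majorant_ge0 _ H)// lerXn2r ?nnegrE// (le_trans x0).
Qed.

(** Dominated by the majorant at [r], the remaining terms gain a factor [cabs t / r] for each
    vanishing coefficient. *)
Lemma majorant_small D M r n t : majorant D M -> 0 < r -> cabs t <= r ->
  (forall i, (i < n)%N -> D`_i = 0) -> cabs D.[t] <= M.[r] * (cabs t / r) ^+ n.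
Proof.
move=> H r0 tr D0; pose m := maxn (size D) (size M).
rewrite (horner_coef_wide _ (leq_maxl (size D) (size M))) -/m.
rewrite (horner_coef_wide _ (leq_maxr (size D) (size M))) -/m.
rewrite (le_trans (cabs_sum _ _ _))// mulr_suml ler_sum// => i _.
rewrite cabsM cabsX; have [ni|ni] := ltnP i n.
  rewrite D0// cabs0 mul0r mulr_ge0 ?exprn_ge0 ?divr_ge0 ?cabs_ge0 ?(ltW r0)//.
  by rewrite mulr_ge0 ?exprn_ge0 ?(ltW r0)// (majorant_ge0 _ H).
rewrite -mulrA ler_pM ?exprn_ge0 ?cabs_ge0//.
have -> : cabs t ^+ i = r ^+ i * (cabs t / r) ^+ i.
  by rewrite expr_div_n mulrCA mulfV ?mulr1// expf_neq0// gt_eqF.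
rewrite ler_wpM2l ?exprn_ge0 ?(ltW r0)//.
apply: ler_wiXn2l => //; first by rewrite divr_ge0 ?cabs_ge0 ?(ltW r0).
by rewrite ler_pdivrMr// mul1r.
Qed.

End Majorants.

Section LocalAnalyticity.
Variable R : realType.
Implicit Types (g : R[i] -> R[i]) (t : R[i]) (K r : R).

(** Analyticity of [g] on the disc of radius [r] without infinite series: polynomials with a
    common majorant bound that approximate [g] to every order at the centre. Sums, products
    with polynomials and substitutions then take place among polynomials. *)
Definition poly_approx g K r := 0 < r /\ forall n,
  exists (D : {poly R[i]}) (M : {poly R}), [/\ majorant D M, M.[r] <= K &
    forall t, cabs t <= r -> cabs (g t - D.[t]) <= K * (cabs t / r) ^+ n].

Lemma majorant_horner_ge0 (D : {poly R[i]}) M r :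
  majorant D M -> 0 <= r -> 0 <= M.[r].
Proof.
move=> DM r0; rewrite -(ger0_norm r0) -cabs_real.
exact: le_trans (cabs_ge0 _) (majorant_horner _ DM).
Qed.

Lemma poly_approx_ge0 g K r : poly_approx g K r -> 0 <= K.
Proof.
move=> [r0 /(_ 0%N)[D [M [DM MK _]]]]; apply: le_trans MK.
exact: majorant_horner_ge0 DM (ltW r0).
Qed.

Lemma poly_approxB g h K L r : poly_approx g K r -> poly_approx h L r ->
  poly_approx (fun t => g t - h t) (K + L) r.
Proof.
move=> [r0 Hg] [_ Hh]; split=> // n.
have [D [M [DM MK gD]]] := Hg n; have [E [N [EN NL hE]]] := Hh n.
exists (D - E), (M + N); split.
- by apply: majorantD => //; exact: majorantN.
- by rewrite hornerD lerD.
- move=> t tr; rewrite hornerD hornerN mulrDl.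
  rewrite (_ : _ - _ = (g t - D.[t]) - (h t - E.[t])); last by ring.
  by rewrite (le_trans (cabsB _ _))// lerD ?gD ?hE.
Qed.

Lemma poly_approxM g K r (P : {poly R[i]}) (Q : {poly R}) :
  majorant P Q -> poly_approx g K r ->
  poly_approx (fun t => P.[t] * g t) (Q.[r] * K) r.
Proof.
move=> PQ [r0 Hg]; split=> // n; have [D [M [DM MK gD]]] := Hg n.
have Q0 : 0 <= Q.[r] by exact: majorant_horner_ge0 PQ (ltW r0).
exists (P * D), (Q * M); split.
- exact: majorantM.
- by rewrite hornerM ler_wpM2l.
- move=> t tr; rewrite hornerM -mulrBr cabsM -mulrA.
  rewrite ler_pM ?cabs_ge0 ?gD// (le_trans (majorant_horner _ PQ))//.
  by rewrite (majorant_le PQ)// cabs_ge0.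
Qed.

Lemma poly_approx_shrink g K r r' : 0 < r' -> r' <= r ->
  poly_approx g K r -> poly_approx g K r'.
Proof.
move=> r'0 r'r gK; have K0 := poly_approx_ge0 gK; have [r0 Hg] := gK.
split=> // n; have [D [M [DM MK gD]]] := Hg n.
exists D, M; split=> //.
  by rewrite (le_trans _ MK)// (majorant_le DM)// ltW.
move=> t tr; rewrite (le_trans (gD t (le_trans tr r'r)))// ler_wpM2l//.
rewrite lerXn2r ?nnegrE ?divr_ge0 ?cabs_ge0 ?(ltW r0) ?(ltW r'0)//.
by rewrite ler_wpM2l ?cabs_ge0// lef_pV2.
Qed.

Lemma le_geometric0 (a C q : R) : 0 <= q -> q < 1 ->
  (forall n, a <= C * q ^+ n) -> a <= 0.
Proof.
move=> q0 q1 H.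
have cv : (fun n => C * q ^+ n) @ \oo --> C * 0.
  by apply: cvgMr; apply: cvg_expr; rewrite ger0_norm.
rewrite -[leRHS](mulr0 C) -(cvg_lim _ cv)//.
by apply: limr_ge; [apply/cvg_ex; exists (C * 0)|near=> n; exact: H].
Unshelve. all: by end_near. Qed.

(** A zero that is not isolated forces every approximating polynomial to start at
    the order of its error. *)
Lemma poly_approx0_coef g K r n (D : {poly R[i]}) (M : {poly R}) : 0 < r -> 0 <= K ->
  (forall e : R, 0 < e -> exists t, [/\ 0 < cabs t, cabs t < e & g t = 0]) ->
  majorant D M -> M.[r] <= K ->
  (forall t, cabs t <= r -> cabs (g t - D.[t]) <= K * (cabs t / r) ^+ n) ->
  forall i, (i < n)%N -> D`_i = 0.
Proof.
move=> r0 K0 acc DM MK gD i.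
elim/ltn_ind: i => i IH i_n.
pose E := D - (D`_i)%:P * 'X^i.
have EM : majorant E M.
  move=> j; rewrite /E coefB coefCM coefXn.
  case: eqP => [->|_]; last by rewrite mulr0 subr0; exact: DM.
  by rewrite mulr1 subrr cabs0 (majorant_ge0 _ DM).
have E0 j : (j < i.+1)%N -> E`_j = 0.
  rewrite ltnS leq_eqVlt => /predU1P[->|ji]; rewrite /E coefB coefCM coefXn.
    by rewrite eqxx mulr1 subrr.
  by rewrite ltn_eqF// mulr0 subr0 IH// (ltn_trans ji).
apply/eqP/negPn/negP => di.
have di0 : 0 < cabs D`_i by rewrite cabs_gt0.
pose e := Num.min r (cabs D`_i * r ^+ i.+1 / (K + K + 1)).
have K1 : 0 < K + K + 1 by lra.
have e0 : 0 < e by rewrite lt_min r0 divr_gt0// mulr_gt0// exprn_gt0.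
have [u [u0 ue gu]] := acc _ e0.
have ur : cabs u <= r by rewrite ltW// (lt_le_trans ue)// ge_min lexx.
have ur1 : cabs u / r <= 1 by rewrite ler_pdivrMr// mul1r.
have Du : cabs D.[u] <= K * (cabs u / r) ^+ i.+1.
  have := gD _ ur; rewrite gu sub0r cabsN => /le_trans; apply.
  rewrite ler_wpM2l//; apply: ler_wiXn2l => //.
  by rewrite divr_ge0 ?cabs_ge0 ?ltW.
have Eu : cabs E.[u] <= K * (cabs u / r) ^+ i.+1.
  rewrite (le_trans (majorant_small EM r0 ur E0))// ler_wpM2r//.
  by rewrite exprn_ge0// divr_ge0 ?cabs_ge0 ?ltW.
have : cabs (D`_i * u ^+ i) <= (K + K) * (cabs u / r) ^+ i.+1.
  rewrite (_ : D`_i * u ^+ i = D.[u] - E.[u]).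
    by rewrite (le_trans (cabsB _ _))// mulrDl lerD.
  by rewrite /E !hornerE; ring.
rewrite cabsM cabsX expr_div_n mulrA ler_pdivlMr ?exprn_gt0//.
have ui : 0 < cabs u ^+ i by rewrite exprn_gt0.
rewrite [in leLHS]mulrAC [leRHS](_ : _ = ((K + K) * cabs u) * cabs u ^+ i);
  last by rewrite exprS mulrA.
rewrite ler_pM2r// leNgt => /negP; apply.
have : cabs u < cabs D`_i * r ^+ i.+1 / (K + K + 1).
  by rewrite (lt_le_trans ue)// ge_min lexx orbT.
rewrite ltr_pdivlMr// => /(le_lt_trans _); apply.
by rewrite mulrDr mulr1 [cabs u * _]mulrC lerDl ltW.
Qed.

(** Identity theorem: an accumulating zero kills every approximating polynomial up to the order
    of its error, so [g t] is smaller than every power of [cabs t / r]. *)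
Lemma poly_approx_eq0 g K r : poly_approx g K r ->
  (forall e : R, 0 < e -> exists t, [/\ 0 < cabs t, cabs t < e & g t = 0]) ->
  forall t, cabs t < r -> g t = 0.
Proof.
move=> gK; have K0 := poly_approx_ge0 gK; have [r0 Hg] := gK => acc t tr.
have small n : cabs (g t) <= (K + K) * (cabs t / r) ^+ n.
  have [D [M [DM MK gD]]] := Hg n.
  have D0 := poly_approx0_coef r0 K0 acc DM MK gD.
  rewrite -[g t](subrK D.[t]) mulrDl (le_trans (cabsD _ _))// lerD ?gD ?(ltW tr)//.
  rewrite (le_trans (majorant_small DM r0 (ltW tr) D0))// ler_wpM2r//.
  by rewrite exprn_ge0// divr_ge0 ?cabs_ge0// ltW.
apply/eqP; rewrite -cabs_eq0 eq_le cabs_ge0 andbT.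
rewrite leNgt; apply/negP => gt0.
have q0 : 0 <= cabs t / r by rewrite divr_ge0 ?cabs_ge0 ?ltW.
have q1 : cabs t / r < 1 by rewrite ltr_pdivrMr// mul1r.
by have := le_geometric0 q0 q1 small; rewrite leNgt gt0.
Qed.

Lemma cabs_exprB_le (x y : R[i]) r i : 0 < r -> cabs x <= r / 2 ->
  cabs y <= r / 2 -> cabs (x ^+ i - y ^+ i) <= r ^+ i / r * cabs (x - y).
Proof.
move=> r0 xr yr; case: i => [|i].
  by rewrite subrr cabs0 mulr_ge0 ?cabs_ge0// mulr_ge0 ?invr_ge0 ?ltW// exprn_gt0.
rewrite [r ^+ _]exprSr mulfK ?gt_eqF//; elim: i => [|i IH].
  by rewrite expr0 mul1r !expr1.
rewrite (_ : _ - _ = x * (x ^+ i.+1 - y ^+ i.+1) + (x - y) * y ^+ i.+1).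
  2: by rewrite ![_ ^+ i.+2]exprS; ring.
rewrite (le_trans (cabsD _ _))// !cabsM.
have -> : r ^+ i.+1 * cabs (x - y) =
    r / 2 * (r ^+ i * cabs (x - y)) + cabs (x - y) * (r / 2 * r ^+ i).
  by rewrite exprS; field.
apply: lerD; first by rewrite ler_pM ?cabs_ge0.
rewrite ler_wpM2l ?cabs_ge0// cabsX exprS.
rewrite ler_pM ?cabs_ge0 ?exprn_ge0 ?cabs_ge0// lerXn2r ?nnegrE ?cabs_ge0 ?ltW//.
by rewrite (le_lt_trans yr)// ltr_pdivrMr// mulr_natr mulr2n ltrDl.
Qed.

Lemma majorant_lipschitz (D : {poly R[i]}) M (x y : R[i]) r : majorant D M ->
  0 < r -> cabs x <= r / 2 -> cabs y <= r / 2 ->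
  cabs (D.[x] - D.[y]) <= M.[r] / r * cabs (x - y).
Proof.
move=> DM r0 xr yr; pose n := maxn (size D) (size M).
rewrite !(horner_coef_wide _ (leq_maxl (size D) (size M))) -/n.
rewrite (horner_coef_wide _ (leq_maxr (size D) (size M))) -/n.
rewrite -sumrB (le_trans (cabs_sum _ _ _))// !mulr_suml ler_sum// => i _.
rewrite -mulrBr cabsM -!mulrA ler_pM ?cabs_ge0//.
by rewrite mulrA; exact: cabs_exprB_le.
Qed.

Lemma geometric_partial (K : fieldType) n (t : K) : 1 - t != 0 ->
  t / (1 - t) - \sum_(i < n) t ^+ i.+1 = t ^+ n.+1 / (1 - t).
Proof.
move=> t1; elim: n => [|n IH]; first by rewrite big_ord0 subr0.
rewrite big_ord_recr /= opprD addrA IH -[X in _ - X](mulfK t1) -mulrBl.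
by congr (_ / _); rewrite [in RHS]exprSr; ring.
Qed.

Lemma cabs_ge1B t r : cabs t <= r -> 1 - r <= cabs (1 - t).
Proof.
move=> tr; rewrite lerBlDr -[leLHS](@cabs1 R) -{1}(subrK t 1).
by rewrite (le_trans (cabsD _ _))// lerD2l.
Qed.

Lemma neq1_cabs_lt1 t r : cabs t <= r -> r < 1 -> 1 - t != 0.
Proof.
by move=> tr r1; rewrite -cabs_gt0 (lt_le_trans _ (cabs_ge1B tr))// subr_gt0.
Qed.

(** The substitution replaces the geometric series by its partial sums, so it
    only composes polynomials. *)
Lemma poly_approx_mobius g K rho (c : R[i]) r : poly_approx g K rho ->
  cabs c = 1 -> 0 < r -> r < 1 -> r / (1 - r) <= rho / 2 ->
  poly_approx (fun t => g (c * (t / (1 - t)))) (K + K) r.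
Proof.
move=> gK c1 r0 r1 rrho; have K0 := poly_approx_ge0 gK; have [rho0 Hg] := gK.
split=> // n; have [D [M [DM MK gD]]] := Hg n.
pose J (S : nzRingType) : {poly S} := \sum_(i < n) 'X ^+ i.+1.
have JJ : majorant (J _) (J R).
  by apply: majorant_sum => i _; apply/majorant_exp/majorantX.
have JE (S : comNzRingType) (x : S) : (J S).[x] = \sum_(i < n) x ^+ i.+1.
  by rewrite horner_sum; apply: eq_bigr => i _; rewrite hornerXn.
have r10 : 0 < 1 - r by rewrite subr_gt0.
have Jr : (J R).[r] <= rho / 2.
  apply: le_trans rrho; rewrite JE -subr_ge0 geometric_partial ?gt_eqF//.
  by rewrite divr_ge0 ?exprn_ge0 ?ltW.
have Jr0 : 0 <= (J R).[r] := majorant_horner_ge0 JJ (ltW r0).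
have rho2 : rho / 2 <= rho by rewrite ler_pdivrMr// mulr_natr mulr2n lerDl ltW.
exists (D \Po (c%:P * J _)), (M \Po (1%:P * J _)); split.
- apply: majorant_comp => //; apply: majorantM => //.
  by apply: majorantC; rewrite c1.
- rewrite horner_comp hornerM hornerC mul1r.
  have : M.[rho] <= K + K by rewrite (le_trans MK)// lerDl.
  apply: le_trans; apply: (majorant_le DM) => //.
  exact: le_trans rho2.
move=> t tr; set h := c * (t / (1 - t)).
have t1 : 1 - t != 0 := neq1_cabs_lt1 tr r1.
have hle : cabs h <= cabs t / (1 - r).
  rewrite /h cabsM c1 mul1r cabsM cabsV ler_wpM2l ?cabs_ge0//.
  by rewrite lef_pV2 ?posrE ?cabs_gt0// cabs_ge1B.
have hrho : cabs h <= rho / 2.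
  by apply: le_trans rrho; apply: le_trans hle _; rewrite ler_wpM2r// invr_ge0 ltW.
rewrite horner_comp hornerM hornerC.
rewrite (_ : _ - _ = (g h - D.[h]) + (D.[h] - D.[c * (J _).[t]])); last by ring.
rewrite (le_trans (cabsD _ _))// mulrDl lerD//.
  rewrite (le_trans (gD _ _)) ?(le_trans hrho)// ler_wpM2l//.
  rewrite lerXn2r ?nnegrE ?divr_ge0 ?cabs_ge0 ?(ltW r0) ?(ltW rho0)//.
  rewrite ler_pdivrMr// (le_trans hle)// -mulrA ler_wpM2l ?cabs_ge0//.
  by rewrite mulrC ler_pdivlMr// mulrC (le_trans rrho).
have cJ : cabs (c * (J _).[t]) <= rho / 2.
  rewrite cabsM c1 mul1r (le_trans (majorant_horner _ JJ))//.
  by rewrite (le_trans _ Jr)// (majorant_le JJ)// cabs_ge0.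
rewrite (le_trans (majorant_lipschitz DM rho0 hrho cJ))//.
rewrite /h -mulrBr cabsM c1 mul1r JE geometric_partial// cabsM cabsV cabsX.
rewrite -mulrA ler_pM ?(majorant_horner_ge0 DM (ltW rho0))//.
  by rewrite mulr_ge0 ?invr_ge0 ?(ltW rho0)// divr_ge0 ?exprn_ge0 ?cabs_ge0.
rewrite mulrC ler_pdivrMr// exprS mulrAC.
have -> : cabs t ^+ n = r ^+ n * (cabs t / r) ^+ n.
  by rewrite expr_div_n mulrCA mulfV ?mulr1// expf_neq0// gt_eqF.
rewrite [leRHS]mulrC mulrA ler_wpM2r ?exprn_ge0 ?divr_ge0 ?cabs_ge0 ?(ltW r0)//.
rewrite -[leRHS]mulr1 ler_pM ?exprn_ge0 ?divr_ge0 ?cabs_ge0 ?(ltW r0)//.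
  apply: le_trans rho2; apply: le_trans rrho.
  rewrite ler_pM ?cabs_ge0 ?invr_ge0 ?cabs_ge0//.
  by rewrite lef_pV2 ?posrE ?cabs_gt0// cabs_ge1B.
by rewrite exprn_ile1 ?ltW.
Qed.

Lemma poly_approx_rot g K r (c : R[i]) : cabs c = 1 ->
  poly_approx g K r -> poly_approx (fun t => g (c * t)) K r.
Proof.
move=> c1 [r0 Hg]; split=> // n; have [D [M [DM MK gD]]] := Hg n.
exists (D \Po (c%:P * 'X)), (M \Po (1%:P * 'X)); split.
- apply: majorant_comp => //; apply: majorantM; last exact: majorantX.
  by apply: majorantC; rewrite c1.
- by rewrite mul1r comp_polyXr.
- move=> t tr; rewrite horner_comp hornerM hornerC hornerX.
  by rewrite (le_trans (gD _ _)) ?cabsM ?c1 ?mul1r.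
Qed.

(** Analyticity on the half-plane [Re s > -1], on every closed disc inside it. *)
Definition analytic_rhp (Phi : R[i] -> R[i]) := forall s0 rho,
  0 < rho -> rho < 1 + complex.Re s0 ->
  exists K, poly_approx (fun h => Phi (s0 + h)) K rho.

(** The map [s |-> s^-1] preserves the unit circle and exchanges nonnegative and nonpositive
    frequencies there. *)
Definition inversion_rel (Phi Psi : R[i] -> R[i]) s := s * Phi s = Psi s^-1.

Lemma Re_unimodularV (s : R[i]) : cabs s = 1 -> complex.Re s^-1 = complex.Re s.
Proof.
by move=> s1; rewrite cabsE in s1; case: s s1 => a b /= s1;
  rewrite -[a ^+ 2 + b ^+ 2]sqr_sqrtr ?addr_ge0 ?sqr_ge0// s1 expr1n divr1.
Qed.

(** Near a unimodular point both sides of the relation are analytic in the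
    single variable [t], with [s = s0 / (1 - t)] and [s^-1 = s0^-1 * (1 - t)]. *)
Lemma inversion_rel_local (Phi Psi : R[i] -> R[i]) (s0 : R[i]) (rho : R) :
  analytic_rhp Phi -> analytic_rhp Psi -> cabs s0 = 1 -> 0 < rho ->
  rho < 1 + complex.Re s0 ->
  (forall e : R, 0 < e -> exists t, [/\ 0 < cabs t, cabs t < e &
    inversion_rel Phi Psi (s0 / (1 - t))]) ->
  forall t, cabs t < rho / (2 + rho) -> inversion_rel Phi Psi (s0 / (1 - t)).
Proof.
move=> aPhi aPsi s1 rho0 rhos acc.
have s00 : s0 != 0 by rewrite -cabs_gt0 s1.
have sV1 : cabs s0^-1 = 1 by rewrite cabsV s1 invr1.
pose r := rho / (2 + rho).
have r0 : 0 < r by rewrite divr_gt0// addr_gt0.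
have r1 : r < 1 by rewrite ltr_pdivrMr ?addr_gt0// mul1r ltrDr.
have rrho : r / (1 - r) <= rho / 2.
  by rewrite /r le_eqVlt; apply/orP; left; apply/eqP; field; rewrite !gt_eqF; lra.
have rler : r <= rho.
  by rewrite ler_pdivrMr ?addr_gt0// ler_peMr ?ltW//; lra.
have [K PK] := aPhi _ _ rho0 rhos.
have [L PL] : exists L, poly_approx (fun h => Psi (s0^-1 + h)) L rho.
  by apply: aPsi => //; rewrite Re_unimodularV.
have P1 := poly_approxM (@majorantC _ s0 1 ltac:(by rewrite s1))
  (poly_approx_mobius PK s1 r0 r1 rrho).
have mX : majorant (1 - 'X : {poly R[i]}) (1 + 'X).
  by apply/majorantD; [apply: majorantC; rewrite cabs1|exact/majorantN/majorantX].
have P2 := poly_approxM mX (poly_approx_rot (c := - s0^-1)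
  ltac:(by rewrite cabsN) (poly_approx_shrink r0 rler PL)).
have P := poly_approxB P1 P2.
have relE t : cabs t < r -> (inversion_rel Phi Psi (s0 / (1 - t)) <->
    s0%:P.[t] * Phi (s0 + s0 * (t / (1 - t))) -
    (1 - 'X).[t] * Psi (s0^-1 + - s0^-1 * t) = 0).
  move=> tr; have t1 := neq1_cabs_lt1 (ltW tr) r1.
  rewrite hornerC (_ : (1 - 'X).[t] = 1 - t) /inversion_rel; last by rewrite !hornerE.
  have -> : s0 + s0 * (t / (1 - t)) = s0 / (1 - t) by field.
  have -> : s0^-1 + - s0^-1 * t = (s0 / (1 - t))^-1 by field; rewrite t1.
  set x := Phi _; set y := Psi _.
  split=> [<-|/eqP]; first by field.
  rewrite subr_eq0 => /eqP E; apply: (mulfI t1); rewrite -E; field; exact: t1.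
move=> t tr; apply/(relE t tr); apply: (poly_approx_eq0 P) => // e e0.
have [u [u0 ue ru]] := acc (Num.min e r) ltac:(by rewrite lt_min e0).
exists u; split => //; first by rewrite (lt_le_trans ue)// ge_min lexx.
by apply/relE => //; rewrite (lt_le_trans ue)// ge_min lexx orbT.
Qed.

Definition expi (x : R) : R[i] := Complex (cos x) (sin x).

Lemma expiE x : expi x = cexp (Complex 0 x).
Proof. by rewrite /cexp /= expR0 !mul1r. Qed.

Lemma expiD x y : expi (x + y) = expi x * expi y.
Proof. by rewrite !expiE -cexpD; congr cexp; apply: complexP; rewrite /= ?addr0. Qed.

Lemma cabs_expi x : cabs (expi x) = 1.
Proof. by rewrite expiE cabs_cexp expR0. Qed.

Lemma expi0 : expi 0 = 1. Proof. by rewrite /expi cos0 sin0. Qed.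

Lemma expi_neq0 x : expi x != 0. Proof. by rewrite -cabs_gt0 cabs_expi. Qed.

Lemma expiN x : expi (- x) = (expi x)^-1.
Proof.
by apply: (mulfI (expi_neq0 x)); rewrite -expiD subrr expi0 mulfV ?expi_neq0.
Qed.

Lemma expiMn x n : expi (x *+ n) = expi x ^+ n.
Proof. by elim: n => [|n IH]; rewrite ?mulr0n ?expi0// mulrS exprS expiD IH. Qed.

Lemma cabs_1Bexpi x : `|x| <= 1 -> cabs (1 - expi x) <= expR 1 * `|x|.
Proof.
move=> x1; rewrite cabs_distC.
have := cabs_cexp_rem 1 (Complex 0 x : R[i]).
rewrite /cexp_rem big_ord1 expr0 fact0 divr1 -expiE => /le_trans; apply.
rewrite cabsE /= expr0n add0r sqrtr_sqr.
have := @exp_rem_scale R 1 `|x| 1 (normr_ge0 _) x1 ler01.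
rewrite mulr1 expr1 mulrC => /le_trans; apply; rewrite ler_wpM2r//.
by rewrite /exp_rem big_ord1 expr0 fact0 divr1 gerBl.
Qed.

Lemma ge_cos (x y : R) : 0 <= x -> x <= y -> y <= pi -> cos y <= cos x.
Proof.
move=> x0 xy ypi; rewrite leNgt; apply/negP.
by rewrite ltr_cos ?in_itv/= ?x0 ?ypi ?(le_trans x0)//; lra.
Qed.

(** Continuation along the unit circle, from the positive real axis. The only obstruction is
    the point [-1], so on each arc that stops short of it a fixed step size works; [sg] chooses
    one of the two half-circles. *)
Lemma inversion_rel_arc (Phi Psi : R[i] -> R[i]) (sg : R) :
  analytic_rhp Phi -> analytic_rhp Psi -> sg = 1 \/ sg = - 1 ->
  (forall x : R, 0 < x -> inversion_rel Phi Psi x%:C%C) ->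
  forall a : R, 0 <= a -> a < pi -> inversion_rel Phi Psi (expi (sg * a)).
Proof.
move=> aPhi aPsi sg1 real a a0 api.
have cossg x : cos (sg * x) = cos x.
  by case: sg1 => ->; rewrite ?mul1r// mulN1r cosN.
have nsg x : `|sg * x| = `|x|.
  by case: sg1 => ->; rewrite ?mul1r// mulN1r normrN.
pose rho := (1 + cos a) / 2.
have rho0 : 0 < rho.
  rewrite divr_gt0// -ltrBlDl sub0r -cospi.
  by rewrite ltr_cos ?in_itv/= ?a0 ?(ltW api)// ?pi_ge0//= lexx.
have rhoa x : 0 <= x -> x <= a -> rho < 1 + cos x.
  move=> x0 xa; rewrite (@lt_le_trans _ _ (1 + cos a))//.
    by rewrite ltr_pdivrMr// mulr_natr mulr2n ltrDl; move: rho0; rewrite /rho; lra.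
  by rewrite lerD2l ge_cos ?(ltW api).
pose r := rho / (2 + rho).
have r0 : 0 < r by rewrite divr_gt0// addr_gt0.
have r1 : r < 1 by rewrite ltr_pdivrMr ?addr_gt0// mul1r ltrDr.
pose k : R := expR 1.
have k1 : 1 <= k by rewrite -expR0 ler_expR.
have k0 : 0 < k := lt_le_trans ltr01 k1.
pose delta := r / (k + k).
have d0 : 0 < delta by rewrite divr_gt0// addr_gt0.
have d1 : delta <= 1 by rewrite ler_pdivrMr ?addr_gt0//; lra.
have small e : 0 <= e -> e <= delta -> cabs (1 - expi (- (sg * e))) < r.
  move=> e0 ed; rewrite (le_lt_trans (cabs_1Bexpi _))// normrN nsg ger0_norm//.
    exact: le_trans d1.
  rewrite (le_lt_trans (ler_wpM2l (ltW k0) ed))//.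
  by rewrite /delta mulrCA gtr_pMr// ltr_pdivrMr ?addr_gt0// mul1r ltrDl.
have shift x e : expi (sg * x) / (1 - (1 - expi (- (sg * e)))) = expi (sg * (x + e)).
  by rewrite opprB addrCA subrr addr0 expiN invrK -expiD mulrDr.
have step x : 0 <= x -> x <= a -> (forall e, 0 < e -> exists t,
    [/\ 0 < cabs t, cabs t < e & inversion_rel Phi Psi (expi (sg * x) / (1 - t))]) ->
    forall e, 0 <= e -> e <= delta -> inversion_rel Phi Psi (expi (sg * (x + e))).
  move=> x0 xa acc e e0 ed; rewrite -shift.
  apply: (inversion_rel_local (rho := rho)) => //.
  - exact: cabs_expi.
  - by rewrite /expi /= cossg rhoa.
  - exact: small.
suff main n x : 0 <= x -> x <= a -> x <= delta *+ n.+1 ->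
    inversion_rel Phi Psi (expi (sg * x)).
  have [n nP] : exists n : nat, a <= delta *+ n.+1.
    exists (Num.truncn (a / delta)).
    rewrite -mulr_natl -ler_pdivrMr// ltW// truncnS_gt//.
  exact: main nP.
elim: n x => [|n IH] x x0 xa; rewrite ?mulr1n => xn.
  rewrite -[x]add0r; apply: step => // e e0; exists (Num.min (e / 2) (1 / 2))%:C%C.
  have m0 : 0 < Num.min (e / 2) (1 / 2) by rewrite lt_min !divr_gt0.
  have m1 : Num.min (e / 2) (1 / 2) < 1.
    by rewrite gt_min; apply/orP; right; lra.
  rewrite cabs_real gtr0_norm//; split => //.
    by rewrite gt_min; apply/orP; left; lra.
  rewrite mulr0 expi0 -rmorphB -fmorph_div /=.
  by apply: real; rewrite divr_gt0// subr_gt0.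
have [xd|dx] := leP x (delta *+ n.+1); first exact: IH.
pose y := x - delta.
have y0 : 0 < y.
  rewrite subr_gt0 (le_lt_trans _ dx)// -[leLHS]mulr1n.
  by rewrite ler_wpMn2l// ltW.
have xy : x = y + delta by rewrite /y subrK.
have yn : y <= delta *+ n.+1 by rewrite /y lerBlDr -mulrSr.
have yx : y <= x by rewrite gerBl ltW.
rewrite xy; apply: step => //; rewrite ?(ltW y0) ?(ltW d0) ?(le_trans yx)//.
move=> e e0; pose u := Num.min (e / (k + k)) (Num.min y 1).
have u0 : 0 < u by rewrite !lt_min y0 ltr01 divr_gt0// addr_gt0.
have u1 : u <= 1 by rewrite !ge_min lexx !orbT.
have uy : u <= y by rewrite !ge_min lexx !orbT.
have ue : k * u < e.
  have : u <= e / (k + k) by rewrite ge_min lexx.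
  rewrite ler_pdivlMr ?addr_gt0// => H.
  apply: lt_le_trans H; rewrite mulrC mulrDr ltrDl mulr_gt0//.
exists (1 - expi (- (sg * - u))); split.
- rewrite cabs_gt0 subr_eq0; apply/eqP => /(congr1 (@complex.Re R)) /=.
  rewrite -mulrN opprK cossg => /esym/eqP; apply/negP.
  rewrite lt_eqF// -[ltRHS](@cos0 R) ltr_cos ?in_itv/= ?lexx ?pi_ge0 ?(ltW u0)//=.
  by rewrite (le_trans u1)// (le_trans _ (pi_ge2 R))// ler1n.
- rewrite (le_lt_trans (cabs_1Bexpi _)) ?normrN ?nsg ?normrN ?gtr0_norm//.
- rewrite shift; apply: IH; rewrite ?subr_ge0//.
    by rewrite (le_trans _ xa)// (le_trans _ yx)// gerBl ltW.
  by rewrite (le_trans _ yn)// gerBl ltW.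
Qed.

Lemma poly_approx_lip g K r h : poly_approx g K r -> cabs h <= r / 2 ->
  cabs (g h - g 0) <= (K + K) / r * cabs h.
Proof.
move=> gK hr; have K0 := poly_approx_ge0 gK; have [r0 Hg] := gK.
have [D [M [DM MK gD]]] := Hg 1%N.
have r2 : 0 <= r / 2 by rewrite divr_ge0// ltW.
have hr' : cabs h <= r by rewrite (le_trans hr)// ler_pdivrMr// mulr_natr mulr2n lerDl ltW.
have g0 : g 0 = D.[0].
  have := gD 0; rewrite cabs0 mul0r expr1 mulr0 => /(_ (ltW r0)) H.
  by apply/eqP; rewrite -subr_eq0 -cabs_eq0 eq_le H cabs_ge0.
rewrite g0 (_ : _ - _ = (g h - D.[h]) + (D.[h] - D.[0])); last by ring.
rewrite (le_trans (cabsD _ _))// mulrDl mulrDl lerD//.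
  by rewrite (le_trans (gD _ hr'))// expr1 mulrA mulrAC.
rewrite (le_trans (majorant_lipschitz DM r0 hr _)) ?cabs0// subr0.
by rewrite ler_wpM2r ?cabs_ge0// ler_wpM2r// invr_ge0 ltW.
Qed.

Definition continuous_at (F : R[i] -> R[i]) s := forall e : R, 0 < e ->
  exists2 d : R, 0 < d & forall h, cabs h <= d -> cabs (F (s + h) - F s) <= e.

Lemma analytic_rhp_continuous Phi (P : {poly R[i]}) (s : R[i]) : analytic_rhp Phi ->
  -1 < complex.Re s -> continuous_at (fun z => P.[z] * Phi z) s.
Proof.
move=> aPhi s1 e e0.
have rho0 : 0 < (1 + complex.Re s) / 2 by lra.
have [K PK] := aPhi s _ rho0 ltac:(lra).
have mP : majorant (P \Po (s%:P + 'X)) (\poly_(i < size (P \Po (s%:P + 'X)))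
    cabs (P \Po (s%:P + 'X))`_i).
  move=> i; rewrite coef_poly; case: ltnP => // si.
  by rewrite nth_default// cabs0.
have PP := poly_approxM mP PK.
set rho := (X in poly_approx _ _ X) in PP; set L := (X in poly_approx _ X _) in PP.
have L0 := poly_approx_ge0 PP.
have L1 : 0 < L + L + 1 by lra.
exists (Num.min (rho / 2) (e * rho / (L + L + 1))).
  rewrite lt_min; apply/andP; split; first exact: (divr_gt0 rho0).
  by apply: divr_gt0 => //; exact: mulr_gt0.
move=> h hd.
have h1 : cabs h <= rho / 2 by rewrite (le_trans hd)// ge_min lexx.
have h2 : cabs h <= e * rho / (L + L + 1) by rewrite (le_trans hd)// ge_min lexx orbT.
have := poly_approx_lip PP h1.
rewrite !horner_comp !hornerD !hornerC !hornerX !addr0 => /le_trans; apply.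
rewrite mulrAC ler_pdivrMr//; move: h2; rewrite ler_pdivlMr// => /(le_trans _); apply.
by rewrite mulrC ler_wpM2l ?cabs_ge0// lerDl.
Qed.

Lemma uniform_radius m (P : 'I_m -> R -> Prop) :
  (forall j, exists2 d : R, 0 < d & forall x, 0 < x -> x <= d -> P j x) ->
  exists2 d : R, 0 < d & forall x j, 0 < x -> x <= d -> P j x.
Proof.
elim: m P => [|m IH] P H; first by exists 1 => // x [].
have [d d0 dP] := IH (fun j => P (lift ord0 j)) (fun j => H _).
have [d' d'0 d'P] := H ord0.
exists (Num.min d d'); first by rewrite lt_min d0.
move=> x j x0; rewrite le_min => /andP[xd xd'].
by case: (unliftP ord0 j) => [k ->|->]; [exact: dP|exact: d'P].
Qed.

Lemma root_average (m : nat) (z : R[i]) : (0 < m)%N -> z ^+ m = 1 ->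
  (\sum_(j < m) z ^+ j) / m%:R = (z == 1)%:R.
Proof.
move=> m0 zm; have m0' : m%:R != 0 :> R[i] by rewrite pnatr_eq0 -lt0n.
have [->|z1] := eqVneq z 1.
  under eq_bigr do rewrite expr1n.
  by rewrite sumr_const card_ord mulfV.
have : (z - 1) * (\sum_(j < m) z ^+ j) = 0 by rewrite -subrX1 zm subrr.
by move/eqP; rewrite mulf_eq0 subr_eq0 (negPf z1)/= => /eqP ->; rewrite mul0r.
Qed.

Lemma expi_neq1 (x : R) : 0 < x -> x < pi *+ 2 -> expi x != 1.
Proof.
move=> x0 xpi; apply/eqP => /(congr1 (@complex.Re R)) /=.
have -> : x = x / 2 + x / 2 by lra.
rewrite cosD -!expr2; have := @cos2Dsin2 R (x / 2) => E H.
have : 0 < sin (x / 2) by apply: sin_gt0_pi; apply/andP; split; lra.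
have : 0 < sin (x / 2) -> 0 < sin (x / 2) ^+ 2 by move=> h; rewrite exprn_gt0.
by move=> h /h; lra.
Qed.

Lemma expi_2pi : expi (pi *+ 2) = 1.
Proof. by rewrite /expi cos2pi sin2pi. Qed.

Lemma expi_root_eq1 m n : (0 < n < m)%N -> expi (pi *+ 2 / m%:R) ^+ n != 1.
Proof.
move=> /andP[n0 nm]; have m0 : 0 < m%:R :> R by rewrite ltr0n (leq_ltn_trans _ nm).
rewrite -expiMn -[_ *+ n]mulr_natr; apply: expi_neq1.
  by rewrite mulr_gt0 ?ltr0n// divr_gt0// mulrn_wgt0// pi_gt0.
by rewrite mulrAC ltr_pdivrMr// ltr_pM2l ?ltr_nat// mulrn_wgt0// pi_gt0.
Qed.

Lemma expi_root m : (0 < m)%N -> expi (pi *+ 2 / m%:R) ^+ m = 1.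
Proof.
by move=> m0; rewrite -expiMn -[_ *+ m]mulr_natr divfK ?expi_2pi// pnatr_eq0 -lt0n.
Qed.

Definition psum (p : nat -> R[i]) n : {poly R[i]} := \poly_(i < n) p i.

(** Power series expansion in the unit disc, in the style of [poly_approx]. *)
Definition series_at0 (Phi : R[i] -> R[i]) (p : nat -> R[i]) :=
  forall r : R, 0 < r -> r < 1 -> exists K, forall n, exists M,
    [/\ majorant (psum p n) M, M.[r] <= K & forall z, cabs z <= r ->
        cabs (Phi z - (psum p n).[z]) <= K * (cabs z / r) ^+ n].

Definition mulc (P : {poly R[i]}) (p : nat -> R[i]) n : R[i] :=
  \sum_(j < n.+1) P`_j * p (n - j)%N.

Lemma series_at0M Phi p (P : {poly R[i]}) : series_at0 Phi p ->
  series_at0 (fun z => P.[z] * Phi z) (mulc P p).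
Proof.
move=> H r r0 r1; have [K HK] := H r r0 r1.
pose Q : {poly R} := \poly_(i < size P) cabs P`_i.
have PQ : majorant P Q.
  move=> i; rewrite coef_poly; case: ltnP => // si.
  by rewrite nth_default// cabs0.
have Q0 := majorant_horner_ge0 PQ (ltW r0).
exists (Q.[r] * K + Q.[r] * K) => n; have [M [pM MK pPhi]] := HK n.
have K0 : 0 <= K := le_trans (majorant_horner_ge0 pM (ltW r0)) MK.
have QM := majorantM PQ pM.
have QMr : (Q * M).[r] <= Q.[r] * K by rewrite hornerM ler_wpM2l.
have coefE i : (i < n)%N -> (P * psum p n)`_i = mulc P p i.
  move=> i_n; rewrite coefM; apply: eq_bigr => j _.
  by rewrite coef_poly (leq_ltn_trans _ i_n)// leq_subr.
have psE i : (psum (mulc P p) n)`_i = if (i < n)%N then (P * psum p n)`_i else 0.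
  by rewrite coef_poly; case: ltnP => // /coefE ->.
exists (Q * M); split.
- move=> i; rewrite psE; case: ifP => _; first exact: QM.
  by rewrite cabs0 (majorant_ge0 _ QM).
- by rewrite (le_trans QMr)// lerDl mulr_ge0.
move=> z zr; set E := P * psum p n - psum (mulc P p) n.
have EM : majorant E (Q * M).
  move=> i; rewrite coefB psE; case: ifP => _.
    by rewrite subrr cabs0 (majorant_ge0 _ QM).
  by rewrite subr0; exact: QM.
have E0 i : (i < n)%N -> E`_i = 0 by move=> i_n; rewrite coefB psE i_n subrr.
rewrite (_ : _ - _ = P.[z] * (Phi z - (psum p n).[z]) + E.[z]); last first.
  by rewrite /E hornerD hornerN hornerM; ring.
rewrite (le_trans (cabsD _ _))// mulrDl lerD//.
  rewrite cabsM -mulrA ler_pM ?cabs_ge0 ?pPhi//.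
  by rewrite (le_trans (majorant_horner _ PQ))// (majorant_le PQ)// cabs_ge0.
rewrite (le_trans (majorant_small EM r0 zr E0))// ler_wpM2r//.
by rewrite exprn_ge0// divr_ge0 ?cabs_ge0 ?(ltW r0).
Qed.

(** Averages over the [m]-th roots of unity extract coefficients, up to the tail of the series. *)
Lemma root_average_series F a (v : R[i]) (m q l : nat) (e r : R) :
  (0 < m)%N -> v ^+ m = 1 -> cabs v = 1 -> series_at0 F a ->
  (forall n, \sum_(q <= i < n) cabs (a i) <= e) -> 0 < r -> r < 1 ->
  cabs ((\sum_(j < m) F (r%:C%C * v ^+ j) * v ^+ (j * l)) / m%:R -
     \sum_(i < q | v ^+ (i + l) == 1) a i * (r%:C%C) ^+ i) <= e.
Proof.
move=> m0 vm v1 Fa tail r0 r1.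
have m0' : m%:R != 0 :> R[i] by rewrite pnatr_eq0 -lt0n.
have m0R : 0 < m%:R :> R by rewrite ltr0n.
pose r' := (1 + r) / 2.
have rr' : r < r' by rewrite /r'; lra.
have r'0 : 0 < r' by rewrite (lt_trans r0).
have [K HK] := Fa r' r'0 ltac:(rewrite /r'; lra).
have main n : (q <= n)%N ->
    cabs ((\sum_(j < m) F (r%:C%C * v ^+ j) * v ^+ (j * l)) / m%:R -
     \sum_(i < q | v ^+ (i + l) == 1) a i * (r%:C%C) ^+ i) - e <= K * (r / r') ^+ n.
  move=> qn; have [M [_ _ FM]] := HK n.
  have cv j : cabs (r%:C%C * v ^+ j) = r.
    by rewrite cabsM cabsX v1 expr1n mulr1 cabs_real gtr0_norm.
  rewrite (_ : _ - _ = (\sum_(j < m) (F (r%:C%C * v ^+ j) -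
       (psum a n).[r%:C%C * v ^+ j]) * v ^+ (j * l)) / m%:R +
     \sum_(q <= i < n) (a i * (r%:C%C) ^+ i) * (v ^+ (i + l) == 1)%:R).
    rewrite lerBlDr (le_trans (cabsD _ _))// lerD//.
      rewrite cabsM cabsV cabs_nat ler_pdivrMr// (le_trans (cabs_sum _ _ _))//.
      have -> : K * (r / r') ^+ n * m%:R = \sum_(j < m) K * (r / r') ^+ n.
        by rewrite sumr_const card_ord mulr_natr.
      rewrite ler_sum// => j _.
      rewrite cabsM cabsX v1 expr1n mulr1.
      by have := FM (r%:C%C * v ^+ j); rewrite cv; apply; exact: ltW.
    apply: le_trans (tail n); rewrite (le_trans (cabs_sum _ _ _))// ler_sum// => i _.
    rewrite !cabsM -mulrA ler_piMr ?cabs_ge0// cabsX cabs_real gtr0_norm//.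
    by rewrite mulr_ile1 ?exprn_ge0 ?exprn_ile1 ?cabs_ge0 ?(ltW r0) ?(ltW r1)//
       cabs_nat lern1; case: (_ == _).
  under [in RHS]eq_bigr do rewrite mulrBl.
  rewrite sumrB mulrBl -[RHS]addrA; congr (_ + _).
  have -> : (\sum_(j < m) (psum a n).[r%:C%C * v ^+ j] * v ^+ (j * l)) / m%:R =
     \sum_(0 <= i < n) (a i * (r%:C%C) ^+ i) * (v ^+ (i + l) == 1)%:R.
    rewrite (eq_bigr (fun j : 'I_m => \sum_(0 <= i < n) (a i * (r%:C%C) ^+ i) *
        (v ^+ (i + l)) ^+ j)).
      rewrite exchange_big /= mulr_suml; apply: eq_bigr => i _.
      rewrite -mulr_sumr -[LHS]mulrA; congr (_ * _); apply: root_average => //.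
      by rewrite -exprM mulnC exprM vm expr1n.
    move=> j _; rewrite horner_poly mulr_suml big_mkord; apply: eq_bigr => i _.
    by rewrite exprMn -!exprM -!mulrA -exprD; congr (_ * (_ * _ ^+ _)); lia.
  rewrite (big_cat_nat (leq0n q) qn)//= opprD -addrA addNr addr0 big_mkord.
  rewrite [in LHS]big_mkcond /=; congr (- _); apply: eq_bigr => i _.
  by case: eqP; rewrite ?mulr1 ?mulr0.
rewrite -subr_le0.
have K0 : 0 <= K * (r / r') ^+ q.
  have [M [_ _ FM]] := HK q.
  have := FM (r%:C%C * v ^+ 0); rewrite expr0 mulr1 cabs_real gtr0_norm// => /(_ (ltW rr')).
  exact: le_trans (cabs_ge0 _).
apply: (@le_geometric0 _ (K * (r / r') ^+ q) (r / r')).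
- by rewrite divr_ge0// ltW.
- by rewrite ltr_pdivrMr// mul1r.
- by move=> n; rewrite -mulrA -exprD; apply: main; exact: leq_addr.
Qed.

Definition summable_coef (a : nat -> R[i]) := forall e : R, 0 < e ->
  exists m0, forall m n, (m0 <= m)%N -> \sum_(m <= i < n) cabs (a i) <= e.

(** The roots of unity of odd order avoid the singular point [-1]. *)
Lemma odd_root_arc m j : (j < m.*2.+1)%N -> exists sg a : R,
  [/\ sg = 1 \/ sg = -1, 0 <= a, a < pi &
      expi (pi *+ 2 / m.*2.+1%:R) ^+ j = expi (sg * a)].
Proof.
set M := m.*2.+1 => jM; have M0 : 0 < M%:R :> R by rewrite ltr0n.
have pi0 := @pi_gt0 R.
have t0 : 0 <= (pi : R) *+ 2 / M%:R.
  by apply: divr_ge0; [apply: mulrn_wge0; exact: ltW|exact: ltW].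
have [jm|mj] := leqP j m.
  exists 1, (pi *+ 2 / M%:R *+ j); split; first by left.
  - exact: mulrn_wge0.
  - rewrite -[_ *+ j]mulr_natr mulrAC ltr_pdivrMr// -[pi *+ 2]mulr_natr -mulrA.
    rewrite ltr_pM2l// -natrM ltr_nat /M; lia.
  - by rewrite mul1r -expiMn.
exists (-1), (pi *+ 2 / M%:R *+ (M - j)); split; first by right.
- exact: mulrn_wge0.
- rewrite -[_ *+ (M - j)]mulr_natr mulrAC ltr_pdivrMr// -[pi *+ 2]mulr_natr -mulrA.
  rewrite ltr_pM2l// -natrM ltr_nat /M; lia.
- rewrite mulN1r expiN expiMn; apply: (mulIf (x := expi (pi *+ 2 / M%:R) ^+ (M - j))).
    by rewrite expf_neq0// expi_neq0.
  by rewrite mulVf ?expf_neq0 ?expi_neq0// -exprD subnKC ?expi_root// ltnW.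
Qed.

Lemma bernoulli_le n (x : R) : 0 <= x -> x <= 1 -> 1 - x *+ n <= (1 - x) ^+ n.
Proof.
move=> x0 x1; elim: n => [|n IH]; first by rewrite mulr0n subr0.
rewrite exprS (le_trans _ (ler_wpM2l _ IH)) ?subr_ge0// mulrS.
have : 0 <= x * (x *+ n) by rewrite mulr_ge0// mulrn_wge0.
lra.
Qed.

Lemma expr_sub_root (s : R[i]) m k : s != 0 -> s ^+ m = 1 -> (k <= m)%N ->
  s ^+ (m - k) = s^-1 ^+ k.
Proof.
move=> s0 sm km; rewrite exprVn; apply: (mulIf (expf_neq0 k s0)).
by rewrite [RHS]mulVf ?expf_neq0// -exprD subnK.
Qed.

Lemma le_sum4 (x1 x2 x3 y e : R) :
  y <= x1 + x2 -> x1 <= e -> x2 <= e -> x3 <= e -> y + x3 + e <= e *+ 4.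
Proof. by lra. Qed.

Lemma le_quarter (x y : R) : x * 2^-1 <= (y / 8) *+ 4 -> x <= y.
Proof. by lra. Qed.

(** On the unit circle the relation reads [(1 + z)^4 Phi z = z^3 (1 + z^-1)^4 Psi z^-1]. The
    factor [(1 + z)^4] tames both sides at the only singular point [-1], so that their boundary
    values are sums of absolutely convergent series, with frequencies [>= 0] on the left and
    [<= 3] on the right. Frequencies are compared by averaging over roots of unity. *)
Lemma inversion_rel_polynomial (Phi Psi : R[i] -> R[i]) (p q : nat -> R[i]) :
  analytic_rhp Phi -> analytic_rhp Psi -> series_at0 Phi p -> series_at0 Psi q ->
  summable_coef (mulc ((1 + 'X) ^+ 4) p) ->
  summable_coef (mulc ((1 + 'X) ^+ 4) q) ->
  (forall x : R, 0 < x -> inversion_rel Phi Psi x%:C%C) ->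
  exists2 P : {poly R[i]}, (size P <= 4)%N &
    forall z, cabs z < 1 -> (1 + z) ^+ 4 * Phi z = P.[z].
Proof.
move=> aPhi aPsi pPhi qPsi sp sq real.
pose X4 : {poly R[i]} := (1 + 'X) ^+ 4.
have X4E z : X4.[z] = (1 + z) ^+ 4 by rewrite /X4 !hornerE.
pose a := mulc X4 p; pose b := mulc X4 q.
pose F z := X4.[z] * Phi z; pose G z := X4.[z] * Psi z.
have Fa : series_at0 F a by exact: series_at0M.
have Gb : series_at0 G b by exact: series_at0M.
suff a0 k : (3 < k)%N -> a k = 0.
  exists (psum a 4); first exact: size_poly.
  move=> z z1; rewrite -X4E -/(F z).
  pose r := (1 + cabs z) / 2.
  have r0 : 0 < r by rewrite /r; have := cabs_ge0 z; lra.
  have r1 : r < 1 by rewrite /r; lra.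
  have zr : cabs z < r by rewrite /r; lra.
  have [K HK] := Fa r r0 r1.
  apply/eqP; rewrite -subr_eq0 -cabs_eq0 eq_le cabs_ge0 andbT.
  apply: (@le_geometric0 _ (K * (cabs z / r) ^+ 4) (cabs z / r)).
  - by rewrite divr_ge0 ?cabs_ge0 ?ltW.
  - by rewrite ltr_pdivrMr// mul1r.
  - move=> n; rewrite -mulrA -exprD; have [M [_ _ FM]] := HK (4 + n)%N.
    have -> : psum a 4 = psum a (4 + n).
      apply/polyP => i; rewrite !coef_poly; case: (ltnP i 4) => i4.
        by rewrite (leq_trans i4)// leq_addr.
      by case: ifP => // _; rewrite a0.
    exact/FM/ltW.
move=> k3; apply/eqP; rewrite -cabs_eq0 eq_le cabs_ge0 andbT.
apply/ler_addgt0Pr => e8 e80; rewrite add0r.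
(* four errors of size [e], and a factor [2] because [r ^+ k >= 1 / 2] *)
pose e := e8 / 8; have e0 : 0 < e by rewrite divr_gt0.
have [ma maP] := sp e e0; have [mb mbP] := sq e e0.
have [m [m0 km mma mmb marc]] : exists m, [/\ (0 < m)%N, (k < m)%N, (ma <= m)%N,
    (mb <= m - (k - 3))%N & forall j, (j < m)%N -> exists sg x : R,
    [/\ sg = 1 \/ sg = -1, 0 <= x, x < pi &
        expi (pi *+ 2 / m%:R) ^+ j = expi (sg * x)]].
  (* odd, so that no root of unity is [-1] *)
  exists (ma + mb + k).*2.+1; split=> //; try lia.
  by move=> j; exact: odd_root_arc.
pose w : R[i] := expi (pi *+ 2 / m%:R).
have wm : w ^+ m = 1 by exact: expi_root.
have w0 : w != 0 by exact: expi_neq0.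
have w1 : cabs w = 1 by exact: cabs_expi.
have wn n : (0 < n < m)%N -> w ^+ n != 1 by exact: expi_root_eq1.
pose v := w^-1.
have vX n : v ^+ n = (w ^+ n)^-1 by rewrite exprVn.
have vm : v ^+ m = 1 by rewrite vX wm invr1.
have v1 : cabs v = 1 by rewrite cabsV w1 invr1.
have arc j : (j < m)%N -> -1 < complex.Re (w ^+ j) /\ inversion_rel Phi Psi (w ^+ j).
  move=> jm; have [sg [x [sg1 x0 xpi ->]]] := marc j jm; split.
    have -> : complex.Re (expi (sg * x)) = cos x.
      by case: sg1 => ->; rewrite /= ?mul1r// mulN1r cosN.
    by rewrite -cospi ltr_cos ?in_itv/= ?x0 ?(ltW xpi)// ?pi_ge0//= lexx.
  exact: (inversion_rel_arc aPhi aPsi sg1 real).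
have [d d0 dP] : exists2 d : R, 0 < d & forall x (j : 'I_m), 0 < x -> x <= d ->
    cabs (F ((1 - x)%:C%C * w ^+ j) - F (w ^+ j)) <= e /\
    cabs (G ((1 - x)%:C%C * v ^+ j) - G (v ^+ j)) <= e.
  apply: uniform_radius => j; have [Rj _] := arc j (ltn_ord j).
  have Rv : -1 < complex.Re (v ^+ j).
    by rewrite vX Re_unimodularV// cabsX w1 expr1n.
  have [d1 d10 d1P] := analytic_rhp_continuous X4 aPhi Rj e0.
  have [d2 d20 d2P] := analytic_rhp_continuous X4 aPsi Rv e0.
  exists (Num.min d1 d2); first by rewrite lt_min d10.
  move=> x x0; rewrite le_min => /andP[xd1 xd2].
  have E (u : R[i]) : (1 - x)%:C%C * u = u + (- x)%:C%C * u.
    by rewrite !rmorphD !rmorphN rmorph1; ring.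
  by split; rewrite E; [apply: d1P|apply: d2P];
    rewrite cabsM cabs_real normrN cabsX ?w1 ?v1 expr1n mulr1 gtr0_norm.
have kR : 0 < k.+1.*2%:R :> R by rewrite ltr0n.
pose x := Num.min d (k.+1.*2%:R)^-1; pose r : R := 1 - x.
have x0 : 0 < x by rewrite lt_min d0 invr_gt0.
have x2 : x <= 2^-1.
  rewrite ge_min; apply/orP; right.
  by rewrite lef_pV2 ?posrE// ler_nat doubleS.
have r0 : 0 < r by rewrite /r; lra.
have r1 : r < 1 by rewrite /r; lra.
have rk : 2^-1 <= r ^+ k.
  apply: le_trans (bernoulli_le k (ltW x0) _); last by lra.
  suff : x *+ k <= 2^-1 by lra.
  rewrite -[x *+ k]mulr_natr -ler_pdivlMr ?ltr0n ?(leq_trans _ k3)//.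
  rewrite -invfM ge_min; apply/orP; right.
  rewrite lef_pV2 ?posrE ?mulr_gt0 ?ltr0n ?(leq_trans _ k3)//.
  by rewrite -natrM ler_nat mul2n leq_double.
pose avF y := (\sum_(j < m) F (y%:C%C * w ^+ j) * w ^+ (j * (m - k))) / m%:R.
pose avG y := (\sum_(j < m) G (y%:C%C * v ^+ j) * v ^+ (j * (k - 3))) / m%:R.
have m0R : 0 < m%:R :> R by rewrite ltr0n.
have avFe : cabs (avF r - avF 1) <= e.
  rewrite /avF -mulrBl -sumrB cabsM cabsV cabs_nat ler_pdivrMr//.
  rewrite (le_trans (cabs_sum _ _ _))//.
  have -> : e * m%:R = \sum_(j < m) e by rewrite sumr_const card_ord mulr_natr.
  rewrite ler_sum// => j _; rewrite -mulrBl cabsM cabsX w1 expr1n mulr1 mul1r.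
  by have [] := dP x j x0; rewrite ?ge_min ?lexx.
have avGe : cabs (avG r - avG 1) <= e.
  rewrite /avG -mulrBl -sumrB cabsM cabsV cabs_nat ler_pdivrMr//.
  rewrite (le_trans (cabs_sum _ _ _))//.
  have -> : e * m%:R = \sum_(j < m) e by rewrite sumr_const card_ord mulr_natr.
  rewrite ler_sum// => j _; rewrite -mulrBl cabsM cabsX v1 expr1n mulr1 mul1r.
  by have [] := dP x j x0; rewrite ?ge_min ?lexx.
have avFG : avF 1 = avG 1.
  have one : (1 : R)%:C%C = 1 :> R[i] by exact: rmorph1.
  rewrite /avF /avG one; apply: (congr1 (fun z => z / m%:R)); apply: eq_bigr => j _.
  rewrite (mul1r (w ^+ j)) (mul1r (v ^+ j)).
  have [_ rel] := arc j (ltn_ord j).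
  rewrite /F /G !X4E !vX -rel !exprM; set s := w ^+ j.
  rewrite -[s ^- (k - 3)]exprVn.
  have s0 : s != 0 by rewrite expf_neq0.
  have -> : s ^+ (m - k) = s^-1 ^+ k.
    apply: expr_sub_root => //; last exact: ltnW.
    by rewrite /s -exprM mulnC exprM wm expr1n.
  have -> : s^-1 ^+ k = s^-1 ^+ 3 * s^-1 ^+ (k - 3) by rewrite -exprD subnKC// ltnW.
  by move: (s^-1 ^+ (k - 3)) => y; rewrite !exprVn; field.
have Fk : cabs (avF r - a k * r%:C%C ^+ k) <= e.
  have := @root_average_series F a w m m (m - k)%N e r m0 wm w1 Fa
    (fun n => maP m n mma) r0 r1.
  have eqi (i : 'I_m) : (w ^+ (i + (m - k)) == 1) = (i == Ordinal km).
    rewrite -val_eqE /=; apply/idP/idP => [|/eqP ->]; last first.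
      by rewrite subnKC ?wm// ltnW.
    apply: contraLR => ik; have im := ltn_ord i.
    have [ki|ki] := ltnP k i.
      have -> : (i + (m - k) = m + (i - k))%N by clear -ki km; lia.
      by rewrite exprD wm mul1r; apply: wn; clear -ki im; lia.
    by apply: wn; clear -ki ik km; lia.
  by rewrite (eq_bigl _ _ eqi) big_pred1_eq.
have Gk : cabs (avG r) <= e.
  have := @root_average_series G b v m (m - (k - 3))%N (k - 3)%N e r m0 vm v1 Gb
    (fun n => mbP (m - (k - 3))%N n mmb) r0 r1.
  have eqi (i : 'I_(m - (k - 3))) : (v ^+ (i + (k - 3)) == 1) = false.
    by apply/negbTE; rewrite vX invr_eq1; apply: wn; have := ltn_ord i; clear -k3 km; lia.
  by rewrite (eq_bigl _ _ eqi) big_pred0_eq subr0.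
have : cabs (a k * r%:C%C ^+ k) <= e *+ 4.
  rewrite (_ : a k * _ = (avF r - avF 1) - (avG r - avG 1) -
     (avF r - a k * r%:C%C ^+ k) + avG r); last by rewrite avFG; ring.
  rewrite (le_trans (cabsD _ _))// (le_trans (lerD (cabsB _ _) Gk))//.
  exact: (le_sum4 (cabsB (avF r - avF 1) (avG r - avG 1)) avFe avGe Fk).
rewrite cabsM cabsX cabs_real gtr0_norm// => H.
have H1 := le_trans (ler_wpM2l (cabs_ge0 (a k)) rk) H.
exact: (le_quarter H1).
Qed.

End LocalAnalyticity.

(** * Real and complex integrals *)

Section RealIntegral.
Context d (T : measurableType d) (R : realType) (mu : {measure set T -> \bar R}).
Implicit Types f g : T -> R.

Definition rintegrable f := mu.-integrable setT (EFin \o f).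

Lemma rintegrable_meas f : rintegrable f -> measurable_fun setT f.
Proof. by move=> /measurable_int /measurable_EFinP. Qed.

Lemma rintegrable_le f g : measurable_fun setT f -> rintegrable g ->
  (forall x, `|f x| <= g x) -> rintegrable f.
Proof.
move=> mf ig fg; apply: le_integrable ig => //; first exact/measurable_EFinP.
by move=> x _ /=; rewrite lee_fin (le_trans (fg x))// ler_norm.
Qed.

Lemma rintegrableD f g : rintegrable f -> rintegrable g ->
  rintegrable (fun x => f x + g x).
Proof.
move=> /integrableD i /i -/(_ measurableT) h.
by apply: eq_integrable h => // x _ /=; rewrite EFinD.
Qed.

Lemma rintegrableZ (c : R) f : rintegrable f -> rintegrable (fun x => c * f x).
Proof.
by move=> i; apply: eq_integrable (integrableZl measurableT c i).
Qed.

Lemma rintegrableN f : rintegrable f -> rintegrable (fun x => - f x).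
Proof.
by move=> /(rintegrableZ (-1)); under eq_fun do rewrite mulN1r.
Qed.

Lemma rintegrableB f g : rintegrable f -> rintegrable g ->
  rintegrable (fun x => f x - g x).
Proof. by move=> i j; apply: rintegrableD => //; exact: rintegrableN. Qed.

Lemma rintegrable0 : rintegrable (fun=> 0).
Proof. exact: integrable0. Qed.

Lemma rintegrable_sum I (s : seq I) (P : pred I) (F : I -> T -> R) :
  (forall i, P i -> rintegrable (F i)) ->
  rintegrable (fun x => \sum_(i <- s | P i) F i x).
Proof.
move=> H; elim: s => [|i s IH].
  by under eq_fun do rewrite big_nil; exact: rintegrable0.
under eq_fun do rewrite big_cons; case: (boolP (P i)) => // Pi.
by apply: rintegrableD => //; exact: H.
Qed.

Lemma rintD f g : rintegrable f -> rintegrable g ->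
  (\int[mu]_x (f x + g x) = \int[mu]_x f x + \int[mu]_x g x)%R.
Proof. by move=> i j; rewrite RintegralD. Qed.

Lemma rintZ (c : R) f : rintegrable f ->
  (\int[mu]_x (c * f x) = c * \int[mu]_x f x)%R.
Proof. by move=> i; rewrite RintegralZl. Qed.

Lemma rintB f g : rintegrable f -> rintegrable g ->
  (\int[mu]_x (f x - g x) = \int[mu]_x f x - \int[mu]_x g x)%R.
Proof. by move=> i j; rewrite RintegralB. Qed.

Lemma rint0 : (\int[mu]_x (0 : R) = 0)%R.
Proof. by rewrite /Rintegral integral0. Qed.

Lemma rint_sum I (s : seq I) (P : pred I) (F : I -> T -> R) :
  (forall i, P i -> rintegrable (F i)) ->
  (\int[mu]_x (\sum_(i <- s | P i) F i x) = \sum_(i <- s | P i) \int[mu]_x F i x)%R.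
Proof.
move=> H; elim: s => [|i s IH].
  by rewrite big_nil; under eq_Rintegral do rewrite big_nil; exact: rint0.
rewrite big_cons; under eq_Rintegral do rewrite big_cons.
case: (boolP (P i)) => // Pi; rewrite rintD ?IH//; first exact: H.
exact: rintegrable_sum.
Qed.

Lemma rint_le f g : rintegrable f -> rintegrable g -> (forall x, f x <= g x) ->
  (\int[mu]_x f x <= \int[mu]_x g x)%R.
Proof. by move=> i j H; apply: le_Rintegral. Qed.

Lemma rint_ge0 f : (forall x, 0 <= f x) -> (0 <= \int[mu]_x f x)%R.
Proof. by move=> H; exact: Rintegral_ge0. Qed.

Lemma rint_EFin f : rintegrable f ->
  (\int[mu]_x (f x)%:E = (\int[mu]_x f x)%R%:E)%E.
Proof. by move=> i; rewrite /Rintegral fineK//; exact: integrable_fin_num. Qed.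

(** Monotone convergence. *)
Lemma rintegrable_mono (g : nat -> T -> R) f (B : R) :
  (forall n, rintegrable (g n)) -> (forall n x, 0 <= g n x) ->
  (forall x m n, (m <= n)%N -> g m x <= g n x) ->
  (forall x, g n x @[n --> \oo] --> f x) ->
  (forall n, (\int[mu]_x g n x <= B)%R) ->
  rintegrable f /\ (\int[mu]_x g n x)%R @[n --> \oo] --> (\int[mu]_x f x)%R.
Proof.
move=> ig g0 ndg gf gB.
have mg n : measurable_fun setT (EFin \o g n) by exact: measurable_int (ig n).
have f0 x : 0 <= f x.
  rewrite -(cvg_lim _ (gf x))//; apply: limr_ge; first by apply/cvg_ex; exists (f x).
  by near=> n; exact: g0.
have cv : (\int[mu]_x (g n x)%:E @[n --> \oo] --> \int[mu]_x (f x)%:E)%E.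
  rewrite (_ : (fun x => (f x)%:E) = fun x => limn (fun n => (g n x)%:E)).
    apply: cvg_monotone_convergence => // [n x _|x _ m n mn].
      by rewrite lee_fin.
    by rewrite lee_fin ndg.
  apply/funext => x; apply/esym/cvg_lim => //.
  by apply: cvg_EFin; [exact: nearW|exact: gf].
have mf : measurable_fun setT (EFin \o f).
  apply: (emeasurable_fun_cvg (fun n => EFin \o g n)) => // x _.
  by apply: cvg_EFin; [exact: nearW|exact: gf].
have fB : (\int[mu]_x (f x)%:E <= B%:E)%E.
  rewrite -(cvg_lim _ cv)//; apply: lime_le; first by apply/cvg_ex; eexists; exact: cv.
  by near=> n; rewrite rint_EFin ?lee_fin.
have intf : rintegrable f.
  apply/integrableP; split=> //.
  under eq_integral do rewrite /= ger0_norm//.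
  by rewrite (le_lt_trans fB)// ltry.
split=> //; move: cv; rewrite rint_EFin//.
under eq_fun do rewrite rint_EFin//.
by move/fine_cvg.
Unshelve. all: by end_near. Qed.

End RealIntegral.

Section ComplexIntegral.
Context d (T : measurableType d) (R : realType) (mu : {measure set T -> \bar R}).
Implicit Types (f g : T -> R[i]) (h : T -> R).

Definition cmeas f := measurable_fun setT (fun x => complex.Re (f x)) /\
  measurable_fun setT (fun x => complex.Im (f x)).

Definition cintegrable f := rintegrable mu (fun x => complex.Re (f x)) /\
  rintegrable mu (fun x => complex.Im (f x)).

Definition cint f : R[i] :=
  Complex (\int[mu]_x complex.Re (f x))%R (\int[mu]_x complex.Im (f x))%R.

Lemma cmeasD f g : cmeas f -> cmeas g -> cmeas (fun x => f x + g x).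
Proof.
move=> [f1 f2] [g1 g2]; split.
  by under eq_fun do rewrite cReD; exact: measurable_funD.
by under eq_fun do rewrite cImD; exact: measurable_funD.
Qed.

Lemma cmeasM f g : cmeas f -> cmeas g -> cmeas (fun x => f x * g x).
Proof.
move=> [f1 f2] [g1 g2]; split.
  by under eq_fun do rewrite cReM; apply: measurable_funB; exact: measurable_funM.
by under eq_fun do rewrite cImM; apply: measurable_funD; exact: measurable_funM.
Qed.

Lemma cmeas_cst c : cmeas (fun=> c).
Proof. by split; exact: measurable_cst. Qed.

Lemma cmeas_real h : measurable_fun setT h -> cmeas (fun x => (h x)%:C%C).
Proof. by move=> mh; split => //; exact: measurable_cst. Qed.

Lemma cmeasX f n : cmeas f -> cmeas (fun x => f x ^+ n).
Proof.
move=> mf; elim: n => [|n IH].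
  by under eq_fun do rewrite expr0; exact: cmeas_cst.
by under eq_fun do rewrite exprS; exact: cmeasM.
Qed.

Lemma cmeas_sum I (s : seq I) (P : pred I) (F : I -> T -> R[i]) :
  (forall i, cmeas (F i)) -> cmeas (fun x => \sum_(i <- s | P i) F i x).
Proof.
move=> H; elim: s => [|i s IH].
  by under eq_fun do rewrite big_nil; exact: cmeas_cst.
by under eq_fun do rewrite big_cons; case: (P i) => //; exact: cmeasD.
Qed.

Lemma measurable_expR_comp h : measurable_fun setT h ->
  measurable_fun setT (fun x => expR (h x)).
Proof. by move=> mh; exact: measurableT_comp. Qed.

Lemma measurable_cos_comp h : measurable_fun setT h ->
  measurable_fun setT (fun x => cos (h x)).
Proof.
move=> mh; apply: (measurableT_comp (f := @cos R)) => //.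
by apply: continuous_measurable_fun; exact: continuous_cos.
Qed.

Lemma measurable_sin_comp h : measurable_fun setT h ->
  measurable_fun setT (fun x => sin (h x)).
Proof.
move=> mh; apply: (measurableT_comp (f := @sin R)) => //.
by apply: continuous_measurable_fun; exact: continuous_sin.
Qed.

Lemma cmeas_cexp f : cmeas f -> cmeas (fun x => cexp (f x)).
Proof.
move=> [f1 f2]; split; rewrite /cexp /=; apply: measurable_funM.
- exact: measurable_expR_comp.
- exact: measurable_cos_comp.
- exact: measurable_expR_comp.
- exact: measurable_sin_comp.
Qed.

Lemma cmeas_cabs f : cmeas f -> measurable_fun setT (fun x => cabs (f x)).
Proof.
move=> [f1 f2]; under eq_fun do rewrite cabsE.
apply: (measurableT_comp (f := @Num.sqrt R)).
  by apply: continuous_measurable_fun; exact: sqrt_continuous.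
by apply: measurable_funD; exact: measurable_funX.
Qed.

Lemma cintegrable_meas f : cintegrable f -> cmeas f.
Proof. by move=> [i j]; split; [exact: rintegrable_meas i|exact: rintegrable_meas j]. Qed.

Lemma cintegrable_le f h : cmeas f -> rintegrable mu h ->
  (forall x, cabs (f x) <= h x) -> cintegrable f.
Proof.
move=> [f1 f2] ih fh; split; apply: rintegrable_le ih _ => // x.
  exact: le_trans (Re_le_cabs _) (fh x).
exact: le_trans (Im_le_cabs _) (fh x).
Qed.

Lemma cintegrable_cabs f : cintegrable f -> rintegrable mu (fun x => cabs (f x)).
Proof.
move=> fi; have [i j] := fi.
apply: (rintegrable_le (g := fun x => `|complex.Re (f x)| + `|complex.Im (f x)|)).
- exact/cmeas_cabs/cintegrable_meas.
- apply: rintegrableD; [exact: (integrable_norm i)|exact: (integrable_norm j)].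
- by move=> x; rewrite ger0_norm ?cabs_ge0// cabs_le_ReIm.
Qed.

Lemma cintegrableD f g : cintegrable f -> cintegrable g ->
  cintegrable (fun x => f x + g x).
Proof.
move=> [f1 f2] [g1 g2]; split.
  by under eq_fun do rewrite cReD; exact: rintegrableD.
by under eq_fun do rewrite cImD; exact: rintegrableD.
Qed.

Lemma cintegrableZ c f : cintegrable f -> cintegrable (fun x => c * f x).
Proof.
move=> [f1 f2]; split.
  by under eq_fun do rewrite cReM; apply: rintegrableB; exact: rintegrableZ.
by under eq_fun do rewrite cImM; apply: rintegrableD; exact: rintegrableZ.
Qed.

Lemma cintegrableB f g : cintegrable f -> cintegrable g ->
  cintegrable (fun x => f x - g x).
Proof.
move=> fi /(cintegrableZ (-1)) /(cintegrableD fi).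
by under eq_fun do rewrite mulN1r.
Qed.

Lemma cintegrable0 : cintegrable (fun=> 0).
Proof. by split; exact: rintegrable0. Qed.

Lemma cintegrable_sum I (s : seq I) (P : pred I) (F : I -> T -> R[i]) :
  (forall i, P i -> cintegrable (F i)) ->
  cintegrable (fun x => \sum_(i <- s | P i) F i x).
Proof.
move=> H; elim: s => [|i s IH].
  by under eq_fun do rewrite big_nil; exact: cintegrable0.
under eq_fun do rewrite big_cons; case: (boolP (P i)) => // Pi.
by apply: cintegrableD => //; exact: H.
Qed.

Lemma eq_cint f g : f =1 g -> cint f = cint g.
Proof. by move=> /funext ->. Qed.

Lemma cintD f g : cintegrable f -> cintegrable g ->
  cint (fun x => f x + g x) = cint f + cint g.
Proof.
move=> [f1 f2] [g1 g2]; apply: complexP; rewrite ?cReD ?cImD /=.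
  by under eq_Rintegral do rewrite cReD; exact: rintD.
by under eq_Rintegral do rewrite cImD; exact: rintD.
Qed.

Lemma cintZ c f : cintegrable f -> cint (fun x => c * f x) = c * cint f.
Proof.
move=> [f1 f2]; apply: complexP; rewrite ?cReM ?cImM /=.
  under eq_Rintegral do rewrite cReM.
  by rewrite rintB ?rintZ//; exact: rintegrableZ.
under eq_Rintegral do rewrite cImM.
by rewrite rintD ?rintZ//; exact: rintegrableZ.
Qed.

Lemma cintZr c f : cintegrable f -> cint (fun x => f x * c) = cint f * c.
Proof.
by move=> fi; rewrite mulrC -cintZ//; apply: eq_cint => x; rewrite mulrC.
Qed.

Lemma cintB f g : cintegrable f -> cintegrable g ->
  cint (fun x => f x - g x) = cint f - cint g.
Proof.
move=> fi gi; rewrite -mulN1r -cintZ// -cintD//; last exact: cintegrableZ.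
by apply: eq_cint => x; rewrite mulN1r.
Qed.

Lemma cint_sum I (s : seq I) (P : pred I) (F : I -> T -> R[i]) :
  (forall i, P i -> cintegrable (F i)) ->
  cint (fun x => \sum_(i <- s | P i) F i x) = \sum_(i <- s | P i) cint (F i).
Proof.
move=> H; elim: s => [|i s IH].
  rewrite big_nil; apply: complexP => /=;
    by under eq_Rintegral do rewrite big_nil /=; exact: rint0.
rewrite big_cons (eq_cint (g := fun x => if P i then F i x + \sum_(j <- s | P j) F j x
  else \sum_(j <- s | P j) F j x)); last by move=> x; rewrite big_cons.
case: (boolP (P i)) => // Pi; rewrite cintD ?IH//; first exact: H.
exact: cintegrable_sum.
Qed.

Lemma cint_real h : cint (fun x => (h x)%:C%C) = (\int[mu]_x h x)%R%:C%C.
Proof. by apply: complexP => //=; exact: rint0. Qed.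

Lemma cabs_cint_le f h : cmeas f -> rintegrable mu h ->
  (forall x, cabs (f x) <= h x) -> cabs (cint f) <= (\int[mu]_x h x)%R.
Proof.
move=> mf ih fh; have fi := cintegrable_le mf ih fh.
apply: cabs_le_rot => w w1; rewrite -cintZ//=.
apply: rint_le => //; first by have [] := cintegrableZ w fi.
move=> x; rewrite (le_trans (ler_norm _))// (le_trans (Re_le_cabs _))//.
by rewrite cabsM w1 mul1r.
Qed.

End ComplexIntegral.

(** * Laplace transforms with exponential weights *)

Section LaplaceSeries.
Context d (T : measurableType d) (R : realType) (mu : {measure set T -> \bar R}).
Variables (k : T -> R[i]) (w q : T -> R).
Hypotheses (mk : cmeas k) (mq : measurable_fun setT q).
Hypothesis kw : forall x, cabs (k x) <= w x.

Definition laplace h : R[i] := cint mu (fun x => k x * cexp (- h * (q x)%:C%C)).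

Definition laplace_coef i : R[i] :=
  cint mu (fun x => k x * ((- (q x)%:C%C) ^+ i / i`!%:R)).

Lemma cmeas_laplace_kernel h : cmeas (fun x => k x * cexp (- h * (q x)%:C%C)).
Proof.
apply: cmeasM => //; apply: cmeas_cexp; apply: cmeasM; first exact: cmeas_cst.
exact: cmeas_real.
Qed.

Lemma cmeas_laplace_coef i :
  cmeas (fun x => k x * ((- (q x)%:C%C) ^+ i / i`!%:R)).
Proof.
apply: cmeasM => //; apply: cmeasM; last exact: cmeas_cst.
apply: cmeasX; under eq_fun do rewrite -rmorphN.
by apply: cmeas_real; exact: measurableT_comp.
Qed.

Lemma cabs_laplace_coef i x :
  cabs ((- (q x)%:C%C) ^+ i / i`!%:R : R[i]) = `|q x| ^+ i / i`!%:R.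
Proof.
by rewrite cabsM cabsX cabsN cabs_real cabsV cabs_nat.
Qed.

Lemma expsum_le_expR n (x : R) : 0 <= x -> \sum_(i < n) x ^+ i / i`!%:R <= expR x.
Proof. by move=> x0; rewrite -subr_ge0; exact: exp_rem_ge0. Qed.

Lemma exp_coef_le_expR i (x : R) : 0 <= x -> x ^+ i / i`!%:R <= expR x.
Proof.
move=> x0; rewrite (le_trans _ (expsum_le_expR i.+1 x0))// big_ord_recr /= lerDr.
by rewrite sumr_ge0// => j _; rewrite divr_ge0// exprn_ge0.
Qed.

Variable rho : R.
Hypotheses (rho0 : 0 < rho) (iw : rintegrable mu (fun x => w x * expR (rho * `|q x|))).

Lemma measurable_laplace_majorant i :
  measurable_fun setT (fun x => cabs (k x) * (`|q x| ^+ i / i`!%:R)).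
Proof.
apply: measurable_funM; first exact: cmeas_cabs.
apply: measurable_funM; last exact: measurable_cst.
by apply: measurable_funX; exact: measurableT_comp.
Qed.

Lemma rintegrable_laplace_coef i :
  rintegrable mu (fun x => cabs (k x) * (`|q x| ^+ i / i`!%:R)).
Proof.
apply: (rintegrable_le (g := fun x => rho ^- i * (w x * expR (rho * `|q x|)))).
- exact: measurable_laplace_majorant.
- exact: rintegrableZ.
- move=> x; rewrite ger0_norm; last by rewrite mulr_ge0 ?cabs_ge0// divr_ge0 ?exprn_ge0.
  rewrite [leRHS]mulrC ler_pdivlMr ?exprn_gt0// -mulrA.
  have -> : `|q x| ^+ i / i`!%:R * rho ^+ i = (rho * `|q x|) ^+ i / i`!%:R.
    by rewrite exprMn; ring.
  have rq : 0 <= rho * `|q x| by rewrite mulr_ge0// ltW.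
  by rewrite ler_pM ?cabs_ge0 ?exp_coef_le_expR// divr_ge0// exprn_ge0.
Qed.

(** The exponential is expanded under the integral; the remainder is controlled by
    [cabs_cexp_rem] and the weight [exp (rho |q|)]. *)
Lemma laplace_series n : exists M, [/\ majorant (psum laplace_coef n) M,
  M.[rho] <= (\int[mu]_x (w x * expR (rho * `|q x|)))%R &
  forall h, cabs h <= rho -> cabs (laplace h - (psum laplace_coef n).[h]) <=
    (\int[mu]_x (w x * expR (rho * `|q x|)))%R * (cabs h / rho) ^+ n].
Proof.
pose m i := (\int[mu]_x (cabs (k x) * (`|q x| ^+ i / i`!%:R)))%R.
have icoef i : cintegrable mu (fun x => k x * ((- (q x)%:C%C) ^+ i / i`!%:R)).
  apply: cintegrable_le (rintegrable_laplace_coef i) _; first exact: cmeas_laplace_coef.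
  by move=> x; rewrite cabsM cabs_laplace_coef.
have pm i : cabs (laplace_coef i) <= m i.
  apply: cabs_cint_le (rintegrable_laplace_coef i) _; first exact: cmeas_laplace_coef.
  by move=> x; rewrite cabsM cabs_laplace_coef.
exists (\poly_(i < n) m i); split.
- move=> i; rewrite !coef_poly; case: ifP => // _; by rewrite cabs0.
- rewrite horner_poly (eq_bigr (fun i : 'I_n => (\int[mu]_x (rho ^+ i *
    (cabs (k x) * (`|q x| ^+ i / i`!%:R))))%R)); last first.
    move=> i _; rewrite mulrC; apply/esym/rintZ; exact: rintegrable_laplace_coef.
  rewrite -rint_sum; last by move=> i _; exact/rintegrableZ/rintegrable_laplace_coef.
  apply: rint_le => //.
    by apply: rintegrable_sum => i _; exact/rintegrableZ/rintegrable_laplace_coef.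
  move=> x; rewrite (eq_bigr (fun i : 'I_n => cabs (k x) *
      ((rho * `|q x|) ^+ i / i`!%:R))); last by move=> i _; rewrite exprMn; ring.
  rewrite -mulr_sumr ler_pM ?cabs_ge0//.
    by rewrite sumr_ge0// => i _; rewrite divr_ge0// exprn_ge0// mulr_ge0// ltW.
  by apply: expsum_le_expR; rewrite mulr_ge0// ltW.
move=> h hr.
have il : cintegrable mu (fun x => k x * cexp (- h * (q x)%:C%C)).
  apply: cintegrable_le iw _; first exact: cmeas_laplace_kernel.
  move=> x; rewrite cabsM ler_pM ?cabs_ge0// cabs_cexp ler_expR cReMr.
  rewrite (le_trans (ler_norm _))// normrM ler_wpM2r// (le_trans _ hr)//.
  by rewrite cReN normrN Re_le_cabs.
have -> : laplace h - (psum laplace_coef n).[h] =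
    cint mu (fun x => k x * cexp_rem n (- h * (q x)%:C%C)).
  rewrite horner_poly /laplace (eq_bigr (fun i : 'I_n => cint mu (fun x => h ^+ i *
      (k x * ((- (q x)%:C%C) ^+ i / i`!%:R))))); last first.
    by move=> i _; rewrite cintZ// mulrC.
  rewrite -cint_sum; last by move=> i _; exact: cintegrableZ.
  rewrite -cintB//; last by apply: cintegrable_sum => i _; exact: cintegrableZ.
  apply: eq_cint => x; rewrite /cexp_rem mulrBr; congr (_ - _).
  rewrite mulr_sumr; apply: eq_bigr => i _.
  by rewrite mulNr -mulrN exprMn; ring.
rewrite mulrC -rintZ//; apply: cabs_cint_le.
- apply: cmeasM => //; rewrite /cexp_rem.
  under eq_fun do rewrite -[- (\sum_(i < n) _)]mulN1r.
  apply: cmeasD; first by apply: cmeas_cexp; apply: cmeasM; [exact: cmeas_cst|exact: cmeas_real].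
  apply: cmeasM; first exact: cmeas_cst.
  apply: cmeas_sum => i; apply: cmeasM; last exact: cmeas_cst.
  by apply: cmeasX; apply: cmeasM; [exact: cmeas_cst|exact: cmeas_real].
- exact: rintegrableZ.
- move=> x; rewrite cabsM mulrCA ler_pM ?cabs_ge0//.
  rewrite (le_trans (cabs_cexp_rem _ _))// cabsM cabsN cabs_real.
  have -> : cabs h * `|q x| = (cabs h / rho) * (rho * `|q x|).
    by rewrite mulrA divfK// gt_eqF.
  rewrite (le_trans (exp_rem_scale _ _ _ _))//.
  + by rewrite divr_ge0 ?cabs_ge0 ?ltW.
  + by rewrite ler_pdivrMr// mul1r.
  + by rewrite mulr_ge0 ?(ltW rho0).
  rewrite ler_wpM2l ?exprn_ge0 ?divr_ge0 ?cabs_ge0 ?(ltW rho0)//.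
  rewrite /exp_rem gerBl sumr_ge0// => i _.
  by rewrite divr_ge0// exprn_ge0// mulr_ge0 ?(ltW rho0).
Qed.

End LaplaceSeries.

Section ExponentialWeight.
Context d (T : measurableType d) (R : realType) (mu : {measure set T -> \bar R}).
Variables (E q : T -> R) (M : R).
Hypotheses (mE : measurable_fun setT E) (E0 : forall x, 0 <= E x).
Hypotheses (mq : measurable_fun setT q) (q0 : forall x, 0 <= q x).

(** [E dmu] is [M] times a measure under which [q] is exponentially distributed, as far as
    moments can tell. *)
Definition exp_moments := forall m, rintegrable mu (fun x => E x * q x ^+ m) /\
  (\int[mu]_x (E x * q x ^+ m))%R = M * m`!%:R.

Hypothesis HE : exp_moments.

(** The partial sums of the exponential series have integrals bounded by the geometric series
    of [a]. *)
Lemma rintegrable_exp_weight a : a < 1 ->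
  rintegrable mu (fun x => E x * expR (a * q x)).
Proof.
move=> a1.
have mEa : measurable_fun setT (fun x => E x * expR (a * q x)).
  apply: measurable_funM => //; apply: measurable_expR_comp.
  by apply: measurable_funM => //; exact: measurable_cst.
have iE : rintegrable mu E.
  by have [] := HE 0; under eq_fun do rewrite expr0 mulr1.
have [a0|a0] := leP a 0.
  apply: rintegrable_le iE _ => // x; rewrite ger0_norm ?mulr_ge0 ?expR_ge0//.
  by rewrite ler_piMr// -expR0 ler_expR mulr_le0_ge0.
pose g n x := E x * \sum_(i < n) (a * q x) ^+ i / i`!%:R.
have ig n : rintegrable mu (g n).
  rewrite /g; under eq_fun do rewrite mulr_sumr.
  apply: rintegrable_sum => i _.
  rewrite (_ : (fun x => _) = fun x => (a ^+ i / i`!%:R) * (E x * q x ^+ i)).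
    by apply: rintegrableZ; have [] := HE i.
  by apply/funext => x; rewrite exprMn; ring.
have gE n : (\int[mu]_x g n x)%R = M * \sum_(i < n) a ^+ i.
  rewrite /g; under eq_Rintegral do rewrite mulr_sumr.
  rewrite rint_sum; last first.
    move=> i _; rewrite (_ : (fun x => _) = fun x => (a ^+ i / i`!%:R) * (E x * q x ^+ i)).
      by apply: rintegrableZ; have [] := HE i.
    by apply/funext => x; rewrite exprMn; ring.
  rewrite mulr_sumr; apply: eq_bigr => i _; have [iEi EEi] := HE i.
  rewrite (_ : (fun x => _) = fun x => (a ^+ i / i`!%:R) * (E x * q x ^+ i)).
    rewrite rintZ// EEi; have := @fact_unit R i; move: (i`!%:R : R) => f f0.
    by field.
  by apply/funext => x; rewrite exprMn; ring.
have M0 : 0 <= M.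
  have [_] := HE 0; rewrite fact0 mulr1 => <-; apply: rint_ge0 => x.
  by rewrite mulr_ge0 ?exprn_ge0.
have term0 x i : 0 <= (a * q x) ^+ i / i`!%:R.
  by rewrite divr_ge0// exprn_ge0// mulr_ge0// ltW.
have := @rintegrable_mono _ _ _ mu g (fun x => E x * expR (a * q x)) (M / (1 - a)) ig.
case=> //.
- by move=> n x; rewrite mulr_ge0// sumr_ge0.
- move=> x m n mn; rewrite ler_wpM2l//.
  rewrite -!(big_mkord xpredT (fun i => (a * q x) ^+ i / i`!%:R)).
  by rewrite (big_cat_nat (leq0n m) mn)//= lerDl sumr_ge0.
- move=> x; apply: cvgMr.
  have := @is_cvg_series_exp_coeff R (a * q x) => /cvg_ex[l].
  rewrite /expR => cl; rewrite (cvg_lim _ cl)//.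
  rewrite (_ : (fun n => _) = series (exp_coeff (a * q x)))//.
  by apply/funext => n; rewrite /series /= big_mkord.
- move=> n; rewrite gE ler_wpM2l//.
  have a1' : 0 < 1 - a by rewrite subr_gt0.
  rewrite -(ler_pM2r a1') mulVf ?gt_eqF//.
  by rewrite mulrC -opprB mulNr -subrX1 opprB gerBl exprn_ge0// ltW.
Qed.

Variables (k : T -> R[i]) (C : R).
Hypotheses (mk : cmeas k) (C0 : 0 <= C) (kE : forall x, cabs (k x) <= C * E x).

(** Recentring at [s0] multiplies the weight by [exp (- Re s0 * q)], which leaves room for
    exponential growth at any rate less than [1 + Re s0]. *)
Lemma analytic_laplace : analytic_rhp (laplace mu k q).
Proof.
move=> s0 rho rho0 rhos.
pose k' x := k x * cexp (- s0 * (q x)%:C%C).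
pose w' x := (C * E x) * expR (- complex.Re s0 * q x).
have mk' : cmeas k' by exact: cmeas_laplace_kernel.
have kw' x : cabs (k' x) <= w' x.
  by rewrite cabsM cabs_cexp ler_pM ?cabs_ge0 ?expR_ge0 ?kE// ler_expR cReMr cReN.
have iw' : rintegrable mu (fun x => w' x * expR (rho * q x)).
  rewrite (_ : (fun x => _) = fun x => C * (E x * expR ((rho - complex.Re s0) * q x))).
    by apply/rintegrableZ/rintegrable_exp_weight; rewrite ltrBlDr.
  by apply/funext => x; rewrite /w' -!mulrA -expRD; congr (_ * (_ * expR _)); ring.
exists (\int[mu]_x (w' x * expR (rho * q x)))%R; split=> // n.
have iw2 : rintegrable mu (fun x => w' x * expR (rho * `|q x|)).
  by under eq_fun do rewrite ger0_norm//.
have [P [pP Pr H]] := laplace_series mk' mq kw' rho0 iw2 n.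
have E2 : (\int[mu]_x (w' x * expR (rho * `|q x|)) = \int[mu]_x (w' x * expR (rho * q x)))%R.
  by apply: eq_Rintegral => x _; rewrite ger0_norm.
rewrite E2 in Pr H.
exists (psum (laplace_coef mu k' q) n), P; split=> // h hr.
have -> : laplace mu k q (s0 + h) = laplace mu k' q h.
  apply: eq_cint => x; rewrite /k' -mulrA -cexpD; congr (_ * cexp _).
  by ring.
exact: H.
Qed.

Lemma series_laplace : series_at0 (laplace mu k q) (laplace_coef mu k q).
Proof.
move=> r r0 r1; exists (\int[mu]_x (C * E x * expR (r * `|q x|)))%R => n.
apply: laplace_series => //.
rewrite (_ : (fun x => _) = fun x => C * (E x * expR (r * q x))).
  exact/rintegrableZ/rintegrable_exp_weight.
by apply/funext => x; rewrite ger0_norm// mulrA.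
Qed.

End ExponentialWeight.

(** * Summability of Laplace coefficients *)

Section SummableCoefficients.
Variable R : realType.
Implicit Types (v : R) (N : nat).

(** Up to a factor this is the Laguerre polynomial of degree 4 and parameter [N]. *)
Definition laguerre4 N v : R :=
  let n := N%:R in v ^+ 4 - 4 * (n + 4) * v ^+ 3 + 6 * (n + 4) * (n + 3) * v ^+ 2 -
  4 * (n + 4) * (n + 3) * (n + 2) * v + (n + 4) * (n + 3) * (n + 2) * (n + 1).

Lemma coef_1DX4 j : ((1 + 'X) ^+ 4 : {poly R[i]})`_j = 'C(4, j)%:R.
Proof.
rewrite exprDn coef_sum; under eq_bigr do rewrite expr1n mul1r coefMn coefXn.
have [j5|j5] := ltnP j 5; last first.
  rewrite bin_small// big1// => i _.
  by rewrite (gtn_eqF (leq_trans (ltn_ord i) j5)) mul0rn.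
rewrite (bigD1 (Ordinal j5))//= eqxx big1 ?addr0// => i ij.
by rewrite (_ : (j == i) = false) ?mul0rn//; apply: contra_neqF ij => /eqP ji; exact/val_inj.
Qed.

Lemma natr_facts N : [/\ (N.+4`!)%:R = (N%:R + 4) * (N%:R + 3) * (N%:R + 2) * (N%:R + 1) * (N`!)%:R :> R,
  (N.+3`!)%:R = (N%:R + 3) * (N%:R + 2) * (N%:R + 1) * (N`!)%:R :> R,
  (N.+2`!)%:R = (N%:R + 2) * (N%:R + 1) * (N`!)%:R :> R &
  (N.+1`!)%:R = (N%:R + 1) * (N`!)%:R :> R].
Proof.
have E (m : nat) : (m.+1`!)%:R = (m%:R + 1) * (m`!)%:R :> R.
  by rewrite factS natrM -natr1.
split; rewrite !E -?natr1; ring.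
Qed.

(** The multiplier [(1 + z)^4] turns the Taylor coefficients of the exponential into Laguerre
    polynomials. *)
Lemma sum_binomial4 N v :
  \sum_(j < 5) 'C(4, j)%:R * ((- v) ^+ (N.+4 - j) / (N.+4 - j)`!%:R) =
  (- v) ^+ N * laguerre4 N v / N.+4`!%:R.
Proof.
rewrite !big_ord_recr big_ord0 /= add0r /bump /= !subSS !subn0.
rewrite (_ : 'C(4, 0) = 1%N)// (_ : 'C(4, 1) = 4%N)// (_ : 'C(4, 2) = 6%N)//.
rewrite (_ : 'C(4, 3) = 4%N)// (_ : 'C(4, 4) = 1%N)//.
have [-> -> -> ->] := natr_facts N.
have f0 := @fact_unit R N; rewrite !exprS /laguerre4.
have p1 : N%:R + 1 != 0 :> R by rewrite natr1 pnatr_eq0.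
have p2 : N%:R + 2 != 0 :> R by rewrite -natrD pnatr_eq0 addnS.
have p3 : N%:R + 3 != 0 :> R by rewrite -natrD pnatr_eq0 addnS.
have p4 : N%:R + 4 != 0 :> R by rewrite -natrD pnatr_eq0 addnS.
move: f0 p1 p2 p3 p4; move: (N`!%:R : R) (N%:R : R) ((- v) ^+ N) => f n y f0 p1 p2 p3 p4.
by field; rewrite f0 p1 p2 p3 p4.
Qed.

Lemma mulc_laplace_sum (p : nat -> R[i]) N : mulc ((1 + 'X) ^+ 4) p N.+4 =
  \sum_(j < 5) 'C(4, j)%:R * p (N.+4 - j)%N.
Proof.
rewrite /mulc.
have -> : \sum_(j < N.+4.+1) ((1 + 'X) ^+ 4 : {poly R[i]})`_j * p (N.+4 - j)%N =
  \sum_(j < N.+4.+1) 'C(4, j)%:R * p (N.+4 - j)%N.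
  by apply: eq_bigr => j _; rewrite coef_1DX4.
have le5 : (5 <= N.+4.+1)%N by [].
rewrite (big_ord_widen _ (fun j => 'C(4, j)%:R * p (N.+4 - j)%N) le5).
rewrite [RHS]big_mkcond /=; apply: eq_bigr => j _.
by case: ltnP => // j5; rewrite bin_small ?mul0r.
Qed.

(** The squared norm of [laguerre4 N] for the density [v^N e^(-v)]. It is of order [N^4 N!],
    while each of the terms in its expansion is of order [N^8 N!]. *)
Lemma laguerre4_norm N (m : nat -> R) : (forall i, m i = i`!%:R) ->
  exists c : 'I_9 -> R, (forall v, laguerre4 N v ^+ 2 = \sum_(i < 9) c i * v ^+ i) /\
    \sum_(i < 9) c i * m (N + i)%N = 24 * N.+4`!%:R.
Proof.
move=> mE; pose n : R := N%:R.
pose a0 := (n + 4) * (n + 3) * (n + 2) * (n + 1).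
pose a1 := - (4 * (n + 4) * (n + 3) * (n + 2)).
pose a2 := 6 * (n + 4) * (n + 3).
pose a3 := - (4 * (n + 4)).
(* the coefficients of the square of [v^4 + a3 v^3 + a2 v^2 + a1 v + a0] *)
exists (fun i => nth 0 [:: a0 ^+ 2; 2 * a0 * a1; a1 ^+ 2 + 2 * a0 * a2;
  2 * a0 * a3 + 2 * a1 * a2; 2 * a0 + 2 * a1 * a3 + a2 ^+ 2; 2 * a1 + 2 * a2 * a3;
  2 * a2 + a3 ^+ 2; 2 * a3; 1] i); split.
  move=> v; rewrite !big_ord_recr big_ord0 /= /laguerre4 -/n /a0 /a1 /a2 /a3; ring.
have E (k : nat) : (k.+1`!)%:R = (k%:R + 1) * (k`!)%:R :> R.
  by rewrite factS natrM -natr1.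
rewrite !big_ord_recr big_ord0 /= !mE !addnS !addn0 !E -!natr1 -/n /a0 /a1 /a2 /a3.
ring.
Qed.

Lemma tail_inv_sqr (K : R) m n : 0 <= K -> (3 < m)%N ->
  \sum_(m <= i < n) K / ((i%:R - 2) * (i%:R - 3)) <= K / (m%:R - 3).
Proof.
move=> K0 m3; have [nm|mn] := leqP n m.
  rewrite big_geq// divr_ge0// subr_ge0 ler_nat ltnW//.
have gt3 i : (m <= i)%N -> 0 < i%:R - 3 :> R.
  by move=> mi; rewrite subr_gt0 ltr_nat (leq_trans m3).
have E : \sum_(m <= i < n) K / ((i%:R - 2) * (i%:R - 3)) = K / (m%:R - 3) - K / (n%:R - 3).
  elim: n mn => // n IH; rewrite ltnS leq_eqVlt => /predU1P[<-|mn].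
    rewrite big_nat1 -[m.+1%:R]natr1; have := gt3 m (leqnn m); move: (m%:R : R) => x x3.
    by field; rewrite !gt_eqF//; lra.
  rewrite big_nat_recr ?(ltnW mn)//= IH// -[n.+1%:R]natr1; have := gt3 n (ltnW mn).
  have := gt3 m (leqnn m).
  move: (n%:R : R) (m%:R : R) => x y y3 x3.
  by field; rewrite !gt_eqF//; lra.
by rewrite E gerBl divr_ge0// ltW// gt3// ltnW.
Qed.

End SummableCoefficients.

Section ExponentialWeightSummable.
Context d (T : measurableType d) (R : realType) (mu : {measure set T -> \bar R}).
Variables (E q : T -> R) (M : R).
Hypotheses (mE : measurable_fun setT E) (E0 : forall x, 0 <= E x).
Hypotheses (mq : measurable_fun setT q) (q0 : forall x, 0 <= q x).
Hypothesis HE : exp_moments mu E q M.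
Variables (k : T -> R[i]) (C : R).
Hypotheses (mk : cmeas k) (C0 : 0 <= C) (kE : forall x, cabs (k x) <= C * E x).

Let M0 : 0 <= M.
Proof.
have [_] := HE 0; rewrite fact0 mulr1 => <-; apply: rint_ge0 => x.
by rewrite mulr_ge0 ?exprn_ge0.
Qed.

Let cintegrable_coef i :
  cintegrable mu (fun x => k x * ((- (q x)%:C%C) ^+ i / i`!%:R)).
Proof.
have iE : rintegrable mu (fun x => C / i`!%:R * (E x * q x ^+ i)).
  by apply: rintegrableZ; have [] := HE i.
apply: cintegrable_le iE _; first exact: cmeas_laplace_coef.
move=> x; rewrite cabsM cabs_laplace_coef ger0_norm//.
rewrite (_ : C / _ * _ = (C * E x) * (q x ^+ i / i`!%:R)); last by ring.
by rewrite ler_pM ?cabs_ge0// divr_ge0 ?exprn_ge0.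
Qed.

(** Cauchy-Schwarz between [1] and [laguerre4 N], in the form [2 x y <= t x^2 + y^2 / t]: the
    cancellation in [laguerre4_norm] gains two powers of the index. *)
Lemma mulc_laplace_le N :
  cabs (mulc ((1 + 'X) ^+ 4) (laplace_coef mu k q) N.+4) <=
  13 * C * M / ((N.+4%:R - 2) * (N.+4%:R - 3)).
Proof.
(* this weight makes both terms of the bound of order [N^(-2)] *)
pose t : R := (N%:R + 3) * (N%:R + 4).
have t0 : 0 < t by rewrite mulr_gt0// ltr_wpDl.
have f0 : 0 < (N.+4`!)%:R :> R by rewrite ltr0n fact_gt0.
have [c [cE cM]] := @laguerre4_norm R N (fun i => i`!%:R) (fun=> erefl).
have iL : rintegrable mu (fun x => E x * (q x ^+ N * laguerre4 N (q x) ^+ 2)).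
  rewrite (_ : (fun x => _) = fun x => \sum_(i < 9) c i * (E x * q x ^+ (N + i))).
    by apply: rintegrable_sum => i _; apply: rintegrableZ; have [] := HE (N + i).
  apply/funext => x; rewrite cE !mulr_sumr; apply: eq_bigr => i _.
  by rewrite exprD; ring.
have EL : (\int[mu]_x (E x * (q x ^+ N * laguerre4 N (q x) ^+ 2)))%R =
    24 * M * N.+4`!%:R.
  rewrite (_ : (fun x => _) = fun x => \sum_(i < 9) c i * (E x * q x ^+ (N + i))).
    rewrite rint_sum; last first.
      by move=> i _; apply: rintegrableZ; have [] := HE (N + i).
    rewrite mulrAC -cM mulr_suml; apply: eq_bigr => i _; have [iE Ei] := HE (N + i).
    by rewrite rintZ// Ei; ring.
  apply/funext => x; rewrite cE !mulr_sumr; apply: eq_bigr => i _.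
  by rewrite exprD; ring.
have [iN EN] := HE N.
pose g x := C / N.+4`!%:R / 2 * (t * (E x * q x ^+ N) +
   t^-1 * (E x * (q x ^+ N * laguerre4 N (q x) ^+ 2))).
have ig : rintegrable mu g.
  by apply: rintegrableZ; apply: rintegrableD; exact: rintegrableZ.
have Eg : (\int[mu]_x g x)%R = C / N.+4`!%:R / 2 *
    (t * (M * N`!%:R) + t^-1 * (24 * M * N.+4`!%:R)).
  rewrite rintZ; last by apply: rintegrableD; exact: rintegrableZ.
  by rewrite rintD ?rintZ ?EN ?EL//; exact: rintegrableZ.
rewrite mulc_laplace_sum.
have -> : \sum_(j < 5) 'C(4, j)%:R * laplace_coef mu k q (N.+4 - j) =
    cint mu (fun x => k x * ((- q x) ^+ N * laguerre4 N (q x) / N.+4`!%:R)%:C%C).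
  have -> : (fun x => k x * ((- q x) ^+ N * laguerre4 N (q x) / N.+4`!%:R)%:C%C) =
     (fun x => \sum_(j < 5) 'C(4, j)%:R *
       (k x * ((- (q x)%:C%C) ^+ (N.+4 - j) / (N.+4 - j)`!%:R))).
    apply/funext => x; rewrite -sum_binomial4 rmorph_sum mulr_sumr.
    apply: eq_bigr => j _.
    by rewrite !rmorphM rmorphXn rmorphN fmorphV !rmorph_nat /=; ring.
  rewrite cint_sum; last by move=> j _; exact: cintegrableZ.
  by apply: eq_bigr => j _; rewrite cintZ.
have mk' : cmeas (fun x => k x * ((- q x) ^+ N * laguerre4 N (q x) / N.+4`!%:R)%:C%C).
  apply: cmeasM => //; apply: cmeas_real; apply: measurable_funM; last exact: measurable_cst.
  apply: measurable_funM.
    by apply: measurable_funX; exact: measurableT_comp.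
  rewrite /laguerre4; apply: measurable_funD; last exact: measurable_cst.
  have mX i : measurable_fun setT (fun x => q x ^+ i) by exact: measurable_funX.
  have mZ (a : R) i : measurable_fun setT (fun x => a * q x ^+ i).
    by apply: measurable_funM; [exact: measurable_cst|exact: mX].
  apply: measurable_funB; last by apply: measurable_funM; [exact: measurable_cst|].
  apply: measurable_funD; last exact: mZ.
  by apply: measurable_funB; [exact: mX|exact: mZ].
have kg x : cabs (k x * ((- q x) ^+ N * laguerre4 N (q x) / N.+4`!%:R)%:C%C) <= g x.
  rewrite cabsM cabs_real normrM normrM normrX normrN (ger0_norm (q0 x)).
  rewrite normfV normr_nat.
  apply: (@le_trans _ _ (C * E x * (q x ^+ N * `|laguerre4 N (q x)| / N.+4`!%:R))).
    by rewrite ler_wpM2r// divr_ge0// mulr_ge0 ?exprn_ge0.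
  rewrite /g.
  have -> : C / N.+4`!%:R / 2 * (t * (E x * q x ^+ N) +
     t^-1 * (E x * (q x ^+ N * laguerre4 N (q x) ^+ 2))) =
     (C * E x * q x ^+ N / N.+4`!%:R) * ((t + laguerre4 N (q x) ^+ 2 / t) / 2).
    by field; rewrite !gt_eqF.
  have -> : C * E x * (q x ^+ N * `|laguerre4 N (q x)| / N.+4`!%:R) =
     (C * E x * q x ^+ N / N.+4`!%:R) * `|laguerre4 N (q x)| by ring.
  rewrite ler_wpM2l//; first by rewrite divr_ge0// !mulr_ge0 ?exprn_ge0.
  rewrite ler_pdivlMr// -real_normK ?num_real//.
  move: (`|laguerre4 N (q x)|) => l.
  rewrite -subr_ge0 (_ : _ - _ = (t - l) ^+ 2 / t); last by field; rewrite gt_eqF.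
  by rewrite divr_ge0 ?sqr_ge0 ?ltW.
apply: le_trans (cabs_cint_le mk' ig kg) _; rewrite Eg.
have [-> _ _ _] := natr_facts R N.
rewrite -[N.+4%:R]natr1 -[N.+3%:R]natr1 -[N.+2%:R]natr1 -[N.+1%:R]natr1 /t.
have fN : 0 < (N`!)%:R :> R by rewrite ltr0n fact_gt0.
have n0 : 0 <= N%:R :> R by [].
have CM : 0 <= C * M by rewrite mulr_ge0.
move: fN n0; move: (N`!%:R : R) (N%:R : R) => f n fN n0.
rewrite -subr_ge0 [X in 0 <= X](_ : _ = C * M *
   ((25 / 2 * (n + 3) * (n + 4) - 12 * (n + 2) * (n + 1)) /
    ((n + 1) * (n + 2) * (n + 3) * (n + 4)))); last first.
  by field; rewrite !gt_eqF//; lra.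
rewrite mulr_ge0// divr_ge0//; last by rewrite !mulr_ge0//; lra.
nra.
Qed.

Lemma summable_laplace :
  summable_coef (mulc ((1 + 'X) ^+ 4) (laplace_coef mu k q)).
Proof.
move=> e e0; pose K := 13 * C * M.
have K0 : 0 <= K by rewrite !mulr_ge0.
exists (4 + Num.bound (K / e))%N => m n hm.
have m3 : (3 < m)%N by rewrite (leq_trans _ hm)// leq_addr.
have m30 : 0 < m%:R - 3 :> R by rewrite subr_gt0 ltr_nat.
apply: (@le_trans _ _ (K / (m%:R - 3))); last first.
  rewrite ler_pdivrMr// -ler_pdivrMl// mulrC.
  apply: (@le_trans _ _ (Num.bound (K / e))%:R).
    by apply/ltW/archi_boundP; rewrite divr_ge0// ltW.
  by rewrite lerBrDr -natrD ler_nat (leq_trans _ hm)// addnC leq_add2r.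
apply: le_trans (tail_inv_sqr n K0 m3); rewrite big_nat_cond [leRHS]big_nat_cond.
apply: ler_sum => i /andP[/andP[mi _] _].
have [N ->] : exists N, i = N.+4 by exists (i - 4)%N; lia.
exact: mulc_laplace_le.
Qed.

End ExponentialWeightSummable.

(** * Translation invariance of the Lebesgue measure *)

Section Lebesgue1.
Variable R : realType.
Local Notation lam := (@lebesgue_measure R).

Lemma measurable_addr (a : R) :
  measurable_fun setT ((fun t => t + a) : measurableTypeR R -> measurableTypeR R).
Proof. exact: measurable_funD. Qed.

Lemma lebesgue_measure_addr (a : R) (A : set (measurableTypeR R)) : measurable A ->
  pushforward lam (fun t : measurableTypeR R => t + a : measurableTypeR R) A = lam A.
Proof.
move=> mA; apply/esym.
apply: (@lebesgue_measure_unique R (pushforward lam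
   (fun t : measurableTypeR R => t + a : measurableTypeR R))) => //.
  exact: measurable_addr.
move=> H X [[x y] _ <-] /=; rewrite /pushforward.
have -> : (fun t : R => t + a) @^-1` `]x, y]%classic = `]x - a, y - a]%classic.
  by apply/seteqP; split=> t /=; rewrite !in_itv /= ltrBlDr lerBrDr.
rewrite !lebesgue_measure_itv /= !lte_fin ltrD2r; case: ifP => // _.
by rewrite -!EFinB; congr _%:E; ring.
Qed.

Lemma ge0_integral_addr (a : R) (f : measurableTypeR R -> \bar R) :
  measurable_fun setT f -> (forall t, 0 <= f t)%E ->
  (\int[lam]_t f (t + a)%R = \int[lam]_t f t)%E.
Proof.
move=> mf f0.
have := @ge0_integral_pushforward _ _ _ _ R _ (measurable_addr a) lam setT f
  measurableT mf (fun x _ => f0 x).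
rewrite preimage_setT => <-.
apply: eq_measure_integral; first exact: measurable_addr.
by move=> H A mA _; rewrite -[RHS](lebesgue_measure_addr a).
Qed.

End Lebesgue1.

Section LebesgueRn.
Variable R : realType.
Local Notation mu n := (@lebesgueRn R n).

Lemma ge0_integral_lebesgueRnS n (f : 'cV[R]_n.+1 -> \bar R) :
  measurable_fun setT f -> (forall x, 0 <= f x)%E ->
  (\int[mu n.+1]_x f x =
   \int[@lebesgue_measure R]_t \int[mu n]_x f (consv (t, x)))%E.
Proof.
move=> mf f0.
have := @ge0_integral_pushforward _ _ _ _ R _ (@measurable_consv R n)
  (@lebesgue_measure R \x mu n)%E setT f measurableT mf (fun x _ => f0 x).
rewrite preimage_setT => /= E.
transitivity (\int[pushforward (@lebesgue_measure R \x mu n)%E (@consv R n)]_x f x)%E.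
  by [].
rewrite E fubini_tonelli1//.
exact: measurableT_comp mf (@measurable_consv R n).
Qed.

Lemma measurable_addv n (v : 'cV[R]_n) :
  measurable_fun setT (fun x : 'cV[R]_n => x + v).
Proof.
apply: measurable_fun_coordP => i; under eq_fun do rewrite mxE.
by apply: measurable_funD; [exact: measurable_coord|exact: measurable_cst].
Qed.

Lemma consv_add n t (x : 'cV[R]_n) (v : 'cV[R]_n.+1) :
  consv (t, x) + v = consv (t + v ord0 0, x + \col_i v (lift ord0 i) 0).
Proof.
apply/colP => i; rewrite !mxE; case: (unliftP ord0 i) => [j ->|->] //=.
by rewrite !mxE.
Qed.

Lemma measurable_slice n (f : 'cV[R]_n.+1 -> \bar R) t : measurable_fun setT f ->
  measurable_fun setT (fun x : 'cV[R]_n => f (consv (t, x))).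
Proof.
move=> mf; apply: (measurableT_comp mf).
by apply: (measurableT_comp (@measurable_consv R n)); exact: measurable_pair1.
Qed.

Lemma ge0_integral_addv n (v : 'cV[R]_n) (f : 'cV[R]_n -> \bar R) :
  measurable_fun setT f -> (forall x, 0 <= f x)%E ->
  (\int[mu n]_x f (x + v)%R = \int[mu n]_x f x)%E.
Proof.
elim: n v f => [|n IH] v f mf f0.
  by apply: eq_integral => x _; congr f; apply/colP => -[].
have mfv : measurable_fun setT (fun x : 'cV[R]_n.+1 => f (x + v)).
  exact: (measurableT_comp mf (measurable_addv v)).
rewrite (ge0_integral_lebesgueRnS mfv (fun x => f0 _)) (ge0_integral_lebesgueRnS mf f0).
have step t : (\int[mu n]_x f (consv (t, x) + v)%R =
    \int[mu n]_x f (consv ((t + v ord0 0)%R, x)))%E.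
  under eq_integral do rewrite consv_add.
  apply: (IH _ (fun x => f (consv (t + v ord0 0, x)))) => //.
  exact: measurable_slice.
under eq_integral do rewrite step.
apply: (ge0_integral_addr _ (f := fun t => (\int[mu n]_x f (consv (t, x)))%E)).
  apply: (measurable_fun_fubini_tonelli_F (fun p => f (consv p))) => //.
  exact: measurableT_comp mf (@measurable_consv R n).
by move=> t; exact: integral_ge0.
Qed.

Lemma rint_addv n (v : 'cV[R]_n) (f : 'cV[R]_n -> R) :
  measurable_fun setT f -> (forall x, 0 <= f x) ->
  (\int[mu n]_x f (x + v)%R = \int[mu n]_x f x)%R.
Proof.
move=> mf f0; rewrite /Rintegral; congr fine.
apply: (ge0_integral_addv v (f := EFin \o f)); first exact/measurable_EFinP.
by move=> x; rewrite lee_fin.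
Qed.

Lemma rintegrable_addv n (v : 'cV[R]_n) (f : 'cV[R]_n -> R) :
  (forall x, 0 <= f x) -> rintegrable (mu n) f ->
  rintegrable (mu n) (fun x : 'cV[R]_n => f (x + v)).
Proof.
move=> f0 fi; have mf := rintegrable_meas fi.
apply/integrableP; split.
  by apply/measurable_EFinP; exact: (measurableT_comp mf (measurable_addv v)).
move/integrableP: fi => [_]; rewrite -(ge0_integral_addv v)//.
apply: measurableT_comp => //; exact/measurable_EFinP.
Qed.

Lemma measurable_dotv n (w : 'cV[R]_n) :
  measurable_fun setT (fun x : 'cV[R]_n => dotv x w).
Proof.
apply: measurable_sum => i; apply: measurable_funM; last exact: measurable_cst.
exact: measurable_coord.
Qed.

Lemma measurable_quad n (P : 'M[R]_n) :
  measurable_fun setT (fun x : 'cV[R]_n => dotv (P *m x) x).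
Proof.
apply: measurable_sum => i; apply: measurable_funM; last exact: measurable_coord.
under eq_fun do rewrite mxE.
apply: measurable_sum => j; apply: measurable_funM; first exact: measurable_cst.
exact: measurable_coord.
Qed.

End LebesgueRn.

(** * Positive definite matrices *)

Section QuadraticForms.
Variables (R : realType) (n : nat).
Implicit Types (x y w : 'cV[R]_n) (M P S : 'M[R]_n).

Lemma dotvE x y : dotv x y = (x^T *m y) 0 0.
Proof. by rewrite mxE; apply: eq_bigr => i _; rewrite mxE. Qed.

Lemma dotvC x y : dotv x y = dotv y x.
Proof. by apply: eq_bigr => i _; rewrite mulrC. Qed.

Lemma dotvDl x y w : dotv (x + y) w = dotv x w + dotv y w.
Proof. by rewrite /dotv -big_split; apply: eq_bigr => i _; rewrite mxE mulrDl. Qed.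

Lemma dotvDr x y w : dotv w (x + y) = dotv w x + dotv w y.
Proof. by rewrite !(dotvC w) dotvDl. Qed.

Lemma dotvZl (a : R) x w : dotv (a *: x) w = a * dotv x w.
Proof. by rewrite /dotv mulr_sumr; apply: eq_bigr => i _; rewrite mxE mulrA. Qed.

Lemma dotvZr (a : R) x w : dotv w (a *: x) = a * dotv w x.
Proof. by rewrite !(dotvC w) dotvZl. Qed.

Lemma dotvNl x w : dotv (- x) w = - dotv x w.
Proof. by rewrite -scaleN1r dotvZl mulN1r. Qed.

Lemma dotvNr x w : dotv w (- x) = - dotv w x.
Proof. by rewrite !(dotvC w) dotvNl. Qed.

Lemma dotv0l w : dotv 0 w = 0.
Proof. by rewrite -(scale0r 0) dotvZl mul0r. Qed.

Lemma dotv0r w : dotv w 0 = 0.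
Proof. by rewrite dotvC dotv0l. Qed.

Lemma dotvMl M x y : dotv (M *m x) y = dotv x (M^T *m y).
Proof. by rewrite !dotvE trmx_mul mulmxA. Qed.

Lemma dotv_sym M x y : M^T = M -> dotv (M *m x) y = dotv (M *m y) x.
Proof. by move=> MT; rewrite dotvMl MT dotvC. Qed.

Lemma dotv_delta x i : dotv x (delta_mx i 0) = x i 0.
Proof.
rewrite /dotv (bigD1 i)//= mxE !eqxx mulr1 big1 ?addr0// => j ji.
by rewrite mxE (negPf ji) mulr0.
Qed.

Lemma dotvv_ge0 x : 0 <= dotv x x.
Proof. by apply: sumr_ge0 => i _; rewrite -expr2 sqr_ge0. Qed.

Lemma dotvv_eq0 x : (dotv x x == 0) = (x == 0).
Proof.
apply/eqP/eqP => [|->]; last exact: dotv0l.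
move/eqP; rewrite psumr_eq0 => [/allP H|i _]; last by rewrite -expr2 sqr_ge0.
apply/colP => i; have := H i (mem_index_enum _); rewrite -expr2 sqrf_eq0 mxE.
by move/eqP.
Qed.

Lemma semiposdef_CS M x y : semiposdefmx M ->
  dotv (M *m x) y ^+ 2 <= dotv (M *m x) x * dotv (M *m y) y.
Proof.
move=> [MT M0]; set a := dotv (M *m x) x; set b := dotv _ y; set c := dotv (M *m y) y.
have H (s t : R) : 0 <= s ^+ 2 * a + 2 * (s * t * b) + t ^+ 2 * c.
  have := M0 (s *: x + t *: y).
  rewrite mulmxDr -!scalemxAr !(dotvDl, dotvDr, dotvZl, dotvZr) (dotv_sym y x MT).
  by rewrite -/a -/b -/c; congr (_ <= _); ring.
have a0 : 0 <= a := M0 x; have c0 : 0 <= c := M0 y.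
have [a1|a1] := eqVneq a 0.
  have [->|b0] := eqVneq b 0; first by rewrite expr0n a1 mul0r.
  have := H (- (c + 1) / (2 * b)) 1; rewrite a1.
  rewrite (_ : _ + _ = -1) ?ler0N1//; by field.
have := H (- b) a; rewrite (_ : _ + _ = a * (a * c - b ^+ 2)); last by ring.
by rewrite pmulr_rge0 ?lt_neqAle ?a0 ?[_ == a]eq_sym ?a1// subr_ge0.
Qed.

Lemma posdef_semi P : posdefmx P -> semiposdefmx P.
Proof.
move=> [PT P0]; split=> // x; have [->|x0] := eqVneq x 0; first by rewrite dotv0r.
exact/ltW/P0.
Qed.

Lemma posdef_unit P : posdefmx P -> P \in unitmx.
Proof.
move=> [PT P0]; rewrite -row_free_unit -kermx_eq0; apply/eqP/row_matrixP => i.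
rewrite row0; set v := row i _.
have vP : v *m P = 0 by rewrite -row_mul mulmx_ker row0.
apply/eqP; apply: contraT => v0.
have vT0 : v^T != 0 by rewrite -trmx0 (inj_eq trmx_inj).
by have := P0 v^T vT0; rewrite -{1}PT -trmx_mul vP trmx0 dotv0l ltxx.
Qed.

Lemma posdef_inv P : posdefmx P -> posdefmx (invmx P).
Proof.
move=> pP; have uP := posdef_unit pP; have [PT P0] := pP.
split=> [|x x0]; first by rewrite trmx_inv PT.
have := P0 (invmx P *m x); rewrite mulKVmx// dotvC; apply.
by apply: contraNneq x0 => /(congr1 (mulmx P)); rewrite mulKVmx// mulmx0 => ->.
Qed.

Lemma posdefD P M : posdefmx P -> semiposdefmx M -> posdefmx (P + M).
Proof.
move=> [PT P0] [MT M0]; split=> [|x x0]; first by rewrite linearD /= PT MT.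
by rewrite mulmxDl dotvDl ltr_pwDl ?P0.
Qed.

Lemma posdefZ P (c : R) : 0 < c -> posdefmx P -> posdefmx (c *: P).
Proof.
move=> c0 [PT P0]; split=> [|x x0]; first by rewrite linearZ /= PT.
by rewrite -scalemxAl dotvZl mulr_gt0 ?P0.
Qed.

(** Cauchy-Schwarz between a quadratic form and its dual. *)
Lemma posdef_CS P x w : posdefmx P ->
  dotv x w ^+ 2 <= dotv (P *m x) x * dotv (invmx P *m w) w.
Proof.
move=> pP; have uP := posdef_unit pP.
have := semiposdef_CS x (invmx P *m w) (posdef_semi pP).
rewrite mulKVmx// (dotvC w); congr (_ ^+ 2 <= _).
by rewrite dotvMl pP.1 mulKVmx.
Qed.

(** Cauchy-Schwarz with the dual form bounds every coordinate of [x], without recourse to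
    eigenvalues. *)
Lemma posdef_lower P : posdefmx P ->
  exists2 e : R, 0 < e & forall x, e * dotv x x <= dotv (P *m x) x.
Proof.
move=> pP; have pI := posdef_semi (posdef_inv pP).
pose T := \sum_(i < n) dotv (invmx P *m delta_mx i 0) (delta_mx i 0).
have T0 : 0 <= T by apply: sumr_ge0 => i _; exact: pI.2.
exists (1 + T)^-1 => [|x]; first by rewrite invr_gt0 ltr_wpDr.
rewrite mulrC ler_pdivrMr ?ltr_wpDr//.
apply: (@le_trans _ _ (dotv (P *m x) x * T)).
  rewrite mulr_sumr; apply: ler_sum => i _; rewrite -expr2 -(dotv_delta x i).
  exact: posdef_CS.
by rewrite ler_wpM2l ?lerDr// (posdef_semi pP).2.
Qed.

Lemma semiposdef_null M x : semiposdefmx M -> dotv (M *m x) x = 0 -> M *m x = 0.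
Proof.
move=> pM Mx; apply/eqP; rewrite -dotvv_eq0 -sqrf_eq0 eq_le sqr_ge0 andbT.
by rewrite (le_trans (semiposdef_CS x (M *m x) pM))// Mx mul0r.
Qed.

Lemma semiposdef_degenerate M : semiposdefmx M -> ~ posdefmx M ->
  exists2 v : 'cV[R]_n, v != 0 & M *m v = 0.
Proof.
move=> pM npM; apply: contrapT => H; apply: npM; split=> [|x x0]; first exact: pM.1.
rewrite lt_neqAle pM.2 andbT; apply/eqP => M0; apply: H; exists x => //.
exact: semiposdef_null.
Qed.

Lemma semiposdef_diag0 M : semiposdefmx M ->
  (forall i, dotv (M *m delta_mx i 0) (delta_mx i 0) = 0) -> M = 0.
Proof.
move=> pM M0; apply/matrixP => i j.
have /(congr1 (fun u : 'cV_n => u i 0)) := semiposdef_null pM (M0 j).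
by rewrite -colE !mxE.
Qed.

Lemma semiposdef_upper M : semiposdefmx M ->
  exists2 c : R, 0 <= c & forall x : 'cV[R]_n, dotv (M *m x) x <= c * dotv x x.
Proof.
move=> pM; pose T := \sum_(i < n) dotv (M *m delta_mx i 0) (delta_mx i 0).
have T0 : 0 <= T by apply: sumr_ge0 => i _; exact: pM.2.
exists T => // x; set a := dotv (M *m x) x.
have a0 : 0 <= a := pM.2 x.
have MM : dotv (M *m x) (M *m x) <= a * T.
  rewrite mulr_sumr; apply: ler_sum => i _; rewrite -expr2 -(dotv_delta _ i).
  exact: semiposdef_CS.
have /(_ x (M *m x)) := @semiposdef_CS 1%:M.
rewrite !mul1mx => H.
have : a ^+ 2 <= dotv x x * dotv (M *m x) (M *m x).
  by rewrite /a dotvC; apply: H; split=> [|y]; rewrite ?trmx1// mul1mx dotvv_ge0.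
move=> /le_trans/(_ (ler_wpM2l (dotvv_ge0 x) MM)).
have [->//|an0] := eqVneq a 0; first by rewrite mulr_ge0 ?dotvv_ge0.
rewrite (mulrCA _ a) expr2 ler_pM2l ?lt_neqAle ?a0 1?eq_sym ?an0//.
by rewrite mulrC.
Qed.

End QuadraticForms.

Section SquareRoot.
Variable R : realType.

Lemma interpolation (F : fieldType) (g : F -> F) (s : seq F) :
  exists p : {poly F}, forall x, x \in s -> p.[x] = g x.
Proof.
elim: s => [|a s [p Hp]]; first by exists 0.
have [sa|sa] := boolP (a \in s).
  by exists p => x; rewrite inE => /orP[/eqP ->|]; exact: Hp.
pose D := \prod_(b <- s) ('X - b%:P).
have Da : D.[a] != 0 by rewrite -/(root D a) root_prod_XsubC.
exists (p + ((g a - p.[a]) / D.[a])%:P * D) => x; rewrite inE !hornerE.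
case/orP => [/eqP ->|xs]; first by rewrite divfK// addrC subrK.
have -> : D.[x] = 0 by apply/rootP; rewrite root_prod_XsubC.
by rewrite mulr0 addr0 Hp.
Qed.

Lemma tr_horner_mx n (A : 'M[R]_n.+1) p : (horner_mx A p)^T = horner_mx A^T p.
Proof.
elim/poly_ind: p => [|p c IH]; first by rewrite !rmorph0 trmx0.
rewrite !rmorphD !rmorphM /= !horner_mx_X !horner_mx_C linearD /= tr_scalar_mx.
by rewrite -!mulmxE trmx_mul IH; congr (_ + _); apply: comm_mx_horner.
Qed.

(** Diagonalise over the complex numbers, then interpolate the fourth roots of the
    eigenvalues by a real polynomial [q]: the square root [q(A)^2] is real, symmetric
    and semidefinite because it is the square of the symmetric matrix [q(A)]. *)
Lemma semiposdef_sqrt n (A : 'M[R]_n) : semiposdefmx A ->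
  exists2 S, semiposdefmx S & S *m S = A.
Proof.
case: n A => [|n] A pA.
  by exists 0; rewrite ?mul0mx; [split=> [|x]; rewrite ?trmx0// mul0mx dotv0l|apply/matrixP => -[]].
have [AT A0] := pA.
pose Ac : 'M[R[i]]_n.+1 := map_mx (real_complex R) A.
have AcE : map_mx Num.conj Ac^T = Ac.
  apply/matrixP => i j; rewrite !mxE -{2}AT mxE.
  by rewrite -[RHS]conjc_real.
have nA : Ac \is normalmx by apply/normalmxP; rewrite AcE.
have hA : Ac \is hermsymmx by apply/is_hermitianmxP; rewrite expr0 scale1r AcE.
have dreal := hermitian_spectral_diag_real hA.
have /orthomx_spectralP := nA.
set P := spectralmx Ac; set D := spectral_diag Ac => AE.
have uP : P \in unitmx := spectral_unit Ac.
pose r j := complex.Re (D 0 j).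
have rE j : D 0 j = (r j)%:C%C.
  by rewrite RRe_real//; have /mxOverP := dreal; apply.
have r0 j : 0 <= r j.
  rewrite leNgt; apply/negP => rj.
  have uB : A - (r j)%:M \in unitmx.
    apply/posdef_unit; split=> [|x x0]; first by rewrite linearB /= AT tr_scalar_mx.
    rewrite mulmxBl dotvDl mul_scalar_mx dotvNl dotvZl ltr_wpDl// -mulNr.
    rewrite mulr_gt0 ?oppr_gt0// lt_neqAle dotvv_ge0 andbT.
    by rewrite eq_sym dotvv_eq0.
  have /(congr1 (fun X => row j (P *m X))) := AE.
  rewrite !mulmxA mulmxV// mul1mx !row_mul row_diag_mx rE -scalemxAl -rowE => Hj.
  have : row j P *m map_mx (real_complex R) (A - (r j)%:M) = 0.
    by rewrite map_mxB map_scalar_mx mulmxBr -/Ac Hj mul_mx_scalar subrr.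
  move=> /(congr1 (mulmx^~ (invmx (map_mx (real_complex R) (A - (r j)%:M))))).
  rewrite mulmxK ?map_unitmx// mul0mx => /(congr1 (mulmx^~ (invmx P))).
  rewrite -row_mul mulmxV// mul0mx => /matrixP/(_ 0 j)/eqP.
  by rewrite !mxE eqxx oner_eq0.
have [q Hq] := interpolation (fun x => Num.sqrt (Num.sqrt x)) [seq r j | j : 'I_n.+1].
have q4 j : (q ^+ 4).[r j] = r j.
  rewrite horner_exp Hq ?map_f ?mem_enum//.
  by rewrite (exprM _ 2 2) sqr_sqrtr ?sqrtr_ge0// sqr_sqrtr.
pose T := horner_mx A q.
have TT : T^T = T by rewrite tr_horner_mx AT.
have T4 : (T *m T) *m (T *m T) = A.
  rewrite !mulmxE -!expr2 -exprM -rmorphXn /=.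
  apply: (map_mx_inj (f := real_complex R)); rewrite map_horner_mx -/Ac AE.
  have uV : invmx P \in unitmx by rewrite unitmx_inv.
  have E p := horner_mx_uconj p (diag_mx D) uV; rewrite invmxK in E.
  rewrite E; apply: (congr1 (fun X => invmx P *m X *m P)).
  rewrite horner_mx_diag; apply: congr1.
  apply/matrixP => i j; rewrite ord1 !mxE rE horner_map /=.
  by congr (_%:C%C); exact: q4.
exists (T *m T) => //; split=> [|x]; first by rewrite trmx_mul TT.
by rewrite -mulmxA dotvMl TT dotvv_ge0.
Qed.

Lemma sqrtmxP n (A : 'M[R]_n) : semiposdefmx A ->
  semiposdefmx (sqrtmx A) /\ sqrtmx A *m sqrtmx A = A.
Proof.
move=> /semiposdef_sqrt[S pS SS].
have /(xgetPex 0) // : exists S, [set S : 'M[R]_n | semiposdefmx S /\ S *m S = A] S.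
by exists S.
Qed.

End SquareRoot.

(** * Gaussian integrals *)

Section GaussianIntegrals.
Variable R : realType.
Local Notation mu n := (@lebesgueRn R n).

Lemma integral_gauss1 (a : R) : 0 < a ->
  (\int[@lebesgue_measure R]_t (expR (- a * t ^+ 2))%:E)%E = (Num.sqrt (pi / a))%:E.
Proof.
move=> a0; pose s := (Num.sqrt (2 * a))^-1.
have s2 : s ^+ 2 = (2 * a)^-1 by rewrite exprVn sqr_sqrtr// mulr_ge0// ltW.
have s0 : s != 0 by rewrite invr_eq0 gt_eqF// sqrtr_gt0 mulr_gt0.
have := @integral_normal_pdf R 0 s; have := @integrable_normal_pdf R 0 s.
have pE t : normal_pdf 0 s t = normal_peak s * expR (- a * t ^+ 2).
  rewrite normal_pdfE// /normal_fun subr0 s2; congr (_ * expR _).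
  by field; rewrite gt_eqF.
have p0 := normal_peak_gt0 s0.
have -> : Num.sqrt (pi / a) = (normal_peak s)^-1.
  rewrite /normal_peak invrK s2; congr (Num.sqrt _).
  by field; rewrite gt_eqF.
move=> ip; under eq_integral do rewrite pE EFinM.
rewrite integralZl//=; last first.
  rewrite (_ : (fun x => _) = fun x => ((normal_peak s)^-1%:E * (normal_pdf 0 s x)%:E)%E).
    by apply: integrableZl => //; exact: ip.
  by apply/funext => t /=; rewrite -EFinM pE mulKf// gt_eqF.
move=> H; have : ((normal_peak s)^-1%:E * (normal_peak s)%:E *
  \int[lebesgue_measure]_x (expR (- a * x ^+ 2))%:E = (normal_peak s)^-1%:E)%E.
  by rewrite -muleA H mule1.
by rewrite -EFinM mulVf ?gt_eqF// mul1e.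
Qed.

Lemma dotv_consv n t (x : 'cV[R]_n) :
  dotv (consv (t, x)) (consv (t, x)) = t ^+ 2 + dotv x x.
Proof.
rewrite /dotv big_ord_recl !mxE unlift_none /= expr2; congr (_ + _).
by apply: eq_bigr => i _; rewrite !mxE liftK.
Qed.

Lemma measurable_gauss n (c : R) (P : 'M[R]_n) :
  measurable_fun setT (fun x : 'cV[R]_n => expR (- c * dotv (P *m x) x)).
Proof.
apply: measurable_expR_comp; apply: measurable_funM; first exact: measurable_cst.
exact: measurable_quad.
Qed.

Lemma integral_gaussRn n (a : R) : 0 < a ->
  (\int[mu n]_x (expR (- a * dotv x x))%:E)%E = (Num.sqrt (pi / a) ^+ n)%:E.
Proof.
have mg k : measurable_fun setT (fun x : 'cV[R]_k => (expR (- a * dotv x x))%:E).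
  by apply/measurable_EFinP; have := measurable_gauss a (1%:M : 'M[R]_k);
    under eq_fun do rewrite mul1mx.
move=> a0; elim: n => [|n IH].
  rewrite /= integral_dirac//; last exact: mg.
  by rewrite diracT mul1e dotv0l mulr0 expR0.
rewrite ge0_integral_lebesgueRnS//.
have step t : (\int[mu n]_x (expR (- a * dotv (consv (t, x)) (consv (t, x))))%:E =
    (expR (- a * t ^+ 2))%:E * (Num.sqrt (pi / a) ^+ n)%:E)%E.
  under eq_integral do rewrite dotv_consv mulrDr expRD EFinM.
  rewrite -IH; apply: ge0_integralZl; rewrite ?lee_fin ?expR_ge0//.
  exact: mg.
under eq_integral do rewrite step.
transitivity ((\int[@lebesgue_measure R]_t (expR (- a * t ^+ 2))%:E) * (Num.sqrt (pi / a) ^+ n)%:E)%E.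
  apply: ge0_integralZr; rewrite ?lee_fin ?exprn_ge0 ?sqrtr_ge0//.
  apply/measurable_EFinP/measurable_expR_comp/measurable_funM; first exact: measurable_cst.
  exact: measurable_funX.
by rewrite integral_gauss1// exprS.
Qed.

Lemma rintegrable_ge0 d (T : measurableType d) (nu : {measure set T -> \bar R}) (f : T -> R) :
  measurable_fun setT f -> (forall x, 0 <= f x) ->
  (\int[nu]_x (f x)%:E < +oo)%E -> rintegrable nu f.
Proof.
move=> mf f0 fi; apply/integrableP; split; first exact/measurable_EFinP.
by under eq_integral do rewrite /= ger0_norm//.
Qed.

Lemma rintegrable_gauss n (c : R) (P : 'M[R]_n) : 0 < c -> posdefmx P ->
  rintegrable (mu n) (fun x => expR (- c * dotv (P *m x) x)).
Proof.
move=> c0 /posdef_lower[e e0 He].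
apply: (rintegrable_le (g := fun x => expR (- (c * e) * dotv x x))).
- exact: measurable_gauss.
- apply: rintegrable_ge0.
  + by have := measurable_gauss (c * e) (1%:M : 'M[R]_n);
      under eq_fun do rewrite mul1mx.
  + by move=> x; exact: expR_ge0.
  + by rewrite integral_gaussRn ?mulr_gt0// ltry.
move=> x; rewrite ger0_norm ?expR_ge0// ler_expR !mulNr lerN2 -mulrA.
by rewrite ler_wpM2l// ltW.
Qed.

Definition openbox n (x : 'cV[R]_n) (r : R) : set 'cV[R]_n :=
  [set y | forall i, `]x i 0 - r, x i 0 + r[%classic (y i 0)].

Lemma measurable_openbox n (x : 'cV[R]_n) r : measurable (openbox x r).
Proof.
rewrite (_ : openbox x r = \bigcap_(i in [set: 'I_n])
    ((fun y : 'cV[R]_n => y i 0) @^-1` `]x i 0 - r, x i 0 + r[%classic)).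
  apply: fin_bigcap_measurable => // i _.
  by rewrite -[X in measurable X]setTI; apply: measurable_coord.
by apply/seteqP; split => [y Hy i _|y Hy i]; [exact: Hy|exact: (Hy i I)].
Qed.

Lemma openbox_gt0 n (x : 'cV[R]_n) r : 0 < r -> (0 < mu n (openbox x r))%E.
Proof.
move=> r0; rewrite (lebesgueRn_box (A := fun i => `]x i 0 - r, x i 0 + r[%classic))//.
elim/big_ind: _ => [|a b|i _]; [exact: lte01|exact: mule_gt0|].
rewrite lebesgue_measure_itv /= lte_fin ifT; last by lra.
by rewrite -EFinB lte_fin; lra.
Qed.

Lemma lebesgueRn_setT n : (0 < mu n setT)%E.
Proof.
apply: lt_le_trans (openbox_gt0 (0 : 'cV[R]_n) ltr01) _.
apply: le_measure => //; rewrite inE; last exact: measurableT.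
exact: measurable_openbox.
Qed.

Lemma rint_gt0 n (f : 'cV[R]_n -> R) : rintegrable (mu n) f ->
  (forall x, 0 < f x) -> (0 < \int[mu n]_x f x)%R.
Proof.
move=> fi f0; rewrite lt_neqAle rint_ge0 ?andbT; last by move=> x; exact: ltW.
apply/eqP => E.
have : (\int[mu n]_x `|(f x)%:E| = 0)%E.
  under eq_integral do rewrite gee0_abs ?lee_fin ?(ltW (f0 _))//.
  by rewrite rint_EFin// -E.
move/ae_eq_integral_abs => /(_ measurableT) H.
have mf := rintegrable_meas fi.
have /H[N [mN N0 NE]] : measurable_fun setT (EFin \o f) by exact/measurable_EFinP.
have : (mu n setT <= mu n N)%E.
  apply: le_measure; rewrite ?inE//; apply: subset_trans NE => x _ /= /(_ I)/eqP.
  by rewrite eqe gt_eqF.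
by rewrite N0 leNgt lebesgueRn_setT.
Qed.

Section Transform.
Variables (n : nat) (P : 'M[R]_n) (w : 'cV[R]_n).
Hypothesis pP : posdefmx P.
Let E (x : 'cV[R]_n) := expR (- 2^-1 * dotv (P *m x) x).
Let v (x : 'cV[R]_n) := dotv x w.
Let kappa := dotv (invmx P *m w) w.
Let M0 := (\int[mu n]_x E x)%R.

Let kappa0 : 0 <= kappa. Proof. exact: (posdef_semi (posdef_inv pP)).2. Qed.

Let iE : rintegrable (mu n) E.
Proof. by apply: rintegrable_gauss; rewrite // invr_gt0. Qed.

Let E0 x : 0 <= E x. Proof. exact: expR_ge0. Qed.

Lemma gauss_mass_gt0 : 0 < M0.
Proof. by apply: rint_gt0 => // x; exact: expR_gt0. Qed.

Let complete_square (t : R) x : E x * expR (t * v x) =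
  expR (t ^+ 2 * (kappa / 2)) * E (x + - (t *: (invmx P *m w))).
Proof.
have uP := posdef_unit pP; rewrite /E -!expRD; congr expR.
rewrite mulmxDr mulmxN -scalemxAr mulKVmx// !(dotvDl, dotvDr, dotvNl, dotvNr, dotvZl, dotvZr).
rewrite (dotvC w (invmx P *m w)) -/kappa (dotvC w x) (dotvMl P x (invmx P *m w)) pP.1 mulKVmx// -/(v x).
by field.
Qed.

Let gauss_mgf (t : R) : rintegrable (mu n) (fun x => E x * expR (t * v x)) /\
  (\int[mu n]_x (E x * expR (t * v x)))%R = M0 * expR (t ^+ 2 * (kappa / 2)).
Proof.
have iEs := rintegrable_addv (- (t *: (invmx P *m w))) E0 iE.
split; first by under eq_fun do rewrite complete_square; exact: rintegrableZ.
under eq_Rintegral do rewrite complete_square.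
rewrite (rintZ _ iEs) [RHS]mulrC; congr (_ * _).
by apply: rint_addv => //; exact: rintegrable_meas iE.
Qed.

Lemma rintegrable_gauss_exp (r : R) : 0 <= r ->
  rintegrable (mu n) (fun x => E x * expR (r * `|v x|)).
Proof.
move=> r0; apply: (rintegrable_le (g := fun x => E x * expR (r * v x) + E x * expR (- r * v x))).
- apply: measurable_funM; first exact: measurable_gauss.
  apply/measurable_expR_comp/measurable_funM; first exact: measurable_cst.
  by apply: measurableT_comp => //; exact: measurable_dotv.
- by apply: rintegrableD; have [] := gauss_mgf r; have [] := gauss_mgf (- r).
move=> x; rewrite ger0_norm ?mulr_ge0 ?expR_ge0// -mulrDr ler_wpM2l//.
have [vx|vx] := leP 0 (v x); first by rewrite ger0_norm// lerDl expR_ge0.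
by rewrite ltr0_norm// mulrN mulNr lerDr expR_ge0.
Qed.

Let quad_coef i : R := (kappa / 2) ^+ i / i`!%:R.
Let quad_poly (m : nat) : {poly R} := \sum_(i < m) quad_coef i *: 'X^(i.*2).
Let quad_polyC m := map_poly (real_complex R) (M0 *: quad_poly m).

Let quad_coef_ge0 i : 0 <= quad_coef i.
Proof. by rewrite divr_ge0// exprn_ge0// divr_ge0. Qed.

Let quad_poly_coef m j : (j < m)%N ->
  (quad_poly m)`_j = if odd j then 0 else quad_coef j./2.
Proof.
move=> jm; rewrite coef_sum; under eq_bigr do rewrite coefZ coefXn.
case: ifPn => [oj|ej].
  rewrite big1// => i _; rewrite (_ : (j == _) = false) ?mulr0//.
  by apply: contraTF oj => /eqP ->; rewrite odd_double.
have jm2 : (j./2 < m)%N by lia.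
rewrite (bigD1 (Ordinal jm2))//= big1 ?addr0 => [|i /eqP ij].
  by rewrite (_ : (j == _)) ?mulr1//; apply/eqP; lia.
rewrite (_ : (j == _) = false) ?mulr0//; apply/eqP => ji; apply: ij; apply: val_inj => /=.
by lia.
Qed.

Let quad_poly_ge0 m j : 0 <= (quad_poly m)`_j.
Proof.
rewrite coef_sum; apply: sumr_ge0 => i _; rewrite coefZ coefXn.
by rewrite mulr_ge0// ler0n.
Qed.

Let quad_poly_approx (r : R) m : 0 < r -> [/\
  majorant (quad_polyC m) (M0 *: quad_poly m),
  (M0 *: quad_poly m).[r] <= M0 * expR (r ^+ 2 * (kappa / 2)) &
  forall h : R[i], cabs h <= r ->
    cabs (M0%:C%C * cexp (h ^+ 2 * (kappa / 2)%:C%C) - (quad_polyC m).[h]) <=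
    M0 * expR (r ^+ 2 * (kappa / 2)) * (cabs h / r) ^+ m].
Proof.
move=> r0; have M00 := ltW gauss_mass_gt0.
have hornerq (F : comNzRingType) (f : {rmorphism R -> F}) (h : F) :
    (map_poly f (M0 *: quad_poly m)).[h] =
    f M0 * \sum_(i < m) (h ^+ 2 * f (kappa / 2)) ^+ i * f (i`!%:R)^-1.
  rewrite linearZ /= hornerZ rmorph_sum horner_sum /=; congr (_ * _).
  apply: eq_bigr => i _; rewrite linearZ /= map_polyXn hornerZ hornerXn.
  have -> : f (quad_coef i) = f (kappa / 2) ^+ i * f (i`!%:R)^-1.
    by rewrite -rmorphXn -rmorphM.
  by rewrite -muln2 mulnC exprM [(h ^+ 2 * _) ^+ i]exprMn mulrAC (mulrC (f _ ^+ i)).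
split.
- move=> i; rewrite coef_map [cabs _]cabs_real ger0_norm// coefZ mulr_ge0//.
- have := hornerq _ idfun r; rewrite map_poly_id// => ->.
  rewrite ler_wpM2l//; apply: expsum_le_expR.
  by rewrite mulr_ge0 ?sqr_ge0// divr_ge0.
move=> h hr; rewrite hornerq -mulrBr cabsM cabs_real ger0_norm// -mulrA ler_wpM2l//.
have -> : cexp (h ^+ 2 * (kappa / 2)%:C%C) -
    \sum_(i < m) (h ^+ 2 * real_complex R (kappa / 2)) ^+ i * real_complex R (i`!%:R)^-1 =
    cexp_rem m (h ^+ 2 * (kappa / 2)%:C%C).
  by congr (_ - _); apply: eq_bigr => i _; rewrite fmorphV rmorph_nat.
rewrite (le_trans (cabs_cexp_rem _ _))// cabsM cabsX cabs_real.
rewrite ger0_norm ?divr_ge0//; set a := cabs h / r.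
have a0 : 0 <= a by rewrite divr_ge0 ?cabs_ge0 ?ltW.
have a1 : a <= 1 by rewrite ler_pdivrMr// mul1r.
have -> : cabs h ^+ 2 * (kappa / 2) = a ^+ 2 * (r ^+ 2 * (kappa / 2)).
  by rewrite /a; field; rewrite gt_eqF.
have q0 : 0 <= r ^+ 2 * (kappa / 2) by rewrite mulr_ge0 ?sqr_ge0// divr_ge0.
rewrite (le_trans (exp_rem_scale _ _ _ _))// ?exprn_ge0// ?exprn_ile1//.
rewrite mulrC ler_pM ?exp_rem_ge0 ?exprn_ge0//.
  rewrite /exp_rem gerBl sumr_ge0// => i _.
  by rewrite divr_ge0// exprn_ge0.
by rewrite exprAC expr2 ler_piMl ?exprn_ge0// exprn_ile1.
Qed.

Let mEC : cmeas (fun x : 'cV[R]_n => (E x)%:C%C).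
Proof. by apply: cmeas_real; exact: measurable_gauss. Qed.

Let gap (h : R[i]) := laplace (mu n) (fun x => (E x)%:C%C) v h -
  M0%:C%C * cexp (h ^+ 2 * (kappa / 2)%:C%C).

Let gap_acc (e : R) : 0 < e -> exists t, [/\ 0 < cabs t, cabs t < e & gap t = 0].
Proof.
move=> e0; exists (e / 2)%:C%C; rewrite cabs_real ger0_norm ?divr_ge0 ?(ltW e0)//.
split; [by lra|by lra|].
rewrite /gap /laplace; under eq_cint do rewrite -rmorphN -rmorphM cexp_real -rmorphM.
rewrite cint_real (gauss_mgf (- (e / 2))).2 sqrrN.
by rewrite -rmorphXn -rmorphM cexp_real -rmorphM subrr.
Qed.

Let gap_approx (r : R) : 0 < r -> exists2 K : R, 0 <= K & forall m,
  exists M, [/\ majorant (psum (laplace_coef (mu n) (fun x => (E x)%:C%C) v) m - quad_polyC m) M,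
   M.[r] <= K & forall h, cabs h <= r ->
   cabs (gap h - (psum (laplace_coef (mu n) (fun x => (E x)%:C%C) v) m - quad_polyC m).[h]) <=
   K * (cabs h / r) ^+ m].
Proof.
move=> r0; have iw := rintegrable_gauss_exp (ltW r0).
exists ((\int[mu n]_x (E x * expR (r * `|v x|)))%R + M0 * expR (r ^+ 2 * (kappa / 2))).
  rewrite addr_ge0 ?rint_ge0// => [x|]; first by rewrite mulr_ge0 ?expR_ge0.
  by rewrite mulr_ge0 ?expR_ge0 ?(ltW gauss_mass_gt0).
move=> m; have [||M [DM Mr H]] := @laplace_series _ _ _ (mu n) (fun x => (E x)%:C%C) E v mEC _ _ r r0 iw m.
- exact: measurable_dotv.
- by move=> x; rewrite cabs_real ger0_norm.
have [DM2 Mr2 H2] := quad_poly_approx m r0.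
exists (M + M0 *: quad_poly m); split.
- by move=> i; rewrite coefB coefD (le_trans (cabsB _ _))// lerD.
- by rewrite hornerD lerD.
- move=> h hr; rewrite hornerD hornerN mulrDl.
  rewrite (_ : _ - _ = (laplace (mu n) (fun x => (E x)%:C%C) v h -
   (psum (laplace_coef (mu n) (fun x => (E x)%:C%C) v) m).[h]) -
   (M0%:C%C * cexp (h ^+ 2 * (kappa / 2)%:C%C) - (quad_polyC m).[h])); last by rewrite /gap; ring.
  by rewrite (le_trans (cabsB _ _))// lerD ?H ?H2.
Qed.

(** Both sides are entire, and they agree on the real axis by translation invariance. *)
Lemma gauss_laplace (h : R[i]) : laplace (mu n) (fun x => (E x)%:C%C) v h =
  M0%:C%C * cexp (h ^+ 2 * (kappa / 2)%:C%C).
Proof.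
have r0 : 0 < cabs h + 1 by rewrite ltr_wpDl ?cabs_ge0.
have [K K0 HK] := gap_approx r0.
apply/eqP; rewrite -subr_eq0; apply/eqP.
apply: (@poly_approx_eq0 _ gap K (cabs h + 1)); last by rewrite ltrDl.
  split=> // m; have [M [DM Mr H]] := HK m.
  by exists (psum (laplace_coef (mu n) (fun x => (E x)%:C%C) v) m - quad_polyC m), M; split.
exact: gap_acc.
Qed.

Let gauss_coef m : laplace_coef (mu n) (fun x => (E x)%:C%C) v m =
  (M0 * (if odd m then 0 else quad_coef m./2))%:C%C.
Proof.
have [K K0 HK] := gap_approx ltr01; have [M [DM Mr H]] := HK m.+1.
have /(_ m (ltnSn m)) := poly_approx0_coef ltr01 K0 gap_acc DM Mr H.
rewrite coefB coef_map /= coefZ quad_poly_coef// coef_poly ltnSn => /eqP.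
by rewrite subr_eq0 => /eqP.
Qed.

Lemma rintegrable_gauss_moment m : rintegrable (mu n) (fun x => E x * v x ^+ m).
Proof.
apply: (rintegrable_le (g := fun x => m`!%:R * (E x * expR (1 * `|v x|)))).
- apply: measurable_funM; first exact: measurable_gauss.
  by apply: measurable_funX; exact: measurable_dotv.
- by apply: rintegrableZ; exact: rintegrable_gauss_exp.
move=> x; rewrite normrM ger0_norm// mulrCA ler_wpM2l// normrX.
by rewrite mulrC -ler_pdivrMr ?ltr0n ?fact_gt0// mul1r exp_coef_le_expR.
Qed.

(** Comparison of Taylor coefficients in [gauss_laplace]. *)
Lemma gauss_moment m : (\int[mu n]_x (E x * v x ^+ m))%R =
  if odd m then 0 else M0 * (kappa / 2) ^+ m./2 * m`!%:R / (m./2)`!%:R.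
Proof.
have := gauss_coef m.
have <- : cint (mu n) (fun x : 'cV[R]_n => ((-1) ^+ m / m`!%:R * (E x * v x ^+ m))%:C%C) =
    laplace_coef (mu n) (fun x => (E x)%:C%C) v m.
  apply: eq_cint => x; rewrite !rmorphM !rmorphXn /= fmorphV rmorph_nat rmorphN rmorph1.
  by rewrite (exprNn (v x)%:C%C); ring.
rewrite cint_real rintZ; last exact: rintegrable_gauss_moment.
move=> /(congr1 (@complex.Re R)) /=; rewrite -signr_odd.
have f0 : m`!%:R != 0 :> R by rewrite pnatr_eq0 -lt0n fact_gt0.
case: (odd m) => /= H; [apply/eqP|].
  move/eqP: H; rewrite expr1 mulr0 !mulf_eq0 invr_eq0 (negPf f0) oppr_eq0 oner_eq0 /=.
  by [].
move: H; rewrite expr0 mul1r => H.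
by rewrite -[LHS](mulVKf f0) H /quad_coef; ring.
Qed.

End Transform.

End GaussianIntegrals.

(** * Integrals over products *)

Section ProductIntegrals.
Context d1 d2 (T1 : measurableType d1) (T2 : measurableType d2) (R : realType).
Variable mu1 : {sigma_finite_measure set T1 -> \bar R}.
Variable mu2 : {sigma_finite_measure set T2 -> \bar R}.

Lemma rintegrable_norm d (T : measurableType d) (mu : {measure set T -> \bar R})
  (f : T -> R) : rintegrable mu f -> rintegrable mu (fun x => `|f x|).
Proof.
move=> fi; have mf := rintegrable_meas fi; move/integrableP: fi => [_ fi].
apply/integrableP; split; first by apply/measurable_EFinP; exact: measurableT_comp.
by under eq_integral do rewrite /= normr_id.
Qed.

Lemma rintegrable_prod f g : rintegrable mu1 f -> rintegrable mu2 g ->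
  rintegrable (mu1 \x mu2)%E (fun p => f p.1 * g p.2).
Proof.
move=> fi gi; have mf := rintegrable_meas fi; have mg := rintegrable_meas gi.
have mfg : measurable_fun setT (fun p : T1 * T2 => f p.1 * g p.2).
  by apply: measurable_funM; exact: measurableT_comp.
apply/integrable12ltyP; first exact/measurable_EFinP.
have ng := rintegrable_norm gi.
rewrite (_ : (\int[_]_x _)%E = (\int[mu1]_x (`|f x| * (\int[mu2]_y `|g y|)%R)%:E)%E).
  rewrite rint_EFin ?ltry//; under eq_fun do rewrite mulrC; apply: rintegrableZ.
  exact: rintegrable_norm.
apply: eq_integral => x _; rewrite -rintZ// -rint_EFin; last exact: rintegrableZ.
by apply: eq_integral => y _; rewrite /= normrM.
Qed.

Lemma rint_prod f g : rintegrable mu1 f -> rintegrable mu2 g ->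
  (\int[(mu1 \x mu2)%E]_p (f p.1 * g p.2) = (\int[mu1]_x f x) * (\int[mu2]_y g y))%R.
Proof.
move=> fi gi; have fgi := rintegrable_prod fi gi.
rewrite [LHS]/Rintegral -(integral12_prod_meas1 fgi) /fubini_F /=.
rewrite (_ : (\int[_]_x _)%E = (\int[mu1]_x (f x * (\int[mu2]_y g y)%R)%:E)%E).
  rewrite rint_EFin /=; last by under eq_fun do rewrite mulrC; exact: rintegrableZ.
  by under eq_Rintegral do rewrite mulrC; rewrite rintZ// mulrC.
apply: eq_integral => x _; rewrite -rintZ// -rint_EFin//; exact: rintegrableZ.
Qed.

Lemma rfubini (k : T1 * T2 -> R) : rintegrable (mu1 \x mu2)%E k ->
  (forall x, rintegrable mu2 (fun y => k (x, y))) ->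
  (forall y, rintegrable mu1 (fun x => k (x, y))) ->
  (\int[mu1]_x (\int[mu2]_y k (x, y)) = \int[mu2]_y (\int[mu1]_x k (x, y)))%R.
Proof.
move=> ki k1 k2; rewrite /Rintegral; congr fine.
transitivity (\int[mu1]_x (\int[mu2]_y (k (x, y))%:E))%E.
  by apply: eq_integral => x _; rewrite rint_EFin.
rewrite (Fubini ki); apply: eq_integral => y _.
by rewrite /= rint_EFin.
Qed.

Lemma cfubini (k : T1 * T2 -> R[i]) f g : cmeas k ->
  rintegrable mu1 f -> rintegrable mu2 g ->
  (forall x y, cabs (k (x, y)) <= f x * g y) ->
  cint mu1 (fun x => cint mu2 (fun y => k (x, y))) =
  cint mu2 (fun y => cint mu1 (fun x => k (x, y))).
Proof.
move=> mk fi gi kfg.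
have [ki1 ki2] : cintegrable (mu1 \x mu2)%E k.
  by apply: cintegrable_le mk (rintegrable_prod fi gi) _ => -[x y]; exact: kfg.
have k1 x : cintegrable mu2 (fun y => k (x, y)).
  apply: (cintegrable_le _ (rintegrableZ (f x) gi)) => // ; case: mk => mk1 mk2; split.
  - by apply: (measurableT_comp mk1); exact: measurable_pair1.
  - by apply: (measurableT_comp mk2); exact: measurable_pair1.
have k2 y : cintegrable mu1 (fun x => k (x, y)).
  apply: (cintegrable_le (h := fun x => g y * f x)); [|exact: rintegrableZ|].
    case: mk => mk1 mk2; split.
    - by apply: (measurableT_comp mk1); exact: measurable_pair2.
    - by apply: (measurableT_comp mk2); exact: measurable_pair2.
  by move=> x; rewrite mulrC.
rewrite /cint; congr Complex.
  by apply: (rfubini ki1) => z; [exact: (k1 z).1|exact: (k2 z).1].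
by apply: (rfubini ki2) => z; [exact: (k1 z).2|exact: (k2 z).2].
Qed.

Lemma cint_prod f g : cintegrable mu1 f -> cintegrable mu2 g ->
  cint (mu1 \x mu2)%E (fun p => f p.1 * g p.2) = cint mu1 f * cint mu2 g.
Proof.
move=> [f1 f2] [g1 g2].
have I := rintegrable_prod; have E := rint_prod.
apply: complexP; rewrite /= ?cReM ?cImM /=.
- rewrite -(E _ _ f1 g1) -(E _ _ f2 g2) -(rintB (I _ _ f1 g1) (I _ _ f2 g2)).
  by apply: eq_Rintegral => p _; rewrite cReM.
- rewrite -(E _ _ f1 g2) -(E _ _ f2 g1) -(rintD (I _ _ f1 g2) (I _ _ f2 g1)).
  by apply: eq_Rintegral => p _; rewrite cImM.
Qed.

Lemma cmeas_comp (f : T2 -> R[i]) (g : T1 -> T2) :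
  cmeas f -> measurable_fun setT g -> cmeas (fun x => f (g x)).
Proof.
by case=> f1 f2 mg; split; [exact: (measurableT_comp f1)|exact: (measurableT_comp f2)].
Qed.

End ProductIntegrals.

(** * Chi-square moments *)

Section ChiSquareMoments.
Variable R : realType.

Definition rising (a : R) m := \prod_(i < m) (a + i%:R).

Lemma risingS (a : R) m : rising a m.+1 = rising a m * (a + m%:R).
Proof. by rewrite /rising big_ord_recr. Qed.

Lemma rising1 m : rising 1 m = m`!%:R.
Proof.
elim: m => [|m IH]; first by rewrite /rising big_ord0.
by rewrite risingS IH factS mulnC natrM -add1n natrD.
Qed.

Lemma vandermonde_rising (a b : R) m :
  \sum_(j < m.+1) 'C(m, j)%:R * (rising a j * rising b (m - j)) = rising (a + b) m.
Proof.
elim: m => [|m IH]; first by rewrite big_ord1 /rising !big_ord0 !mulr1.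
pose S1 := \sum_(j < m.+1) 'C(m, j)%:R * (rising a j * rising b (m.+1 - j)).
pose S2 := \sum_(j < m.+1) 'C(m, j)%:R * (rising a j.+1 * rising b (m - j)).
have -> : \sum_(j < m.+2) 'C(m.+1, j)%:R * (rising a j * rising b (m.+1 - j)) = S1 + S2.
  have -> : S1 = \sum_(j < m.+2) 'C(m, j)%:R * (rising a j * rising b (m.+1 - j)).
    by rewrite big_ord_recr /= bin_small// mul0r addr0.
  rewrite big_ord_recl [in RHS]big_ord_recl -addrA !bin0; congr (_ + _).
  rewrite -big_split; apply: eq_bigr => j _ /=.
  by rewrite /bump /= add1n binS natrD mulrDl subSS.
rewrite risingS -IH mulr_suml -big_split; apply: eq_bigr => j _ /=.
have jm : (j <= m)%N by rewrite -ltnS.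
rewrite subSn// !risingS natrB//; ring.
Qed.

Context d1 d2 (T1 : measurableType d1) (T2 : measurableType d2).
Variable mu1 : {sigma_finite_measure set T1 -> \bar R}.
Variable mu2 : {sigma_finite_measure set T2 -> \bar R}.

(** Like [exp_moments], for the density [u^(-1/2) e^(-u)], whose moments are proportional to
    [1/2 * (3/2) * ... * (m - 1/2)]. *)
Definition half_moments d (T : measurableType d) (mu : {measure set T -> \bar R})
    (E q : T -> R) (M : R) := forall m, rintegrable mu (fun x => E x * q x ^+ m) /\
  (\int[mu]_x (E x * q x ^+ m))%R = M * rising 2^-1 m.

(** The sum of two independent variables with density proportional to [u^(-1/2) e^(-u)] is
    exponentially distributed; on moments this is the Vandermonde identity for rising
    factorials. *)
Lemma exp_moments_prod E1 q1 M1 E2 q2 M2 :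
  half_moments mu1 E1 q1 M1 -> half_moments mu2 E2 q2 M2 ->
  exp_moments (mu1 \x mu2)%E (fun p => E1 p.1 * E2 p.2) (fun p => q1 p.1 + q2 p.2) (M1 * M2).
Proof.
move=> H1 H2 m.
pose F (j : nat) (p : T1 * T2) := 'C(m, j)%:R *
  ((E1 p.1 * q1 p.1 ^+ (m - j)) * (E2 p.2 * q2 p.2 ^+ j)).
have FE p : (E1 p.1 * E2 p.2) * (q1 p.1 + q2 p.2) ^+ m = \sum_(j < m.+1) F j p.
  rewrite exprDn mulr_sumr; apply: eq_bigr => j _; rewrite /F -mulr_natl; ring.
have iF j : rintegrable (mu1 \x mu2)%E (F j).
  by apply: rintegrableZ; exact: (rintegrable_prod (H1 (m - j)%N).1 (H2 j).1).
split; first by under eq_fun do rewrite FE; apply: rintegrable_sum => j _.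
under eq_Rintegral do rewrite FE; rewrite rint_sum//.
have half2 : 2^-1 + 2^-1 = 1 :> R by field.
rewrite -rising1 -half2 -vandermonde_rising mulr_sumr; apply: eq_bigr => j _.
have [i1 e1] := H1 (m - j)%N; have [i2 e2] := H2 j.
rewrite rintZ; last exact: (rintegrable_prod i1 i2).
by have := rint_prod i1 i2; rewrite /= => ->; rewrite e1 e2; ring.
Qed.

End ChiSquareMoments.

Section GaussianReference.
Variable R : realType.
Local Notation mu n := (@lebesgueRn R n).

Lemma rising_half m : rising (2^-1 : R) m * m`!%:R = 4^-1 ^+ m * (m.*2)`!%:R.
Proof.
elim: m => [|m IH]; first by rewrite /rising big_ord0 expr0.
rewrite risingS doubleS !factS !natrM exprS.
have -> : (m.*2.+2)%:R = 2 * m%:R + 2 :> R by rewrite -addn2 -mul2n natrD natrM.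
have -> : (m.*2.+1)%:R = 2 * m%:R + 1 :> R by rewrite -addn1 -mul2n natrD natrM.
have -> : m.+1%:R = m%:R + 1 :> R by rewrite -addn1 natrD.
transitivity ((rising 2^-1 m * m`!%:R) * ((2^-1 + m%:R) * (m%:R + 1)) : R); first by ring.
by rewrite IH; field.
Qed.

(** The square of a centred Gaussian variable has a chi-square distribution with one degree of
    freedom. *)
Lemma half_moments_gauss n (P : 'M[R]_n) (w : 'cV[R]_n) : posdefmx P ->
  dotv (invmx P *m w) w != 0 ->
  half_moments (mu n) (fun x => expR (- 2^-1 * dotv (P *m x) x))
    (fun x => dotv x w ^+ 2 / (2 * dotv (invmx P *m w) w))
    (\int[mu n]_x expR (- 2^-1 * dotv (P *m x) x))%R.
Proof.
move=> pP; set k := dotv _ w => k0 m.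
have FE x : expR (- 2^-1 * dotv (P *m x) x) * (dotv x w ^+ 2 / (2 * k)) ^+ m =
    (2 * k) ^- m * (expR (- 2^-1 * dotv (P *m x) x) * dotv x w ^+ m.*2).
  by rewrite exprMn -exprM mul2n exprVn; ring.
have iE := rintegrable_gauss_moment w pP m.*2.
split; first by under eq_fun do rewrite FE; exact: rintegrableZ.
under eq_Rintegral do rewrite FE.
rewrite rintZ// gauss_moment// odd_double doubleK -/k.
have f0 : m`!%:R != 0 :> R by rewrite pnatr_eq0 -lt0n fact_gt0.
apply: (mulIf f0); rewrite -[RHS]mulrA rising_half.
rewrite (_ : (k / 2) ^+ m = (2 * k) ^+ m * 4^-1 ^+ m); last first.
  by rewrite -exprMn; congr (_ ^+ _); field.
have : (2 * k) ^+ m != 0 by rewrite expf_neq0// mulf_neq0.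
by move: ((2 * k) ^+ m) (4^-1 ^+ m) => a b a0; field; rewrite f0 a0.
Qed.

Lemma rint_gauss_line (a : R) : 0 < a ->
  (\int[mu 1]_t expR (- a * dotv t t))%R = Num.sqrt (pi / a).
Proof. by move=> a0; rewrite /Rintegral integral_gaussRn// expr1. Qed.

Lemma measurable_dotvv n : measurable_fun setT (fun x : 'cV[R]_n => dotv x x).
Proof. by have := @measurable_quad R n 1%:M; under eq_fun do rewrite mul1mx. Qed.

Lemma rintegrable_gauss_norm n (a : R) : 0 < a ->
  rintegrable (mu n) (fun x => expR (- a * dotv x x)).
Proof.
move=> a0; have := @rintegrable_gauss R n a 1%:M a0.
under eq_fun do rewrite mul1mx; apply.
split=> [|x x0]; first by rewrite trmx1.
by rewrite mul1mx lt_neqAle eq_sym dotvv_eq0 x0 dotvv_ge0.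
Qed.

Lemma posdef_scalar n (a : R) : 0 < a -> posdefmx (a%:M : 'M[R]_n).
Proof.
move=> a0; split=> [|x x0]; first by rewrite tr_scalar_mx.
by rewrite mul_scalar_mx dotvZl mulr_gt0// lt_neqAle eq_sym dotvv_eq0 x0 dotvv_ge0.
Qed.

Lemma dotv1E (t u : 'cV[R]_1) : dotv t u = t 0 0 * u 0 0.
Proof. by rewrite /dotv big_ord1. Qed.

Lemma half_moments_line : half_moments (mu 1) (fun t => expR (- dotv t t))
  (fun t => dotv t t) (Num.sqrt pi).
Proof.
have p2 := @posdef_scalar 1 2 (ltr0Sn R 1).
have k2 : dotv (invmx (2%:M : 'M[R]_1) *m const_mx 1) (const_mx 1) = 2^-1.
  by rewrite invmx_scalar mul_scalar_mx dotvZl dotv1E !mxE !mulr1.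
have := @half_moments_gauss 1 2%:M (const_mx 1) p2.
rewrite k2 mulfV// => /(_ (invr_neq0 (lt0r_neq0 (ltr0Sn R 1)))).
have E1 : (fun t : 'cV[R]_1 => expR (- 2^-1 * dotv (2%:M *m t) t)) =
    (fun t => expR (- dotv t t)).
  by apply/funext => t; rewrite mul_scalar_mx dotvZl mulNr mulKf.
have E2 : (fun t : 'cV[R]_1 => dotv t (const_mx 1) ^+ 2 / 1) = (fun t => dotv t t).
  by apply/funext => t; rewrite !dotv1E mxE mulr1 divr1.
rewrite E1 E2 (_ : (\int[_]_x _)%R = Num.sqrt pi)//.
rewrite -[pi]divr1 -rint_gauss_line//.
by apply: eq_Rintegral => t _; rewrite mulN1r.
Qed.

Lemma laplace_line (s : R) : -1 < s ->
  laplace (mu 1) (fun t => (expR (- dotv t t))%:C%C) (fun t => dotv t t) s%:C%C =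
  (Num.sqrt (pi / (1 + s)))%:C%C.
Proof.
move=> s1; rewrite -rint_gauss_line; last by rewrite -ltrBlDl sub0r.
rewrite -cint_real; apply: eq_cint => t.
rewrite -rmorphN -rmorphM cexp_real -rmorphM -expRD; congr (expR _)%:C%C.
by ring.
Qed.

Lemma expNiE (t : R) : expNi t = cexp (- ('i%C * t%:C%C)).
Proof.
by apply: complexP; rewrite /cexp /= !(mul0r, mul1r, mulr0, subr0, add0r, addr0, oppr0) expR0 mul1r ?cosN ?sinN.
Qed.

Lemma cabs_expNi (t : R) : cabs (expNi t) = 1.
Proof. by rewrite expNiE cabs_cexp /= !(mul0r, mul1r, mulr0, subr0, oppr0) expR0. Qed.

Lemma expNiD (s t : R) : expNi (s + t) = expNi s * expNi t.
Proof. by rewrite !expNiE -cexpD; congr cexp; rewrite rmorphD; ring. Qed.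

Lemma gauss_fourier n (P : 'M[R]_n) (w : 'cV[R]_n) : posdefmx P ->
  cint (mu n) (fun x => (expR (- 2^-1 * dotv (P *m x) x))%:C%C * expNi (dotv x w)) =
  ((\int[mu n]_x expR (- 2^-1 * dotv (P *m x) x))%R *
    expR (- 2^-1 * dotv (invmx P *m w) w))%:C%C.
Proof.
move=> pP; have := gauss_laplace w pP 'i%C.
rewrite (_ : 'i%C ^+ 2 * _ = (- 2^-1 * dotv (invmx P *m w) w)%:C%C); last first.
  by rewrite sqr_i mulN1r -rmorphN; congr (_%:C%C); ring.
rewrite cexp_real -rmorphM => <-.
by apply: eq_cint => x; rewrite expNiE mulNr.
Qed.

Lemma gauss_fourier_line (s y : R) : 0 < s ->
  cint (mu 1) (fun t => (expR (- s * dotv t t))%:C%C * expNi (t 0 0 * y)) =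
  (Num.sqrt (pi / s) * expR (- (y ^+ 2 / (4 * s))))%:C%C.
Proof.
move=> s0; have p2 := @posdef_scalar 1 (2 * s) (mulr_gt0 (ltr0Sn R 1) s0).
have := gauss_fourier (const_mx y) p2; rewrite -rint_gauss_line//.
have E1 (t : 'cV[R]_1) : expR (- 2^-1 * dotv ((2 * s)%:M *m t) t) = expR (- s * dotv t t).
  by rewrite mul_scalar_mx dotvZl; congr expR; field.
rewrite invmx_scalar mul_scalar_mx dotvZl [dotv (const_mx y) _]dotv1E !mxE.
under eq_Rintegral do rewrite E1.
rewrite (_ : - 2^-1 * _ = - (y ^+ 2 / (4 * s))); last by field; rewrite gt_eqF.
move=> <-; apply: eq_cint => t; by rewrite E1 (dotv1E t (const_mx y)) mxE.
Qed.

Lemma cmeas_expNi d (T : measurableType d) (h : T -> R) : measurable_fun setT h ->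
  cmeas (fun x => expNi (h x)).
Proof.
move=> mh; under eq_fun do rewrite expNiE; apply: cmeas_cexp.
under eq_fun do rewrite -mulNr.
by apply: cmeasM; [exact: cmeas_cst|exact: cmeas_real].
Qed.

Lemma cmeas_cint d1 d2 (T1 : measurableType d1) (T2 : measurableType d2)
    (mu1 : {sigma_finite_measure set T1 -> \bar R})
    (mu2 : {sigma_finite_measure set T2 -> \bar R}) (k : T1 * T2 -> R[i]) f g :
  cmeas k -> rintegrable mu1 f -> rintegrable mu2 g ->
  (forall x y, cabs (k (x, y)) <= f x * g y) ->
  cmeas (fun x => cint mu2 (fun y => k (x, y))).
Proof.
move=> mk fi gi kfg.
have [ki1 ki2] : cintegrable (mu1 \x mu2)%E k.
  by apply: cintegrable_le mk (rintegrable_prod fi gi) _ => -[x y]; exact: kfg.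
split.
- by apply: (measurableT_comp _ (measurable_fubini_F ki1)).
- by apply: (measurableT_comp _ (measurable_fubini_F ki2)).
Qed.

End GaussianReference.

(** * Critical slices of the Fourier transform *)

Section CriticalSlice.
Variables (R : realType) (n : nat) (A : 'M[R]_n) (c C C' : R).
Variables (f : 'cV[R]_n -> R[i]) (w eta : 'cV[R]_n).
Local Notation mu n := (@lebesgueRn R n).
Hypotheses (pA : posdefmx A) (c0 : 0 < c) (C0 : 0 <= C) (C'0 : 0 <= C') (mf : cmeas f).
Hypothesis fA : forall x, cabs (f x) <= C * expR (- c * dotv (A *m x) x).
Hypothesis wA : dotv (invmx A *m w) w = 4 * c.

Definition slice_transform (t : 'cV[R]_1) : R[i] :=
  cint (mu n) (fun x => f x * expNi (dotv x (eta + t 0 0 *: w))).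

Definition slice_gauss (s : R[i]) : R[i] :=
  laplace (mu 1) slice_transform (fun t => dotv t t) s.

Definition modulated_gauss (u : R[i]) : R[i] :=
  laplace (mu n) (fun x => f x * expNi (dotv x eta)) (fun x => dotv x w ^+ 2 / 4) u.

Let EA (x : 'cV[R]_n) := expR (- c * dotv (A *m x) x).
Let k (s : R) (p : 'cV[R]_1 * 'cV[R]_n) : R[i] :=
  f p.2 * expNi (dotv p.2 (eta + p.1 0 0 *: w)) * (expR (- s * dotv p.1 p.1))%:C%C.

Let iEA : rintegrable (mu n) EA. Proof. exact: rintegrable_gauss. Qed.

Let mk s : cmeas (k s).
Proof.
apply: cmeasM.
  apply: cmeasM; first by apply: cmeas_comp mf _; exact: measurable_snd.
  apply: cmeas_expNi; under eq_fun do rewrite dotvDr dotvZr.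
  apply: measurable_funD.
    by apply: (measurableT_comp (measurable_dotv eta)); exact: measurable_snd.
  apply: measurable_funM.
    by apply: (measurableT_comp (measurable_coord 0)); exact: measurable_fst.
  by apply: (measurableT_comp (measurable_dotv w)); exact: measurable_snd.
apply: cmeas_real; apply: measurable_expR_comp; apply: measurable_funM.
  exact: measurable_cst.
by apply: (measurableT_comp (@measurable_dotvv R 1)); exact: measurable_fst.
Qed.

Let kle s (t : 'cV[R]_1) (x : 'cV[R]_n) : cabs (k s (t, x)) <= expR (- s * dotv t t) * (C * EA x).
Proof.
rewrite /k !cabsM cabs_expNi mulr1 cabs_real ger0_norm ?expR_ge0// mulrC.
by rewrite ler_wpM2l ?expR_ge0.
Qed.

Let islice (t : 'cV[R]_1) : cintegrable (mu n) (fun x => f x * expNi (dotv x (eta + t 0 0 *: w))).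
Proof.
apply: (cintegrable_le (h := fun x => C * EA x)); last first.
- by move=> x; rewrite cabsM cabs_expNi mulr1.
- exact: rintegrableZ.
- apply: cmeasM => //; apply: cmeas_expNi; exact: measurable_dotv.
Qed.

Let slice_k s t : slice_transform t * (expR (- s * dotv t t))%:C%C =
  cint (mu n) (fun x => k s (t, x)).
Proof. by rewrite /slice_transform -cintZr. Qed.

Lemma cmeas_slice : cmeas slice_transform.
Proof.
have H : cmeas (fun t => cint (mu n) (fun x => k 1 (t, x))).
  apply: (cmeas_cint (mk 1) _ _ (kle 1)); last exact: rintegrableZ.
  exact: rintegrable_gauss_norm.
have -> : slice_transform = fun t => cint (mu n) (fun x => k 1 (t, x)) * (expR (dotv t t))%:C%C.
  apply/funext => t; rewrite -slice_k -mulrA -rmorphM -expRD mulN1r addNr expR0.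
  by rewrite rmorph1 mulr1.
apply: cmeasM => //; apply: cmeas_real; apply: measurable_expR_comp.
exact: measurable_dotvv.
Qed.

(** Fubini and the Fourier transform of a one-dimensional Gaussian. *)
Lemma slice_gaussE (s : R) : 0 < s ->
  slice_gauss s%:C%C = (Num.sqrt (pi / s))%:C%C * modulated_gauss s^-1%:C%C.
Proof.
move=> s0.
transitivity (cint (mu 1) (fun t => cint (mu n) (fun x => k s (t, x)))).
  apply: eq_cint => t; rewrite -slice_k; congr (_ * _).
  by rewrite -rmorphN -rmorphM cexp_real.
rewrite (cfubini (mk s) _ _ (kle s)); first last.
- exact: rintegrableZ.
- exact: rintegrable_gauss_norm.
rewrite /modulated_gauss /laplace -cintZ; last first.
  apply: (cintegrable_le (h := fun x => C * EA x)); last first.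
  - move=> x; rewrite !cabsM cabs_expNi mulr1 cabs_cexp -rmorphN -rmorphM /=.
    rewrite -[leRHS]mulr1 ler_pM ?cabs_ge0 ?expR_ge0// -expR0 ler_expR mulNr oppr_le0.
    by rewrite mulr_ge0 ?invr_ge0 ?(ltW s0)// divr_ge0// sqr_ge0.
  - exact: rintegrableZ.
  - apply: cmeasM; last first.
      apply: cmeas_cexp; apply: cmeasM; first exact: cmeas_cst.
      apply: cmeas_real; apply: measurable_funM; last exact: measurable_cst.
      by apply: measurable_funX; exact: measurable_dotv.
    by apply: cmeasM => //; apply: cmeas_expNi; exact: measurable_dotv.
apply: eq_cint => x; rewrite /k /=.
transitivity (cint (mu 1) (fun t : 'cV[R]_1 => (f x * expNi (dotv x eta)) *
    ((expR (- s * dotv t t))%:C%C * expNi (t 0 0 * dotv x w)))).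
  by apply: eq_cint => t; rewrite dotvDr dotvZr expNiD; ring.
rewrite cintZ; last first.
  apply: (cintegrable_le (h := fun t : 'cV[R]_1 => expR (- s * dotv t t))).
  - apply: cmeasM; first by apply: cmeas_real; apply: measurable_expR_comp; apply: measurable_funM;
      [exact: measurable_cst|exact: measurable_dotvv].
    apply: cmeas_expNi; apply: measurable_funM; last exact: measurable_cst.
    exact: measurable_coord.
  - exact: rintegrable_gauss_norm.
  - by move=> t; rewrite cabsM cabs_expNi mulr1 cabs_real ger0_norm ?expR_ge0.
rewrite gauss_fourier_line// -rmorphN -rmorphM cexp_real [RHS]mulrCA -rmorphM.
by congr (_ * (_ * expR _)%:C%C); field; rewrite gt_eqF.
Qed.

Hypothesis Fw : forall t, cabs (slice_transform t) <= C' * expR (- dotv t t).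

(** The Gaussian [g1], on an auxiliary line, turns the powers [s^(-1/2)] of the
    inversion into integer ones and makes the weights exponentially distributed. *)
Let g1 (t : 'cV[R]_1) : R := expR (- dotv t t).
Let kX (p : 'cV[R]_1 * 'cV[R]_1) : R[i] := slice_transform p.1 * (g1 p.2)%:C%C.
Let qX (p : 'cV[R]_1 * 'cV[R]_1) : R := dotv p.1 p.1 + dotv p.2 p.2.
Let kY (p : 'cV[R]_n * 'cV[R]_1) : R[i] :=
  ((Num.sqrt pi)%:C%C * (f p.1 * expNi (dotv p.1 eta))) * (g1 p.2)%:C%C.
Let qY (p : 'cV[R]_n * 'cV[R]_1) : R := dotv p.1 w ^+ 2 / 4 + dotv p.2 p.2.
Let muX := (mu 1 \x mu 1)%E.
Let muY := (mu n \x mu 1)%E.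

Let mg1 : measurable_fun setT g1.
Proof.
apply: measurable_expR_comp; apply: measurableT_comp => //; exact: measurable_dotvv.
Qed.

Let momX : exp_moments muX (fun p => g1 p.1 * g1 p.2) qX (Num.sqrt pi * Num.sqrt pi).
Proof. exact: (exp_moments_prod (@half_moments_line R) (@half_moments_line R)). Qed.

(** The normalisation [dotv (invmx A *m w) w = 4 * c] says that [dotv x w ^+ 2 / 4] has exactly
    the critical distribution for the weight [EA]. *)
Let momY : exists M, exp_moments muY (fun p => EA p.1 * g1 p.2) qY M.
Proof.
have p2 : posdefmx ((2 * c) *: A) by apply: posdefZ => //; rewrite mulr_gt0.
have := half_moments_gauss (w := w) p2.
have -> : dotv (invmx ((2 * c) *: A) *m w) w = 2.
  rewrite invmxZ ?posdef_unit// -scalemxAl dotvZl wA; field; exact: lt0r_neq0.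
have -> : (fun x : 'cV[R]_n => expR (- 2^-1 * dotv ((2 * c) *: A *m x) x)) = EA.
  by apply/funext => x; rewrite -scalemxAl dotvZl; congr expR; field.
move=> H; exists ((\int[mu n]_x EA x)%R * Num.sqrt pi).
have HE : half_moments (mu n) EA (fun x => dotv x w ^+ 2 / 4) (\int[mu n]_x EA x)%R.
  have -> : (fun x : 'cV[R]_n => dotv x w ^+ 2 / 4) = (fun x => dotv x w ^+ 2 / (2 * 2)).
    by apply/funext => x; congr (_ / _); ring.
  by apply: H; rewrite pnatr_eq0.
exact: (exp_moments_prod HE (@half_moments_line R)).
Qed.

Let laplaceX (s : R) : -1 < s ->
  laplace muX kX qX s%:C%C = slice_gauss s%:C%C * (Num.sqrt (pi / (1 + s)))%:C%C.
Proof.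
move=> s1; rewrite -laplace_line// /slice_gauss /laplace -cint_prod.
- by apply: eq_cint => -[t u]; rewrite /kX /qX /= !rmorphD mulrDr cexpD; ring.
- apply: (cintegrable_le (h := fun t : 'cV[R]_1 => C' * expR (- (1 + s) * dotv t t))).
  + apply: cmeasM; first exact: cmeas_slice.
    apply: cmeas_cexp; apply: cmeasM; first exact: cmeas_cst.
    by apply: cmeas_real; exact: measurable_dotvv.
  + by apply/rintegrableZ/rintegrable_gauss_norm; rewrite -ltrBlDl sub0r.
  + move=> t; rewrite cabsM cabs_cexp -rmorphN -rmorphM /= (le_trans (ler_wpM2r _ (Fw t))) ?expR_ge0//.
    by rewrite -mulrA -expRD ler_wpM2l// ler_expR -subr_ge0 (_ : _ - _ = 0)//; ring.
- apply: (cintegrable_le (h := fun t : 'cV[R]_1 => expR (- (1 + s) * dotv t t))).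
  + apply: cmeasM; first exact: cmeas_real.
    apply: cmeas_cexp; apply: cmeasM; first exact: cmeas_cst.
    by apply: cmeas_real; exact: measurable_dotvv.
  + by apply: rintegrable_gauss_norm; rewrite -ltrBlDl sub0r.
  + move=> t; rewrite cabsM cabs_real cabs_cexp -rmorphN -rmorphM /= ger0_norm ?expR_ge0//.
    by rewrite -expRD ler_expR -subr_ge0 (_ : _ - _ = 0)//; ring.
Qed.

Let laplaceY (u : R) : 0 < u -> laplace muY kY qY u%:C%C =
  (Num.sqrt pi)%:C%C * modulated_gauss u%:C%C * (Num.sqrt (pi / (1 + u)))%:C%C.
Proof.
move=> u0; have imod : cintegrable (mu n) (fun x => (f x * expNi (dotv x eta)) *
    cexp (- u%:C%C * (dotv x w ^+ 2 / 4)%:C%C)).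
  apply: (cintegrable_le (h := fun x => C * EA x)); last first.
  - move=> x; rewrite !cabsM cabs_expNi mulr1 cabs_cexp -rmorphN -rmorphM /=.
    rewrite -[leRHS]mulr1 ler_pM ?cabs_ge0 ?expR_ge0// -expR0 ler_expR mulNr oppr_le0.
    by rewrite mulr_ge0 ?(ltW u0)// divr_ge0// sqr_ge0.
  - exact: rintegrableZ.
  - apply: cmeasM; last first.
      apply: cmeas_cexp; apply: cmeasM; first exact: cmeas_cst.
      apply: cmeas_real; apply: measurable_funM; last exact: measurable_cst.
      by apply: measurable_funX; exact: measurable_dotv.
    by apply: cmeasM => //; apply: cmeas_expNi; exact: measurable_dotv.
rewrite -laplace_line; last by rewrite (lt_trans _ u0)// ltrN10.
transitivity (cint (mu n) (fun x => (Num.sqrt pi)%:C%C * ((f x * expNi (dotv x eta)) *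
    cexp (- u%:C%C * (dotv x w ^+ 2 / 4)%:C%C))) *
  cint (mu 1) (fun t => (g1 t)%:C%C * cexp (- u%:C%C * (dotv t t)%:C%C))); last first.
  by rewrite cintZ.
rewrite -cint_prod.
- by apply: eq_cint => -[t v]; rewrite /kY /qY /= rmorphD mulrDr cexpD; ring.
- exact: cintegrableZ.
- apply: (cintegrable_le (h := fun t : 'cV[R]_1 => expR (- (1 + u) * dotv t t))).
  + apply: cmeasM; first exact: cmeas_real.
    apply: cmeas_cexp; apply: cmeasM; first exact: cmeas_cst.
    by apply: cmeas_real; exact: measurable_dotvv.
  + by apply: rintegrable_gauss_norm; rewrite ltr_wpDl.
  + move=> t; rewrite cabsM cabs_real cabs_cexp -rmorphN -rmorphM /= ger0_norm ?expR_ge0//.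
    by rewrite -expRD ler_expR -subr_ge0 (_ : _ - _ = 0)//; ring.
Qed.

(** Both sides of the inversion relation have exponentially distributed weights: on one side by
    the decay of the slice, on the other by the choice of [w]. *)
Lemma slice_gauss_polynomial : exists2 P : {poly R[i]}, (size P <= 4)%N &
  forall s : R, -1 < s -> s < 1 ->
  (1 + s%:C%C) ^+ 4 * (slice_gauss s%:C%C * (Num.sqrt (pi / (1 + s)))%:C%C) = P.[s%:C%C].
Proof.
have [MY momY'] := momY.
have mEX : measurable_fun setT (fun p : 'cV[R]_1 * 'cV[R]_1 => g1 p.1 * g1 p.2).
  apply: measurable_funM; first by apply: (measurableT_comp mg1); exact: measurable_fst.
  by apply: (measurableT_comp mg1); exact: measurable_snd.
have mEY : measurable_fun setT (fun p : 'cV[R]_n * 'cV[R]_1 => EA p.1 * g1 p.2).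
  apply: measurable_funM; last by apply: (measurableT_comp mg1); exact: measurable_snd.
  by apply: (measurableT_comp (measurable_gauss c A)); exact: measurable_fst.
have mqX : measurable_fun setT qX.
  apply: measurable_funD.
    by apply: (measurableT_comp (@measurable_dotvv R 1)); exact: measurable_fst.
  by apply: (measurableT_comp (@measurable_dotvv R 1)); exact: measurable_snd.
have mqY : measurable_fun setT qY.
  apply: measurable_funD; last first.
    by apply: (measurableT_comp (@measurable_dotvv R 1)); exact: measurable_snd.
  apply: measurable_funM; last exact: measurable_cst.
  apply: measurable_funX.
  by apply: (measurableT_comp (measurable_dotv w)); exact: measurable_fst.
have EX0 (p : 'cV[R]_1 * 'cV[R]_1) : 0 <= g1 p.1 * g1 p.2 by rewrite mulr_ge0 ?expR_ge0.
have EY0 (p : 'cV[R]_n * 'cV[R]_1) : 0 <= EA p.1 * g1 p.2 by rewrite mulr_ge0 ?expR_ge0.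
have qX0 p : 0 <= qX p by rewrite addr_ge0 ?dotvv_ge0.
have qY0 p : 0 <= qY p by rewrite addr_ge0 ?dotvv_ge0// divr_ge0 ?sqr_ge0.
have mkX : cmeas kX.
  apply: cmeasM; first by apply: cmeas_comp cmeas_slice _; exact: measurable_fst.
  by apply: cmeas_real; apply: (measurableT_comp mg1); exact: measurable_snd.
have mkY : cmeas kY.
  apply: cmeasM; last first.
    by apply: cmeas_real; apply: (measurableT_comp mg1); exact: measurable_snd.
  apply: cmeasM; first exact: cmeas_cst.
  apply: cmeasM; first by apply: cmeas_comp mf _; exact: measurable_fst.
  apply: cmeas_expNi; apply: (measurableT_comp (measurable_dotv eta)).
  exact: measurable_fst.
have kX_le p : cabs (kX p) <= C' * (g1 p.1 * g1 p.2).
  by rewrite cabsM cabs_real (ger0_norm (expR_ge0 _)) mulrA ler_wpM2r ?expR_ge0.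
have kY_le p : cabs (kY p) <= (Num.sqrt pi * C) * (EA p.1 * g1 p.2).
  rewrite !cabsM !cabs_real cabs_expNi mulr1 (ger0_norm (expR_ge0 _)).
  by rewrite ger0_norm ?sqrtr_ge0// mulrA ler_wpM2r ?expR_ge0// -mulrA ler_wpM2l ?sqrtr_ge0.
have CY0 : 0 <= Num.sqrt pi * C by rewrite mulr_ge0 ?sqrtr_ge0.
have [] := inversion_rel_polynomial
  (analytic_laplace mEX EX0 mqX qX0 momX mkX kX_le)
  (analytic_laplace mEY EY0 mqY qY0 momY' mkY kY_le)
  (series_laplace mEX EX0 mqX qX0 momX mkX kX_le)
  (series_laplace mEY EY0 mqY qY0 momY' mkY kY_le)
  (summable_laplace EX0 mqX qX0 momX mkX C'0 kX_le)
  (summable_laplace EY0 mqY qY0 momY' mkY CY0 kY_le).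
  move=> s s0; rewrite /inversion_rel -fmorphV laplaceX ?(lt_trans _ s0) ?ltrN10//.
  rewrite laplaceY ?invr_gt0// slice_gaussE//.
  rewrite ![_ * modulated_gauss _]mulrC -!mulrA mulrCA; congr (_ * _).
  rewrite -!rmorphM; congr (_%:C%C).
  have sp : 0 <= (pi : R) := pi_ge0 R.
  have -> : pi / (1 + s^-1) = s * (pi / (1 + s)) by field; rewrite !gt_eqF// ?addr_gt0// ltr_wpDl.
  have -> : pi / s = pi * s / s ^+ 2 by field; rewrite gt_eqF.
  rewrite (sqrtrM _ (ltW s0)) (sqrtrM (s ^- 2)) ?mulr_ge0 ?(ltW s0)//.
  rewrite sqrtrV ?sqr_ge0// sqrtr_sqr ger0_norm ?(ltW s0)// sqrtrM//.
  by field; rewrite gt_eqF.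
move=> P sP HP; exists P => // s s1 s2.
rewrite -laplaceX// -HP// cabs_real ltr_norml s1 s2//.
Qed.

End CriticalSlice.

Section SliceConsequences.
Variables (R : realType).
Local Notation mu n := (@lebesgueRn R n).

Lemma horner_bounded (P : {poly R[i]}) : exists2 B : R, 0 <= B &
  forall z : R[i], cabs z <= 1 -> cabs P.[z] <= B.
Proof.
exists (\sum_(i < size P) cabs P`_i); first by apply: sumr_ge0 => i _; exact: cabs_ge0.
move=> z z1; rewrite horner_coef (le_trans (cabs_sum _ _ _))//; apply: ler_sum => i _.
by rewrite cabsM cabsX ler_piMr ?cabs_ge0// exprn_ile1 ?cabs_ge0.
Qed.

(** At a point tending to [0] the bound kills the constant term; dividing by ['X] then lowers
    the order by one. *)
Lemma poly_half_order n (P : {poly R[i]}) (D : R) : (size P <= n)%N -> 0 <= D ->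
  (forall x : R, 0 < x -> x < 1 -> cabs P.[x%:C%C] <= D * (x ^+ n / Num.sqrt x)) -> P = 0.
Proof.
move=> + D0; elim: n P => [|n IH] P sP HP.
  by apply/eqP; rewrite -size_poly_leq0.
have [Q [a PE]] : exists Q a, P = Q * 'X + a%:P.
  by elim/poly_ind: P {sP HP} => [|Q a _]; [exists 0, 0; rewrite mul0r addr0|exists Q, a].
have hP z : P.[z] = Q.[z] * z + a by rewrite PE !hornerE.
have [B B0 HB] := horner_bounded Q.
have a0 : a = 0.
  apply/eqP; rewrite -cabs_eq0 eq_le cabs_ge0 andbT leNgt; apply/negP => agt.
  pose K := D + B + cabs a.
  have K0 : 0 < K by rewrite /K ltr_wpDl ?addr_ge0.
  pose y := cabs a / (2 * K).
  have y0 : 0 < y by rewrite divr_gt0 ?mulr_gt0.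
  have y1 : y < 1.
    rewrite ltr_pdivrMr ?mul1r ?mulr_gt0// mulr_natl mulr2n /K.
    by rewrite ltr_pwDl// lerDr addr_ge0.
  have x0 : 0 < y ^+ 2 by rewrite exprn_gt0.
  have x1 : y ^+ 2 < 1 by rewrite expr_lt1// ltW.
  have := HP _ x0 x1; rewrite hP sqrtr_sqr gtr0_norm// => H.
  have : cabs a <= D * y + B * y.
    rewrite -[a in cabs a](addKr (Q.[(y ^+ 2)%:C%C] * (y ^+ 2)%:C%C)) addrC.
    rewrite (le_trans (cabsB _ _))// lerD//.
      rewrite (le_trans H)// ler_wpM2l// exprS mulrAC (_ : y ^+ 2 / y = y); last first.
        by field; rewrite gt_eqF.
      by rewrite ler_piMr ?(ltW y0)// exprn_ile1// ltW.
    rewrite cabsM cabs_real gtr0_norm// ler_pM ?cabs_ge0 ?(ltW x0)//.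
      by rewrite HB// cabs_real gtr0_norm// ltW.
    by rewrite expr2 ler_piMl// ltW.
  rewrite leNgt => /negP; apply; rewrite -mulrDl.
  apply: (@le_lt_trans _ _ (K * y)); first by rewrite ler_wpM2r ?(ltW y0)// lerDl cabs_ge0.
  rewrite /y (_ : K * _ = cabs a / 2); first by lra.
  by field; rewrite gt_eqF.
rewrite PE a0 polyC0 addr0 (IH Q) ?mul0r//.
  by have [->|Q0] := eqVneq Q 0; rewrite ?size_poly0//; move: sP; rewrite PE a0 polyC0 addr0 size_mulX.
move=> x x0 x1; have := HP _ x0 x1; rewrite hP a0 addr0 cabsM cabs_real gtr0_norm//.
by rewrite -ler_pdivlMr// => /le_trans; apply; rewrite exprS -!mulrA ler_wpM2l// mulrC mulrA mulfVK ?gt_eqF// mulrC.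
Qed.

Variables (n : nat) (A : 'M[R]_n) (c C C' : R).
Variables (f : 'cV[R]_n -> R[i]) (w eta : 'cV[R]_n).
Hypotheses (pA : posdefmx A) (c0 : 0 < c) (C0 : 0 <= C) (C'0 : 0 <= C') (mf : cmeas f).
Hypothesis fA : forall x, cabs (f x) <= C * expR (- c * dotv (A *m x) x).
Hypothesis wA : dotv (invmx A *m w) w = 4 * c.

(** [slice_gauss_polynomial] read at [s = u^-1]: its cubic is reversed. *)
Lemma modulated_gauss_rational :
  (forall t, cabs (slice_transform f w eta t) <= C' * expR (- dotv t t)) ->
  exists2 Q : {poly R[i]}, (size Q <= 4)%N & forall u : R, 1 < u ->
    ((1 + u) ^+ 4 / Num.sqrt (1 + u))%:C%C * modulated_gauss f w eta u%:C%C = Q.[u%:C%C].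
Proof.
move=> Fw; have [P sP HP] := slice_gauss_polynomial pA c0 C0 C'0 mf fA wA Fw.
exists ((pi^-1)%:C%C *: \poly_(i < 4) P`_(3 - i)).
  by rewrite (leq_trans (size_scale_leq _ _))// size_poly.
move=> u u1; have u0 : 0 < u by rewrite (lt_trans _ u1).
have s0 : 0 < u^-1 by rewrite invr_gt0.
have s1 : u^-1 < 1 by rewrite invf_lt1.
have := HP u^-1; rewrite s1 (lt_trans _ s0) ?ltrN10// => /(_ isT isT).
rewrite (slice_gaussE w eta pA c0 mf fA)// invrK => H.
have u0C : u%:C%C != 0 :> R[i] by rewrite fmorph_eq0 gt_eqF.
have -> : ((pi^-1)%:C%C *: \poly_(i < 4) P`_(3 - i)).[u%:C%C] =
    (pi^-1 * u ^+ 3)%:C%C * P.[(u^-1)%:C%C].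
  rewrite hornerZ horner_poly (horner_coef_wide _ sP) rmorphM rmorphXn -mulrA; congr (_ * _).
  rewrite !big_ord_recl !big_ord0 /= !fmorphV; field.
  by rewrite u0C.
rewrite -H.
set Psi := modulated_gauss _ _ _ _.
have p0 : 0 < (pi : R) := pi_gt0 R.
have v0 : 0 < 1 + u by rewrite ltr_wpDl.
have vs : Num.sqrt (1 + u) != 0 by rewrite gt_eqF// sqrtr_gt0.
have G (e a b : R) : (1 + e%:C%C) ^+ 4 * (a%:C%C * Psi * b%:C%C) =
   ((1 + e) ^+ 4 * (a * b))%:C%C * Psi by ring.
rewrite G.
rewrite mulrA -rmorphM; congr (_%:C%C * _).
have -> : pi / (1 + u^-1) = pi * u / (1 + u) by field; rewrite !gt_eqF// ltr_wpDl.
have pu : 0 <= pi * u by rewrite mulr_ge0// ltW.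
have -> : Num.sqrt (pi * u) * Num.sqrt (pi * u / (1 + u)) = pi * u / Num.sqrt (1 + u).
  by rewrite (sqrtrM _ pu) mulrA -expr2 sqr_sqrtr// sqrtrV ?(ltW v0).
move: (lt0r_neq0 p0); move: (pi : R) => p p1.
by field; rewrite vs (gt_eqF u0).
Qed.

(** If the slice decays faster than the critical Gaussian, [slice_gauss] stays bounded near
    [-1], so the cubic governing it vanishes there to too high an order. *)
Lemma modulated_gauss_eq0 (b : R) : 1 < b ->
  (forall t, cabs (slice_transform f w eta t) <= C' * expR (- b * dotv t t)) ->
  forall u : R, 1 < u -> modulated_gauss f w eta u%:C%C = 0.
Proof.
move=> b1 Fb u u1; have u0 : 0 < u by rewrite (lt_trans _ u1).
have Fw t : cabs (slice_transform f w eta t) <= C' * expR (- dotv t t).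
  rewrite (le_trans (Fb t))// ler_wpM2l// ler_expR mulNr lerN2.
  by rewrite ler_peMl ?dotvv_ge0// ltW.
have [P sP HP] := slice_gauss_polynomial pA c0 C0 C'0 mf fA wA Fw.
have b10 : 0 < b - 1 by rewrite subr_gt0.
have p0 : 0 < (pi : R) := pi_gt0 R.
have Phi_le (s : R) : -1 < s -> cabs (slice_gauss f w eta s%:C%C) <= C' * Num.sqrt (pi / (b - 1)).
  move=> s1; have bs : 0 < b + s by lra.
  have [mF iF] : cmeas (fun t => slice_transform f w eta t * cexp (- s%:C%C * (dotv t t)%:C%C)) /\
      rintegrable (mu 1) (fun t => C' * expR (- (b + s) * dotv t t)).
    split; last by apply: rintegrableZ; exact: rintegrable_gauss_norm.
    apply: cmeasM; first exact: (cmeas_slice w eta pA c0 mf fA).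
    apply: cmeas_cexp; apply: cmeasM; first exact: cmeas_cst.
    by apply: cmeas_real; exact: measurable_dotvv.
  apply: (@le_trans _ _ (\int[mu 1]_t (C' * expR (- (b + s) * dotv t t)))%R).
    apply: cabs_cint_le => // t; rewrite cabsM cabs_cexp -rmorphN -rmorphM /=.
    rewrite (le_trans (ler_wpM2r _ (Fb t))) ?expR_ge0// -mulrA -expRD ler_wpM2l// ler_expR.
    by rewrite -subr_ge0 (_ : _ - _ = 0)//; ring.
  rewrite rintZ; last exact: rintegrable_gauss_norm.
  rewrite rint_gauss_line// ler_wpM2l// ler_wsqrtr// ler_pM2l// lef_pV2 ?posrE//; lra.
have Q0 : P \Po ('X - 1%:P) = 0.
  apply: (@poly_half_order 4 _ (C' * Num.sqrt (pi / (b - 1)) * Num.sqrt pi)).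
  - by rewrite size_comp_poly2 ?size_XsubC.
  - by rewrite !mulr_ge0// sqrtr_ge0.
  move=> x x0 x1; rewrite horner_comp hornerD hornerX hornerN hornerC.
  have -> : x%:C%C - 1 = (x - 1)%:C%C :> R[i] by rewrite rmorphB rmorph1.
  rewrite -HP; [|lra|lra].
  have -> : 1 + (x - 1)%:C%C = x%:C%C :> R[i] by rewrite rmorphB rmorph1 addrC subrK.
  have -> : 1 + (x - 1) = x by ring.
  rewrite cabsM cabsX (cabsM (slice_gauss _ _ _ _)) !cabs_real (gtr0_norm x0) (ger0_norm (sqrtr_ge0 _)).
  rewrite (sqrtrM _ (ltW p0)) sqrtrV ?(ltW x0)//.
  rewrite mulrCA [leRHS](_ : _ = (C' * Num.sqrt (pi / (b - 1))) *
    (x ^+ 4 * (Num.sqrt pi * (Num.sqrt x)^-1))); last by ring.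
  rewrite ler_wpM2r//; last by apply: Phi_le; lra.
  by rewrite !mulr_ge0 ?exprn_ge0 ?invr_ge0 ?sqrtr_ge0 ?(ltW x0).
have s0 : 0 < u^-1 by rewrite invr_gt0.
have s1 : u^-1 < 1 by rewrite invf_lt1.
have sN : -1 < u^-1 by rewrite (lt_trans _ s0) ?ltrN10.
have P0 : P.[(u^-1)%:C%C] = 0.
  have := congr1 (fun q : {poly R[i]} => q.[(u^-1)%:C%C + 1]) Q0.
  by rewrite horner_comp hornerD hornerX hornerN hornerC horner0 addrK.
have nz (x : R) : x != 0 -> (x%:C%C == 0 :> R[i]) = false.
  by move=> x0; rewrite fmorph_eq0 (negPf x0).
have n1 : (1 + (u^-1)%:C%C == 0 :> R[i]) = false.
  by rewrite -(rmorph1 (real_complex R)) -rmorphD nz// gt_eqF// addr_gt0.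
have n2 : (Num.sqrt (pi / (1 + u^-1)))%:C%C == 0 :> R[i] = false.
  by apply: nz; rewrite gt_eqF// sqrtr_gt0 divr_gt0// addr_gt0.
have n3 : (Num.sqrt (pi / u^-1))%:C%C == 0 :> R[i] = false.
  by apply: nz; rewrite gt_eqF// sqrtr_gt0 invrK mulr_gt0.
have /eqP := HP _ sN s1; rewrite P0 mulf_eq0 expf_eq0 n1 /= mulf_eq0 n2 orbF.
by rewrite (slice_gaussE w eta pA c0 mf fA)// mulf_eq0 n3 invrK => /eqP.
Qed.

End SliceConsequences.

(** * Approximation by trigonometric polynomials *)

Section WeightedApproximation.
Variables (R : realType) (n : nat) (w : 'cV[R]_n -> R).
Local Notation mu := (@lebesgueRn R n).
Hypotheses (w0 : forall x, 0 <= w x) (iw : rintegrable mu w).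

Definition trigpoly (s : seq (R[i] * 'cV[R]_n)) (x : 'cV[R]_n) : R[i] :=
  \sum_(p <- s) p.1 * expNi (dotv x p.2).

Lemma trigpoly_cat s r x : trigpoly (s ++ r) x = trigpoly s x + trigpoly r x.
Proof. exact: big_cat. Qed.

Lemma trigpoly_mul s r : exists q, forall x, trigpoly q x = trigpoly s x * trigpoly r x.
Proof.
elim: s => [|[a y] s [q IH]].
  by exists [::] => x; rewrite /trigpoly !big_nil mul0r.
exists ([seq (a * p.1, y + p.2) | p <- r] ++ q) => x.
rewrite trigpoly_cat IH /trigpoly big_map big_cons mulrDl; congr (_ + _).
rewrite mulr_sumr; apply: eq_bigr => p _ /=.
by rewrite dotvDr expNiD; ring.
Qed.

Lemma trigpoly_bounded s : exists2 B : R, 0 <= B & forall x, cabs (trigpoly s x) <= B.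
Proof.
exists (\sum_(p <- s) cabs p.1); first by apply: sumr_ge0 => p _; exact: cabs_ge0.
move=> x; rewrite (le_trans (cabs_sum _ _ _))//; apply: ler_sum => p _.
by rewrite cabsM cabs_expNi mulr1.
Qed.

Lemma cmeas_trigpoly s : cmeas (trigpoly s).
Proof.
apply: cmeas_sum => p; apply: cmeasM; first exact: cmeas_cst.
by apply: cmeas_expNi; exact: measurable_dotv.
Qed.

Definition wnorm2 (k : 'cV[R]_n -> R[i]) : R := (\int[mu]_x (w x * cabs (k x) ^+ 2))%R.

Definition cbounded (k : 'cV[R]_n -> R[i]) := cmeas k /\ exists B : R, forall x, cabs (k x) <= B.

Lemma cbounded_trigpoly s : cbounded (trigpoly s).
Proof. by split; [exact: cmeas_trigpoly|have [B _ HB] := trigpoly_bounded s; exists B]. Qed.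

Lemma cboundedB k l : cbounded k -> cbounded l -> cbounded (fun x => k x - l x).
Proof.
move=> [mk [B HB]] [ml [D HD]]; split.
  by under eq_fun do rewrite -mulN1r; apply: cmeasD => //; apply: cmeasM => //; exact: cmeas_cst.
by exists (B + D) => x; rewrite (le_trans (cabsB _ _))// lerD.
Qed.

Let wk0 (k : 'cV[R]_n -> R[i]) x : 0 <= w x * cabs (k x) ^+ 2.
Proof. exact: mulr_ge0 (w0 x) (sqr_ge0 _). Qed.

Lemma rintegrable_wnorm2 k : cbounded k -> rintegrable mu (fun x => w x * cabs (k x) ^+ 2).
Proof.
move=> [mk [B HB]]; apply: (rintegrable_le (g := fun x => B ^+ 2 * w x)).
- apply: measurable_funM; first exact: rintegrable_meas iw.
  by apply: measurable_funX; exact: cmeas_cabs.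
- exact: rintegrableZ.
- move=> x; rewrite (ger0_norm (wk0 k x)) mulrC ler_wpM2r//.
  by rewrite lerXn2r ?nnegrE ?cabs_ge0// (le_trans (cabs_ge0 _) (HB x)).
Qed.

Lemma wnorm2_le k l h (a b : R) : cbounded k -> cbounded l -> cbounded h ->
  (forall x, cabs (k x) ^+ 2 <= a * cabs (l x) ^+ 2 + b * cabs (h x) ^+ 2) ->
  wnorm2 k <= a * wnorm2 l + b * wnorm2 h.
Proof.
move=> /rintegrable_wnorm2 bk /rintegrable_wnorm2 bl /rintegrable_wnorm2 bh H.
rewrite /wnorm2 -!rintZ// -rintD; [|exact: rintegrableZ|exact: rintegrableZ].
apply: rint_le => //; first by apply: rintegrableD; exact: rintegrableZ.
move=> x; rewrite (_ : _ + _ = w x * (a * cabs (l x) ^+ 2 + b * cabs (h x) ^+ 2)); last by ring.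
exact: ler_wpM2l.
Qed.

Lemma sqr_cabsD (y z : R[i]) : cabs (y + z) ^+ 2 <= 2 * cabs y ^+ 2 + 2 * cabs z ^+ 2.
Proof.
apply: (@le_trans _ _ ((cabs y + cabs z) ^+ 2)).
  by rewrite lerXn2r ?nnegrE ?addr_ge0 ?cabs_ge0// cabsD.
have := sqr_ge0 (cabs y - cabs z); nra.
Qed.

(** The bounded functions in the closure of the trigonometric polynomials; they form an algebra
    closed under bounded pointwise limits. *)
Definition approximable k := cbounded k /\ forall e : R, 0 < e ->
  exists s, wnorm2 (fun x => k x - trigpoly s x) < e.

Lemma approximable_trigpoly s : approximable (trigpoly s).
Proof.
split; first exact: cbounded_trigpoly.
move=> e e0; exists s; rewrite (_ : wnorm2 _ = 0)//.
by rewrite /wnorm2; under eq_Rintegral do rewrite subrr cabs0 expr0n mulr0; rewrite rint0.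
Qed.

Lemma approximableD k l : approximable k -> approximable l ->
  approximable (fun x => k x + l x).
Proof.
move=> [bk Hk] [bl Hl].
have bkl : cbounded (fun x => k x + l x).
  have [mk [B HB]] := bk; have [ml [D HD]] := bl; split; first exact: cmeasD.
  by exists (B + D) => x; rewrite (le_trans (cabsD _ _))// lerD.
split=> // e e0; have e4 : 0 < e / 4 by rewrite divr_gt0.
have [s Hs] := Hk _ e4; have [r Hr] := Hl _ e4; exists (s ++ r).
have b1 := cboundedB bk (cbounded_trigpoly s); have b2 := cboundedB bl (cbounded_trigpoly r).
apply: (le_lt_trans (wnorm2_le (cboundedB bkl (cbounded_trigpoly (s ++ r))) b1 b2 (a := 2) (b := 2) _)).
  move=> x; rewrite trigpoly_cat (_ : _ - _ = (k x - trigpoly s x) + (l x - trigpoly r x)).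
    exact: sqr_cabsD.
  by ring.
by move: Hs Hr; lra.
Qed.

Lemma approximableM k l : approximable k -> approximable l ->
  approximable (fun x => k x * l x).
Proof.
move=> [bk Hk] [bl Hl].
have [mk [B HB]] := bk; have [ml [D HD]] := bl.
have bkl : cbounded (fun x => k x * l x).
  split; first exact: cmeasM.
  by exists (B * D) => x; rewrite cabsM ler_pM ?cabs_ge0.
split=> // e e0; have B0 : 0 <= B := le_trans (cabs_ge0 _) (HB 0).
have K0 (X : R) : 0 < 4 * (X ^+ 2 + 1) by rewrite mulr_gt0// ltr_wpDl ?sqr_ge0.
have [r Hr] := Hl (e / (4 * (B ^+ 2 + 1))) (divr_gt0 e0 (K0 B)).
have [E E0 HE] := trigpoly_bounded r.
have [s Hs] := Hk (e / (4 * (E ^+ 2 + 1))) (divr_gt0 e0 (K0 E)).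
have [q Hq] := trigpoly_mul s r; exists q.
have b1 := cboundedB bl (cbounded_trigpoly r); have b2 := cboundedB bk (cbounded_trigpoly s).
apply: (le_lt_trans (wnorm2_le (cboundedB bkl (cbounded_trigpoly q)) b1 b2
  (a := 2 * (B ^+ 2 + 1)) (b := 2 * (E ^+ 2 + 1)) _)).
  move=> x; rewrite Hq.
  rewrite (_ : _ - _ = k x * (l x - trigpoly r x) + trigpoly r x * (k x - trigpoly s x)); last by ring.
  have HB1 : cabs (k x) ^+ 2 <= B ^+ 2 + 1.
    by rewrite (@le_trans _ _ (B ^+ 2)) ?lerDl// lerXn2r ?nnegrE ?cabs_ge0.
  have HE1 : cabs (trigpoly r x) ^+ 2 <= E ^+ 2 + 1.
    by rewrite (@le_trans _ _ (E ^+ 2)) ?lerDl// lerXn2r ?nnegrE ?cabs_ge0.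
  rewrite (le_trans (sqr_cabsD _ _))// !cabsM !exprMn; apply: lerD; rewrite [leLHS]mulrA.
    by apply: ler_wpM2r; [exact: sqr_ge0|exact: ler_wpM2l].
  by apply: ler_wpM2r; [exact: sqr_ge0|exact: ler_wpM2l].
move: Hs Hr; rewrite !ltr_pdivlMr//.
set X := wnorm2 _; set Y := wnorm2 _ => HX HY.
rewrite (_ : _ + _ = (Y * (4 * (B ^+ 2 + 1)) + X * (4 * (E ^+ 2 + 1))) / 2); last by field.
by rewrite ltr_pdivrMr// mulr_natr mulr2n ltrD.
Qed.

Lemma approximable_cst c : approximable (fun=> c).
Proof.
rewrite (_ : (fun=> c) = trigpoly [:: (c, 0)]); first exact: approximable_trigpoly.
apply/funext => x; rewrite /trigpoly big_seq1 dotv0r expNiE rmorph0 mulr0 oppr0.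
by rewrite cexp0 mulr1.
Qed.

Lemma approximableB k l : approximable k -> approximable l ->
  approximable (fun x => k x - l x).
Proof.
move=> Kk Kl; rewrite (_ : (fun x => _) = fun x => k x + (-1) * l x).
  by apply: approximableD => //; apply: approximableM => //; exact: approximable_cst.
by apply/funext => x; rewrite mulN1r.
Qed.

Lemma rint_dominated_small (g : nat -> 'cV[R]_n -> R) G :
  (forall j, measurable_fun setT (g j)) -> rintegrable mu G ->
  (forall j x, 0 <= g j x <= G x) -> (forall x, g j x @[j --> \oo] --> 0) ->
  forall e : R, 0 < e -> exists j, (\int[mu]_x g j x)%R < e.
Proof.
move=> mg iG gG g0 e e0.
have ig j : rintegrable mu (g j).
  apply: rintegrable_le iG _ => // x; by have /andP[g1 g2] := gG j x; rewrite ger0_norm.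
have cv : (\int[mu]_x (g j x)%:E)%E @[j --> \oo] --> (\int[mu]_x (0 : R)%:E)%E.
  apply: (@dominated_cvg _ _ _ mu setT measurableT (fun j x => (g j x)%:E) (fun=> 0%:E) (fun x => (G x)%:E)).
  - by move=> j; apply/measurable_EFinP.
  - by move=> x _; apply: cvg_EFin; [near=> j|exact: g0].
  - by [].
  - exact: iG.
  - by move=> j x _; have /andP[g1 g2] := gG j x; rewrite lee_fin ger0_norm.
have {}cv : (\int[mu]_x g j x)%R @[j --> \oo] --> (0 : R).
  move: cv; rewrite integral0; under eq_fun do rewrite rint_EFin//.
  by move/fine_cvg.
have /cvgrPdist_lt/(_ e e0)[N _ HN] := cv.
exists N; have := HN N (leqnn N); rewrite sub0r normrN.
by apply: le_lt_trans; exact: ler_norm.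
Unshelve. all: by end_near. Qed.

(** Dominated convergence, the weight [w] being integrable. *)
Lemma approximable_lim (k_ : nat -> 'cV[R]_n -> R[i]) k (B : R) :
  (forall j, approximable (k_ j)) -> (forall j x, cabs (k_ j x) <= B) ->
  (forall x, cabs (k x - k_ j x) @[j --> \oo] --> (0 : R)) ->
  approximable k.
Proof.
move=> Kk HB cv; have bj j := (Kk j).1.
have near1 x (e : R) : 0 < e -> exists N, forall j, (N <= j)%N -> cabs (k x - k_ j x) < e.
  move=> e0; have /cvgrPdist_lt/(_ e e0)[N _ HN] := cv x; exists N => j Nj.
  by have := HN j Nj; rewrite sub0r normrN ger0_norm ?cabs_ge0.
have bk : cbounded k.
  split; last first.
    exists (1 + B) => x; have [N HN] := near1 x 1 ltr01.
    rewrite -[k x](subrK (k_ N x)) (le_trans (cabsD _ _))// lerD//.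
    exact/ltW/HN.
  split.
    apply: (measurable_fun_cvg (h := fun j x => complex.Re (k_ j x))).
  - by move=> j; exact: (bj j).1.1.
  - move=> x _; apply/cvgrPdist_lt => e e0; have [N HN] := near1 x e e0.
    exists N => // j Nj /=; rewrite -cReN -cReD.
    exact: le_lt_trans (Re_le_cabs _) (HN j Nj).
  apply: (measurable_fun_cvg (h := fun j x => complex.Im (k_ j x))).
  - by move=> j; exact: (bj j).1.2.
  - move=> x _; apply/cvgrPdist_lt => e e0; have [N HN] := near1 x e e0.
    exists N => // j Nj /=; rewrite -cImN -cImD.
    exact: le_lt_trans (Im_le_cabs _) (HN j Nj).
split=> // e e0; have [mk [D HD]] := bk.
have e4 : 0 < e / 4 by rewrite divr_gt0.
have D0 : 0 <= D + B.
  by rewrite addr_ge0 ?(le_trans (cabs_ge0 _) (HD 0))// (le_trans (cabs_ge0 _) (HB 0%N 0)).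
have [|||x|j Hj] := @rint_dominated_small (fun j x => w x * cabs (k x - k_ j x) ^+ 2)
  (fun x => (D + B) ^+ 2 * w x) _ _ _ _ _ e4.
- by move=> j; exact: rintegrable_meas (rintegrable_wnorm2 (cboundedB bk (bj j))).
- exact: rintegrableZ.
- move=> j x; rewrite (wk0 (fun x => k x - k_ j x)) /= mulrC ler_wpM2r//.
  by rewrite lerXn2r ?nnegrE ?cabs_ge0// (le_trans (cabsB _ _))// lerD.
- rewrite -[X in _ --> X](mulr0 (w x)); apply: cvgMr.
  by rewrite -[X in _ --> X](mulr0 0); exact: cvgM (cv x) (cv x).
have [s Hs] := (Kk j).2 _ e4; exists s.
have b1 := cboundedB bk (bj j); have b2 := cboundedB (bj j) (cbounded_trigpoly s).
apply: (le_lt_trans (wnorm2_le (cboundedB bk (cbounded_trigpoly s)) b1 b2 (a := 2) (b := 2) _)).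
  move=> x; rewrite (_ : k x - trigpoly s x = (k x - k_ j x) + (k_ j x - trigpoly s x)).
    exact: sqr_cabsD.
  by ring.
by move: Hs Hj; rewrite -/(wnorm2 _); lra.
Qed.

Definition rapproximable (u : 'cV[R]_n -> R) := approximable (fun x => (u x)%:C%C).

Lemma rapproximable_lim (u_ : nat -> 'cV[R]_n -> R) u (B : R) :
  (forall j, rapproximable (u_ j)) -> (forall j x, `|u_ j x| <= B) ->
  (forall x, u_ j x @[j --> \oo] --> u x) -> rapproximable u.
Proof.
move=> Ku uB cv; apply: (approximable_lim Ku) => [j x|x]; first by rewrite cabs_real; exact: uB.
apply/cvgrPdist_lt => e e0; have /cvgrPdist_lt/(_ e e0)[N _ HN] := cv x.
exists N => // j Nj; have := HN j Nj; rewrite /= -cabs_real rmorphB => H.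
by rewrite sub0r normrN ger0_norm ?cabs_ge0.
Qed.

Lemma rapproximableM u v : rapproximable u -> rapproximable v ->
  rapproximable (fun x => u x * v x).
Proof.
by move=> Ku Kv; rewrite /rapproximable; under eq_fun do rewrite rmorphM; exact: approximableM.
Qed.

Lemma rapproximableD u v : rapproximable u -> rapproximable v ->
  rapproximable (fun x => u x + v x).
Proof.
by move=> Ku Kv; rewrite /rapproximable; under eq_fun do rewrite rmorphD; exact: approximableD.
Qed.

Lemma rapproximableB u v : rapproximable u -> rapproximable v ->
  rapproximable (fun x => u x - v x).
Proof.
by move=> Ku Kv; rewrite /rapproximable; under eq_fun do rewrite rmorphB; exact: approximableB.
Qed.

Lemma rapproximable_cst (c : R) : rapproximable (fun=> c).
Proof. exact: approximable_cst. Qed.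

Lemma rapproximable_sin y (b : R) : rapproximable (fun x => sin (dotv x y - b)).
Proof.
have Kexp z : approximable (fun x => expNi (dotv x z)).
  rewrite (_ : (fun x => _) = trigpoly [:: (1, z)]); first exact: approximable_trigpoly.
  by apply/funext => x; rewrite /trigpoly big_seq1 mul1r.
rewrite /rapproximable (_ : (fun x => _) = fun x => ('i%C / 2) *
   (expNi (- b) * expNi (dotv x y) - expNi b * expNi (dotv x (- y)))).
  apply: approximableM; first exact: approximable_cst.
  by apply: approximableB; apply: approximableM => //; exact: approximable_cst.
apply/funext => x; rewrite -!expNiD dotvNr [- b + _]addrC.
have -> : b - dotv x y = - (dotv x y - b) by ring.
move: (dotv x y - b) => t; rewrite /expNi cosN sinN.
rewrite (_ : _ - _ = - (2 * 'i%C) * (sin t)%:C%C); last first.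
  by apply: complexP => /=; ring.
rewrite [RHS](_ : _ = - 'i%C ^+ 2 * (sin t)%:C%C); last by field.
by rewrite sqr_i opprK mul1r.
Qed.

(** Iterating this odd cubic drives every [s] of [[-1, 1]] to its sign, and thereby brings sign
    functions into the closure of the trigonometric polynomials. *)
Definition sharpen (s : R) : R := (3 * s - s ^+ 3) / 2.

Lemma sharpenN s : sharpen (- s) = - sharpen s.
Proof. by rewrite /sharpen; field. Qed.

Lemma iter_sharpenN j s : iter j sharpen (- s) = - iter j sharpen s.
Proof. by elim: j => //= j ->; rewrite sharpenN. Qed.

Lemma iter_sharpen_pos j (s : R) : 0 < s -> s <= 1 ->
  [/\ s <= iter j sharpen s, iter j sharpen s <= 1 &
   1 - iter j sharpen s <= (1 - s / 2) ^+ j].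
Proof.
move=> s0 s1; elim: j => [|j [H1 H2 H3]] /=; first by split=> //; rewrite expr0; lra.
move: (iter j sharpen s) H1 H2 H3 => t H1 H2 H3.
have t0 : 0 < t by exact: lt_le_trans H1.
have E : 1 - sharpen t = (1 - t) * (1 - t * (1 + t) / 2) by rewrite /sharpen; field.
have F : sharpen t - t = t * (1 - t) * (1 + t) / 2 by rewrite /sharpen; field.
have G : 0 <= sharpen t - t.
  by rewrite F !mulr_ge0 ?invr_ge0 ?subr_ge0 ?(ltW t0)// addr_ge0 ?(ltW t0).
have T : t * (1 + t) / 2 <= 1 by rewrite ler_pdivrMr// mul1r; nra.
split.
- by rewrite (le_trans H1)// -subr_ge0.
- by rewrite -subr_ge0 E mulr_ge0 ?subr_ge0.
- rewrite E exprSr ler_pM ?subr_ge0// lerD2l lerN2 ler_pM2r ?invr_gt0//.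
  by rewrite (le_trans H1)// ler_peMr ?(ltW t0)// lerDl ltW.
Qed.

Lemma cvg_sharpen (s : R) : `|s| <= 1 -> iter j sharpen s @[j --> \oo] --> Num.sg s.
Proof.
have pos (t : R) : 0 < t -> t <= 1 -> iter j sharpen t @[j --> \oo] --> (1 : R).
  move=> t0 t1; apply/cvgrPdist_le => e e0.
  have cv : (1 - t / 2) ^+ j @[j --> \oo] --> (0 : R).
    by apply: cvg_expr; rewrite ger0_norm; lra.
  have /cvgrPdist_le/(_ e e0)[N _ HN] := cv; exists N => // j Nj /=.
  have [_ H2 H3] := iter_sharpen_pos j t0 t1.
  rewrite ger0_norm ?subr_ge0// (le_trans H3)//.
  by have := HN j Nj; rewrite sub0r normrN; apply: le_trans; exact: ler_norm.
rewrite ler_norml => /andP[sl sr]; case: (ltgtP s 0) => [sneg|spos|->].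
- rewrite ltr0_sg// -[s]opprK; under eq_fun do rewrite iter_sharpenN.
  by apply: cvgN; apply: pos; lra.
- by rewrite gtr0_sg//; exact: pos.
- rewrite sgr0 (_ : (fun j => _) = fun=> 0); first exact: cvg_cst.
  apply/funext => j; elim: j => //= j ->; by rewrite /sharpen; field.
Qed.

Lemma rapproximable_sg u : rapproximable u -> (forall x, `|u x| <= 1) ->
  rapproximable (fun x => Num.sg (u x)).
Proof.
move=> Ku u1; apply: (@rapproximable_lim (fun j x => iter j sharpen (u x)) _ 1).
- elim=> [|j IH] //=.
  have -> : (fun x => sharpen (iter j sharpen (u x))) = (fun x => (3 / 2) * iter j sharpen (u x) -
      2^-1 * (iter j sharpen (u x) * (iter j sharpen (u x) * iter j sharpen (u x)))).
    by apply/funext => x; rewrite /sharpen; field.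
  apply: rapproximableB; apply: rapproximableM => //; try exact: rapproximable_cst.
  by apply: rapproximableM => //; exact: rapproximableM.
- move=> j x; have := u1 x; rewrite ler_norml => /andP[sl sr].
  case: (ltgtP (u x) 0) => [sneg|spos|->].
  + have np : 0 < - u x by lra.
    have nq : - u x <= 1 by lra.
    have [H1 H2 _] := iter_sharpen_pos j np nq.
    by rewrite -[u x]opprK iter_sharpenN normrN ger0_norm//; lra.
  + by have [H1 H2 _] := iter_sharpen_pos j spos sr; rewrite ger0_norm//; lra.
  + rewrite (_ : iter j sharpen 0 = 0) ?normr0//.
    by elim: j => //= j ->; rewrite /sharpen; field.
- by move=> x; exact: cvg_sharpen.
Qed.

(** [sin ((x i 0 - a) / (j + 1))] has the sign of [x i 0 - a] as soon as [j] is large, and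
    indicators are quadratic polynomials in the sign. *)
Lemma rapproximable_gt i (a : R) : rapproximable (fun x => (a < x i 0)%R%:R).
Proof.
pose s j (x : 'cV[R]_n) := Num.sg (sin (dotv x (j.+1%:R^-1 *: delta_mx i 0) - a / j.+1%:R)).
have Ks j : rapproximable (s j).
  apply: rapproximable_sg; first exact: rapproximable_sin.
  by move=> x; rewrite ler_norml sin_geN1 sin_le1.
apply: (@rapproximable_lim (fun j x => 2^-1 * (s j x + s j x * s j x)) _ 1).
- move=> j; apply: rapproximableM; first exact: rapproximable_cst.
  by apply: rapproximableD => //; exact: rapproximableM.
- move=> j x; rewrite /s; case: sgrP => _.
  + by rewrite mulr0 addr0 mulr0 normr0.
  + by rewrite mulr1 ger0_norm; lra.
  + by rewrite mulrNN mulr1 addNr mulr0 normr0.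
move=> x; have sE j : s j x = Num.sg (sin ((x i 0 - a) / j.+1%:R)).
  by rewrite /s dotvZr dotv_delta; congr (Num.sg (sin _)); rewrite mulrBl mulrC.
pose N := Num.bound (`|x i 0 - a| / pi).
have small j : (N <= j)%N -> `|x i 0 - a| / j.+1%:R < pi.
  move=> Nj; rewrite ltr_pdivrMr// mulrC -ltr_pdivrMr ?pi_gt0//.
  apply: (@lt_trans _ _ N%:R); first by apply: archi_boundP; rewrite divr_ge0// pi_ge0.
  by rewrite ltr_nat ltnS.
apply/cvgrPdist_lt => e e0; exists N => // j Nj /=.
rewrite (_ : _ - _ = 0) ?normr0//; apply/eqP; rewrite subr_eq0; apply/eqP.
have := small j Nj; rewrite sE -[(a < x i 0)%R]subr_gt0; move: (x i 0 - a) => t.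
have j0 : 0 < (j.+1%:R : R)^-1 by rewrite invr_gt0.
case: (ltgtP t 0) => [tneg|tpos|->] tpi.
- have -> : Num.sg (sin (t / j.+1%:R)) = -1.
    rewrite -[t]opprK mulNr sinN sgrN gtr0_sg//; apply: sin_gt0_pi.
    by rewrite mulr_gt0 ?oppr_gt0//= -(ltr0_norm tneg).
  by rewrite mulrNN mulr1 addNr mulr0.
- have -> : Num.sg (sin (t / j.+1%:R)) = 1.
    by rewrite gtr0_sg//; apply: sin_gt0_pi; rewrite mulr_gt0//= -(gtr0_norm tpos).
  by rewrite mulr1 -[1 + 1]/2 mulVf.
- by rewrite mul0r sin0 sgr0 mulr0 addr0 mulr0.
Qed.

(** The sets whose indicator is approximable form a sigma-algebra, and it contains the
    half-spaces that generate the Borel sets. *)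
Lemma rapproximable_set (A : set 'cV[R]_n) : measurable A ->
  rapproximable (fun x => \1_A x).
Proof.
pose G := [set B : set 'cV[R]_n | rapproximable (fun x => \1_B x)].
have G0 : G set0.
  rewrite /G /=; under eq_fun do rewrite indic0; exact: rapproximable_cst.
have GC B : G B -> G (~` B).
  rewrite /G /= => GB; rewrite (_ : (fun x => _) = fun x => 1 - \1_B x).
    by apply: rapproximableB => //; exact: rapproximable_cst.
  apply/funext => x; rewrite !indicE in_setC; case: (x \in B) => /=; ring.
have GU (F : nat -> set 'cV[R]_n) : (forall j, G (F j)) -> G (\bigcup_j F j).
  move=> GF; apply: (@rapproximable_lim (fun m x => 1 - \prod_(j < m) (1 - \1_(F j) x)) _ 1).
  - move=> m; apply: rapproximableB; first exact: rapproximable_cst.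
    elim: m => [|m IH]; first by under eq_fun do rewrite big_ord0; exact: rapproximable_cst.
    under eq_fun do rewrite big_ord_recr /=; apply: rapproximableM => //.
    by apply: rapproximableB; [exact: rapproximable_cst|exact: GF].
  - move=> m x.
    have : 0 <= (\prod_(j < m) (1 - \1_(F j) x) : R) <= 1.
      elim/big_ind: _ => [|a b /andP[a0 a1] /andP[b0 b1]|j _]; first by rewrite ler01 lexx.
        by rewrite mulr_ge0//= mulr_ile1.
      by rewrite indicE; case: (_ \in _); rewrite ?subrr ?subr0 ?lexx ?ler01.
    by move=> /andP[p0 p1]; rewrite ger0_norm; lra.
  move=> x; apply/cvgrPdist_lt => e e0.
  have [[j _ Fj]|nF] := pselect ((\bigcup_j F j) x).
    exists j.+1 => // m jm /=; rewrite indicE mem_set; last by exists j.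
    rewrite (bigD1 (Ordinal jm))//= indicE mem_set// subrr mul0r subr0 subrr normr0//.
  exists 0%N => // m _ /=; rewrite indicE memNset// big1 ?subrr ?normr0//.
  by move=> j _; rewrite indicE memNset ?subr0// => Fj; apply: nF; exists j.
move=> mA; suff : @measurable _ 'cV[R]_n `<=` G by apply.
apply: smallest_sub; first by split=> // B GB; rewrite setTD; exact: GC.
rewrite -bigcup_seq => _ [i _ [B mB <-]]; rewrite setTI.
suff : <<s @RGenOInfty.G R >> `<=` [set B | G ((fun x : 'cV[R]_n => x i 0) @^-1` B)].
  by apply; move: mB; rewrite RGenOInfty.measurableE.
apply: smallest_sub; first split.
- by rewrite /= preimage_set0.
- by move=> C /= GC'; rewrite setTD preimage_setC; exact: GC.
- by move=> F /= GF; rewrite preimage_bigcup; exact: GU.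
move=> _ [a ->] /=; rewrite /G /=.
rewrite (_ : (fun x => _) = fun x : 'cV[R]_n => (a < x i 0)%R%:R); first exact: rapproximable_gt.
apply/funext => x; rewrite indicE; congr (_%:R); congr nat_of_bool.
by apply/idP/idP => [|H]; rewrite ?inE /= ?in_itv /= ?andbT// => /set_mem; rewrite /= in_itv /= andbT.
Qed.

(** Binary digits of the values of [u] are indicators of measurable sets. *)
Lemma dyadic_approximable (m : nat) (b : R) (u : 'cV[R]_n -> R) : measurable_fun setT u -> 0 <= b ->
  (forall x, 0 <= u x <= b) ->
  exists2 v, rapproximable v & forall x, `|u x - v x| <= b / 2 ^+ m.
Proof.
elim: m b u => [|m IH] b u mu0 b0 ub.
  exists (fun=> 0); first exact: rapproximable_cst.
  by move=> x; have /andP[u0 u1] := ub x; rewrite subr0 ger0_norm// expr0 divr1.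
pose H := [set x | b / 2 <= u x].
have mH : measurable H.
  have := mu0 measurableT `[b / 2, +oo[%classic (measurable_itv _); rewrite setTI.
  by congr measurable; apply/seteqP; split=> x /=; rewrite in_itv /= andbT.
have [||x|v Kv Hv] := IH (b / 2) (fun x => u x - b / 2 * \1_H x).
- apply: measurable_funB => //; apply: measurable_funM; first exact: measurable_cst.
  exact: measurable_indic.
- by rewrite divr_ge0.
- have /andP[u0 u1] := ub x; rewrite indicE.
  have [Hx|Hx] := leP (b / 2) (u x).
    by rewrite mem_set//= mulr1; apply/andP; split; lra.
  rewrite memNset /= ?mulr0 ?subr0; first by apply/andP; split; lra.
    by rewrite /H /=; apply/negP; rewrite -ltNge.
exists (fun x => b / 2 * \1_H x + v x).
  apply: rapproximableD => //; apply: rapproximableM; first exact: rapproximable_cst.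
  exact: rapproximable_set.
by move=> x; rewrite opprD addrA exprS invfM mulrA; exact: Hv.
Qed.

Lemma rapproximable_bounded (u : 'cV[R]_n -> R) (B : R) : measurable_fun setT u ->
  (forall x, `|u x| <= B) -> rapproximable u.
Proof.
move=> mu0 uB; have B0 : 0 <= B := le_trans (normr_ge0 _) (uB 0).
have mu1 : measurable_fun setT (fun x => u x + B) by exact: measurable_funD.
have ub x : 0 <= u x + B <= B + B.
  by have := uB x; rewrite ler_norml => /andP[u0 u1]; apply/andP; split; lra.
have H m := dyadic_approximable m mu1 (addr_ge0 B0 B0) ub.
pose v m := sval (cid2 (H m)).
have Kv m : rapproximable (v m) by rewrite /v; case: cid2.
have Hv m x : `|u x + B - v m x| <= (B + B) / 2 ^+ m by rewrite /v; case: cid2.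
rewrite (_ : u = fun x => (u x + B) - B); last by apply/funext => x; rewrite addrK.
apply: rapproximableB; last exact: rapproximable_cst.
apply: (@rapproximable_lim v _ (4 * B)) => // [m x|x].
  have m1 : (B + B) / 2 ^+ m <= B + B.
    by rewrite ler_pdivrMr ?exprn_gt0// ler_peMr ?addr_ge0// exprn_ege1// ler1n.
  rewrite -[v m x](subKr (u x + B)) (le_trans (ler_normB _ _))//.
  have /andP[u0 u1] := ub x; rewrite (ger0_norm u0).
  by have := Hv m x; lra.
apply/cvgrPdist_le => e e0.
have cv : (B + B) * 2^-1 ^+ m @[m --> \oo] --> (0 : R).
  rewrite -[X in _ --> X](mulr0 (B + B)); apply: cvgMr; apply: cvg_expr.
  by rewrite ger0_norm; lra.
have /cvgrPdist_le/(_ e e0)[N _ HN] := cv; exists N => // m Nm /=.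
rewrite (le_trans (Hv m x))//; have := HN m Nm; rewrite sub0r normrN exprVn.
by apply: le_trans; exact: ler_norm.
Qed.

Lemma approximable_bounded k : cbounded k -> approximable k.
Proof.
move=> [[mk1 mk2] [B HB]].
have K1 : rapproximable (fun x => complex.Re (k x)).
  by apply: (@rapproximable_bounded _ B) => // x; exact: le_trans (Re_le_cabs _) (HB x).
have K2 : rapproximable (fun x => complex.Im (k x)).
  by apply: (@rapproximable_bounded _ B) => // x; exact: le_trans (Im_le_cabs _) (HB x).
rewrite (_ : k = fun x => (complex.Re (k x))%:C%C + 'i%C * (complex.Im (k x))%:C%C).
  by apply: approximableD => //; apply: approximableM => //; exact: approximable_cst.
by apply/funext => x; apply: complexP => /=; ring.
Qed.

End WeightedApproximation.

(** * Injectivity of the Fourier transform *)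

Section FourierInjectivity.
Variables (R : realType) (n : nat).
Local Notation mu := (@lebesgueRn R n).

Lemma rint_eq0_ae (u : 'cV[R]_n -> R) : rintegrable mu u -> (forall x, 0 <= u x) ->
  (\int[mu]_x u x)%R = 0 -> {ae mu, forall x, u x = 0}.
Proof.
move=> ui u0 E; have mu0 := rintegrable_meas ui.
have : (\int[mu]_x `|(u x)%:E| = 0)%E.
  under eq_integral do rewrite gee0_abs ?lee_fin ?u0//.
  by rewrite rint_EFin// E.
move/ae_eq_integral_abs => /(_ measurableT).
have mE : measurable_fun setT (EFin \o u) by exact/measurable_EFinP.
move=> /(_ mE); apply: filterS => x /(_ I) /=; by case.
Qed.

Lemma le_add_sqr_div (u v : R) : 0 < u -> v <= u + u^-1 * v ^+ 2.
Proof.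
move=> u0; rewrite -(ler_pM2l u0) (_ : u * (u + u^-1 * v ^+ 2) = u ^+ 2 + v ^+ 2).
  by have := sqr_ge0 (u - v); nra.
by field; rewrite gt_eqF.
Qed.

Lemma le0_of_le_pos (a : R) : (forall d : R, 0 < d -> a <= d) -> a <= 0.
Proof. by move=> H; rewrite leNgt; apply/negP => a0; have := H (a / 2); lra. Qed.

(** Against a trigonometric polynomial [g] integrates to zero by hypothesis, and [k] is a limit
    of such polynomials in mean square with weight [|g|]. *)
Lemma fourier_null_pairing (g k : 'cV[R]_n -> R[i]) : cintegrable mu g ->
  (forall y, cint mu (fun x => g x * expNi (dotv x y)) = 0) -> cbounded k ->
  cint mu (fun x => g x * k x) = 0.
Proof.
move=> gi g0 bk; have ig := cintegrable_cabs gi; have mg := cintegrable_meas gi.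
have w0 x : 0 <= cabs (g x) := cabs_ge0 _.
have [_ Kk] := approximable_bounded w0 ig bk.
have itrig s : cintegrable mu (fun x => g x * trigpoly s x).
  have [B B0 HB] := trigpoly_bounded s.
  apply: (cintegrable_le (h := fun x => B * cabs (g x))).
  - by apply: cmeasM => //; exact: cmeas_trigpoly.
  - exact: rintegrableZ.
  - by move=> x; rewrite cabsM mulrC ler_wpM2r ?cabs_ge0.
have trig0 s : cint mu (fun x => g x * trigpoly s x) = 0.
  have iexp y : cintegrable mu (fun x => g x * expNi (dotv x y)).
    apply: (cintegrable_le _ ig) => [|x]; last by rewrite cabsM cabs_expNi mulr1.
    by apply: cmeasM => //; apply: cmeas_expNi; exact: measurable_dotv.
  rewrite (eq_cint _ (g := fun x => \sum_(p <- s) p.1 * (g x * expNi (dotv x p.2)))); last first.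
    by move=> x; rewrite mulr_sumr; apply: eq_bigr => p _; rewrite mulrCA.
  rewrite cint_sum; last by move=> p _; exact: cintegrableZ.
  by rewrite big1// => p _; rewrite cintZ// g0 mulr0.
have [mk [B HB]] := bk.
have igk : cintegrable mu (fun x => g x * k x).
  apply: (cintegrable_le (h := fun x => B * cabs (g x))).
  - exact: cmeasM.
  - exact: rintegrableZ.
  - by move=> x; rewrite cabsM mulrC ler_wpM2r ?cabs_ge0.
apply/eqP; rewrite -cabs_eq0 eq_le cabs_ge0 andbT.
apply: le0_of_le_pos => d d0.
pose G := (\int[mu]_x cabs (g x))%R; have G0 : 0 <= G by exact: rint_ge0.
pose e := d / (2 * (G + 1)); have e0 : 0 < e by rewrite divr_gt0// mulr_gt0// ltr_wpDl.
have [s Hs] := Kk (d / 2 * e) (mulr_gt0 (divr_gt0 d0 (ltr0Sn R 1)) e0).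
have bs := cboundedB bk (cbounded_trigpoly s).
have iw2 := rintegrable_wnorm2 w0 ig bs.
rewrite -[cint _ _]subr0 -(trig0 s) -cintB//.
apply: (@le_trans _ _ (\int[mu]_x (e * cabs (g x) + e^-1 *
    (cabs (g x) * cabs (k x - trigpoly s x) ^+ 2)))%R).
  apply: cabs_cint_le.
  - exact: cintegrable_meas (cintegrableB igk (itrig s)).
  - by apply: rintegrableD; exact: rintegrableZ.
  move=> x; rewrite -mulrBr cabsM; move: (cabs (g x)) (w0 x) => a a0.
  move: (cabs (k x - trigpoly s x)) => b.
  rewrite (_ : _ + _ = a * (e + e^-1 * b ^+ 2)); last by ring.
  by rewrite ler_wpM2l// le_add_sqr_div.
rewrite rintD ?rintZ//; [|exact: rintegrableZ|exact: rintegrableZ].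
rewrite -/G -[d in _ <= d](mulfVK (lt0r_neq0 (ltr0Sn R 1))) -/(wnorm2 _ _).
have H1 : e * G <= d / 2.
  rewrite /e mulrAC ler_pdivrMr ?mulr_gt0 ?ltr_wpDl//.
  by rewrite (_ : d / 2 * _ = d * (G + 1)) ?ler_pM2l ?lerDl//; field.
have H2 : e^-1 * wnorm2 (fun x => cabs (g x)) (fun x => k x - trigpoly s x) <= d / 2.
  by rewrite mulrC ler_pdivrMr// ltW.
lra.
Qed.

(** Pairing with the bounded multiplier [conj g * exp (- |g|)] leaves the integral of a
    nonnegative function that vanishes only where [g] does. *)
Lemma fourier_injective (g : 'cV[R]_n -> R[i]) : cintegrable mu g ->
  (forall y, cint mu (fun x => g x * expNi (dotv x y)) = 0) -> {ae mu, forall x, g x = 0}.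
Proof.
move=> gi g0; have mg := cintegrable_meas gi.
pose k x := (g x)^*%C * (expR (- cabs (g x)))%:C%C.
have te (t : R) : 0 <= t -> t * expR (- t) <= 1.
  move=> t0; rewrite expRN ler_pdivrMr ?expR_gt0// mul1r.
  by rewrite (le_trans _ (expR_ge1Dx t))// lerDr.
have cabsJ (z : R[i]) : cabs z^*%C = cabs z.
  by case: z => a b; rewrite /cabs /= sqrrN.
have mk : cmeas k.
  apply: cmeasM.
    case: mg => m1 m2; split; first by move: m1; congr measurable_fun; apply/funext => x; case: (g x).
    rewrite (_ : (fun x => _) = fun x => - complex.Im (g x)); last by apply/funext => x; case: (g x).
    exact: measurableT_comp.
  apply: cmeas_real; apply: measurable_expR_comp; apply: measurableT_comp => //.
  exact: cmeas_cabs.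
have bk : cbounded k.
  split=> //; exists 1 => x; rewrite cabsM cabsJ cabs_real ger0_norm ?expR_ge0//.
  by rewrite te ?cabs_ge0.
have gk x : g x * k x = (cabs (g x) * (cabs (g x) * expR (- cabs (g x))))%:C%C.
  rewrite /k mulrA mulrA -expr2 rmorphM; congr (_ * _).
  by rewrite sqr_cabs; case: (g x) => a b; apply: complexP => /=; ring.
have := fourier_null_pairing gi g0 bk.
rewrite (_ : (fun x => g x * k x) = fun x => (cabs (g x) * (cabs (g x) * expR (- cabs (g x))))%:C%C);
  last exact/funext.
rewrite cint_real => /(congr1 (@complex.Re R)) /= H.
have iu : rintegrable mu (fun x => cabs (g x) * (cabs (g x) * expR (- cabs (g x)))).
  apply: (rintegrable_le _ (cintegrable_cabs gi)) => [|x].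
    apply: measurable_funM; first exact: cmeas_cabs.
    apply: measurable_funM; first exact: cmeas_cabs.
    apply: measurable_expR_comp; apply: measurableT_comp => //; exact: cmeas_cabs.
  rewrite ger0_norm ?mulr_ge0 ?cabs_ge0 ?expR_ge0//.
  by rewrite -[leRHS]mulr1 ler_wpM2l ?cabs_ge0// te ?cabs_ge0.
have := rint_eq0_ae iu _ H; move=> /(_ (fun x => mulr_ge0 (cabs_ge0 _) (mulr_ge0 (cabs_ge0 _) (expR_ge0 _)))).
apply: filterS => x /eqP; rewrite !mulf_eq0 [expR _ == 0]gt_eqF ?expR_gt0// orbF orbb.
by rewrite cabs_eq0 => /eqP.
Qed.

End FourierInjectivity.

(** * Square-integrable functions *)

Section SquareIntegrable.
Variables (R : realType) (n : nat).
Local Notation mu := (@lebesgueRn R n).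
Implicit Types f g : 'cV[R]_n -> R[i].

Lemma L2normE f :
  L2norm f = ((\int[mu]_x (cabs (f x) ^+ 2)%:E) `^ 2^-1)%E.
Proof.
rewrite /L2norm unlock; congr (_ `^ _)%E; apply: eq_integral => x _ /=.
by rewrite ger0_norm ?cabs_ge0// powR_mulrn ?cabs_ge0.
Qed.

Lemma L2norm_rint f : rintegrable mu (fun x => cabs (f x) ^+ 2) ->
  L2norm f = (Num.sqrt (\int[mu]_x (cabs (f x) ^+ 2))%R)%:E.
Proof.
move=> fi; rewrite L2normE rint_EFin// poweR_EFin powR12_sqrt//.
by apply: rint_ge0 => x; exact: sqr_ge0.
Qed.

Lemma L2norm_fin f : cmeas f -> (L2norm f < +oo)%E -> rintegrable mu (fun x => cabs (f x) ^+ 2).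
Proof.
move=> mf; rewrite L2normE => H; apply: rintegrable_ge0.
- by apply: measurable_funX; exact: cmeas_cabs.
- by move=> x; exact: sqr_ge0.
move: H; set I := (\int[_]_x _)%E; have I0 : (0 <= I)%E.
  by apply: integral_ge0 => x _; rewrite lee_fin sqr_ge0.
rewrite poweR12_sqrt//; clearbody I; case: I I0 => [r||] //= _ _; exact: ltry.
Qed.

Lemma inL2_cmeas f : inL2 f -> cmeas f.
Proof. by case. Qed.

Lemma inL2P f : inL2 f <-> cmeas f /\ rintegrable mu (fun x => cabs (f x) ^+ 2).
Proof.
split=> [[m1 m2 fin]|[[m1 m2] fi]]; first by split=> //; exact: L2norm_fin.
by split=> //; rewrite L2norm_rint// ltry.
Qed.

Lemma L2norm_lt f (e : R) : 0 < e -> rintegrable mu (fun x => cabs (f x) ^+ 2) ->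
  (L2norm f < e%:E)%E = ((\int[mu]_x (cabs (f x) ^+ 2))%R < e ^+ 2).
Proof.
move=> e0 fi; rewrite L2norm_rint// lte_fin.
have i0 : 0 <= (\int[mu]_x (cabs (f x) ^+ 2))%R by apply: rint_ge0 => x; exact: sqr_ge0.
by rewrite -[in LHS](gtr0_norm e0) -sqrtr_sqr ltr_sqrt// exprn_gt0.
Qed.

Lemma cint_ae f g : cmeas f -> cmeas g -> {ae mu, forall x, f x = g x} ->
  cint mu f = cint mu g.
Proof.
move=> [f1 f2] [g1 g2] fg; congr Complex; congr fine; apply: ae_eq_integral => //.
- exact/measurable_EFinP.
- exact/measurable_EFinP.
- by apply: filterS fg => x /= ->.
- exact/measurable_EFinP.
- exact/measurable_EFinP.
- by apply: filterS fg => x /= ->.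
Qed.

(** A function bounded almost everywhere by [h] is cut to zero where the bound fails. *)
Lemma truncate_ae f (h : 'cV[R]_n -> R) : cmeas f -> measurable_fun setT h ->
  (forall x, 0 <= h x) -> {ae mu, forall x, cabs (f x) <= h x} ->
  exists g, [/\ cmeas g, forall x, cabs (g x) <= h x & {ae mu, forall x, f x = g x}].
Proof.
move=> mf mh h0 fh; pose S := [set x | cabs (f x) <= h x].
have mS : measurable S.
  have md : measurable_fun setT (fun x => h x - cabs (f x)).
    by apply: measurable_funB => //; exact: cmeas_cabs.
  have := md measurableT `[0, +oo[%classic (measurable_itv _); rewrite setTI.
  by congr measurable; apply/seteqP; split=> x /=; rewrite /S /= in_itv /= andbT subr_ge0.
exists (fun x => f x * (\1_S x)%:C%C); split.
- by apply: cmeasM => //; apply: cmeas_real; exact: measurable_indic.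
- move=> x; rewrite cabsM cabs_real indicE; have [xS|xS] := boolP (x \in S).
    by rewrite normr1 mulr1; move/set_mem: xS.
  by rewrite normr0 mulr0.
- by apply: filterS fh => x fx; rewrite indicE mem_set//= mulr1.
Qed.

(** Nonempty open sets have positive measure. *)
Lemma ae_le_everywhere (u : 'cV[R]_n -> R) : continuous u ->
  {ae mu, forall x, u x <= 0} -> forall x, u x <= 0.
Proof.
move=> cu [N [mN N0 HN]] x; rewrite leNgt; apply/negP => ux.
have /cvgrPdist_lt/(_ _ ux) := cu x.
move=> /nbhs_ballP[r /= r0 Hr].
have : (mu (openbox x r) <= mu N)%E.
  apply: le_measure; rewrite ?inE//; first exact: measurable_openbox.
  move=> y Hy; apply: HN => /= uy.
  have /Hr /= : ball x r y.
    split=> // i j; rewrite ord1; have := Hy i; rewrite /= in_itv /= => /andP[y1 y2].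
    by rewrite /ball /= ltr_distlC; apply/andP; split; lra.
  by rewrite ltNge => /negP; apply; rewrite ger0_norm; lra.
by rewrite N0 leNgt openbox_gt0.
Qed.

Lemma continuous_sumr m (F : 'I_m -> 'cV[R]_n -> R) : (forall i, continuous (F i)) ->
  continuous (fun x => \sum_(i < m) F i x).
Proof.
elim: m F => [|m IH] F cF.
  rewrite (_ : (fun x => _) = fun=> 0); last by apply/funext => y; rewrite big_ord0.
  exact: cst_continuous.
rewrite (_ : (fun x => _) =
    fun x => \sum_(i < m) F (widen_ord (leqnSn m) i) x + F ord_max x); last first.
  by apply/funext => y; rewrite big_ord_recr.
by move=> x; exact: cvgD (IH _ (fun i => cF (widen_ord (leqnSn m) i)) x) (cF ord_max x).
Qed.

Lemma continuous_quad (B : 'M[R]_n) : continuous (fun x : 'cV[R]_n => dotv (B *m x) x).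
Proof.
apply: continuous_sumr => i.
have c1 : continuous (fun x : 'cV[R]_n => (B *m x) i 0).
  rewrite (_ : (fun x => _) = fun x : 'cV[R]_n => \sum_j B i j * x j 0); last first.
    by apply/funext => y; rewrite mxE.
  apply: continuous_sumr => j x; have cx := @coord_continuous R n 1 j 0 x.
  exact: cvgM (cvg_cst (B i j)) cx.
by move=> x; exact: cvgM (c1 x) (@coord_continuous R n 1 i 0 x).
Qed.

End SquareIntegrable.

(** * Pointwise decay of Fourier transforms *)

Section FourierDecay.
Variables (R : realType) (n : nat).
Local Notation mu := (@lebesgueRn R n).

Definition ft (f : 'cV[R]_n -> R[i]) xi := cint mu (fun x => f x * expNi (dotv x xi)).

Definition ft_cst : R := (2 * pi) `^ (- (n%:R / 2)).

Lemma ft_cst_gt0 : 0 < ft_cst.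
Proof. by rewrite powR_gt0// mulr_gt0// pi_gt0. Qed.

Lemma cabs_fourier f xi : cabs (fourier f xi) = ft_cst * cabs (ft f xi).
Proof. by rewrite /fourier cabsM cabs_real ger0_norm// ltW// ft_cst_gt0. Qed.

Lemma cabs_expNi_sub1 (t : R) : cabs (expNi t - 1) <= (expR 1 + 2) * `|t|.
Proof.
have E : expNi t = expi (- t) by rewrite /expi cosN sinN.
have [t1|t1] := leP `|t| 1.
  rewrite cabs_distC E (le_trans (cabs_1Bexpi _)) ?normrN//.
  by rewrite ler_wpM2r// lerDl.
rewrite (le_trans (cabsB _ _))// cabs_expNi cabs1 mulrDl.
have := ltW t1; have := mulr_ge0 (expR_ge0 (1 : R)) (normr_ge0 t); lra.
Qed.

Variables (A : 'M[R]_n) (c C : R) (f : 'cV[R]_n -> R[i]).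
Hypotheses (pA : posdefmx A) (c0 : 0 < c) (C0 : 0 <= C) (mf : cmeas f).
Hypothesis fA : forall x, cabs (f x) <= C * expR (- c * dotv (A *m x) x).

Lemma gauss_half x : expR (- 2^-1 * dotv ((2 * c) *: A *m x) x) = expR (- c * dotv (A *m x) x).
Proof. by rewrite -scalemxAl dotvZl; congr expR; field. Qed.

Lemma posdef_half : posdefmx ((2 * c) *: A).
Proof. by apply: posdefZ => //; rewrite mulr_gt0. Qed.

Lemma cintegrable_decay xi : cintegrable mu (fun x => f x * expNi (dotv x xi)).
Proof.
apply: (cintegrable_le (h := fun x => C * expR (- c * dotv (A *m x) x))).
- by apply: cmeasM => //; apply: cmeas_expNi; exact: measurable_dotv.
- by apply: rintegrableZ; exact: rintegrable_gauss.
- by move=> x; rewrite cabsM cabs_expNi mulr1.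
Qed.

Lemma ft_lipschitz : exists2 L : R, 0 <= L & forall (xi h : 'cV[R]_n) (r : R), 0 <= r ->
  (forall i, `|h i 0| <= r) -> cabs (ft f (xi + h) - ft f xi) <= L * r.
Proof.
pose E x := expR (- c * dotv (A *m x) x).
pose G (x : 'cV[R]_n) := \sum_(i < n) E x * `|x i 0|.
have mE : measurable_fun setT E := measurable_gauss c A.
have iG : rintegrable mu G.
  apply: rintegrable_sum => i _.
  have := @rintegrable_gauss_exp R n _ (delta_mx i 0) posdef_half 1 ler01.
  under eq_fun do rewrite gauss_half dotv_delta.
  move=> iEx; apply: rintegrable_le iEx _ => [|x].
    by apply: measurable_funM => //; apply: measurableT_comp => //; exact: measurable_coord.
  rewrite ger0_norm ?mulr_ge0 ?expR_ge0// ler_wpM2l ?expR_ge0// mul1r.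
  by rewrite (le_trans _ (expR_ge1Dx _))// lerDr.
have G0 x : 0 <= G x by apply: sumr_ge0 => i _; rewrite mulr_ge0 ?expR_ge0.
exists (C * (expR 1 + 2) * (\int[mu]_x G x)%R).
  by rewrite !mulr_ge0 ?addr_ge0 ?expR_ge0// rint_ge0.
move=> xi h r r0 hr; rewrite /ft -cintB; [|exact: cintegrable_decay|exact: cintegrable_decay].
rewrite (_ : _ * r = (\int[mu]_x ((C * (expR 1 + 2) * r) * G x))%R); last first.
  by rewrite rintZ//; ring.
apply: cabs_cint_le.
- exact: (cintegrable_meas (cintegrableB (cintegrable_decay _) (cintegrable_decay _))).
- exact: rintegrableZ.
move=> x; rewrite dotvDr expNiD.
rewrite (_ : _ - _ = f x * (expNi (dotv x xi) * (expNi (dotv x h) - 1))); last by ring.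
rewrite !cabsM cabs_expNi mul1r.
have xh : `|dotv x h| <= r * \sum_(i < n) `|x i 0|.
  rewrite (le_trans (ler_norm_sum _ _ _))// mulr_sumr; apply: ler_sum => i _.
  by rewrite normrM mulrC ler_wpM2r.
rewrite (_ : _ * G x = (C * E x) * ((expR 1 + 2) * (r * \sum_(i < n) `|x i 0|))); last first.
  by rewrite /G -mulr_sumr; ring.
rewrite ler_pM ?cabs_ge0// ?fA// (le_trans (cabs_expNi_sub1 _))// ler_wpM2l//.
Qed.

Lemma continuous_cabs_ft : continuous (fun xi => cabs (ft f xi)).
Proof.
have [L L0 HL] := ft_lipschitz => xi.
have FF : Filter (nbhs (xi : 'cV[R]_n)) by exact: nbhs_filter.
apply/cvgrPdist_lt => e e0.
have L1 : 0 < L + 1 by rewrite ltr_wpDl.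
have r0 : 0 < e / (L + 1) by rewrite divr_gt0.
apply: filterS (nbhsx_ballx (xi : 'cV[R]_n) _ r0) => y [_ By] /=.
have H : cabs (ft f y - ft f xi) <= L * (e / (L + 1)).
  have -> : y = xi + (y - xi) by rewrite addrC subrK.
  apply: HL => [|i]; first by rewrite divr_ge0 ?ltW.
  by rewrite !mxE distrC; exact/ltW/By.
have {}H : cabs (ft f y - ft f xi) < e.
  by rewrite (le_lt_trans H)// mulrA ltr_pdivrMr// mulrC ltr_pM2l// ltrDl.
have key (a b d e' : R) : d < e' -> b <= d + a -> a <= d + b -> `|a - b| < e'.
  by move=> *; rewrite ltr_norml; apply/andP; split; lra.
apply: key H _ _.
  by have := cabsD (ft f y - ft f xi) (ft f xi); rewrite subrK.
by have := cabsD (ft f xi - ft f y) (ft f y); rewrite subrK [cabs (ft f xi - _)]cabs_distC.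
Qed.

Lemma ft_decay_everywhere (B : 'M[R]_n) (b D : R) :
  {ae mu, forall xi, cabs (fourier f xi) <= D * expR (- b * dotv (B *m xi) xi)} ->
  forall xi, cabs (ft f xi) <= D / ft_cst * expR (- b * dotv (B *m xi) xi).
Proof.
move=> H; have k0 := ft_cst_gt0.
pose u xi := ft_cst * cabs (ft f xi) - D * expR (- b * dotv (B *m xi) xi).
have cu : continuous u.
  have ce : continuous (fun xi => expR (- b * dotv (B *m xi) xi)).
    move=> xi; apply: continuous_comp; last exact: continuous_expR.
    exact: cvgM (cvg_cst (- b)) (@continuous_quad R n B xi).
  move=> xi; have FF : Filter (nbhs (xi : 'cV[R]_n)) by exact: nbhs_filter.
  have c1 := cvgM (cvg_cst ft_cst) (@continuous_cabs_ft xi).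
  have c2 := cvgM (cvg_cst D) (ce xi).
  first [exact: (cvgB c1 c2)|apply: (@cvgB _ R^o); [exact: c1|exact: c2]|exact: continuousB c1 c2].
have u0 : {ae mu, forall xi, u xi <= 0}.
  by apply: filterS H => xi; rewrite /u cabs_fourier subr_le0.
move=> xi; have := ae_le_everywhere cu u0 xi; rewrite /u subr_le0 mulrC -ler_pdivlMr//.
by rewrite mulrAC.
Qed.

End FourierDecay.

(** * Uniqueness and its threshold *)

Section HardyUniqueness.
Variables (R : realType) (n : nat) (A B : 'M[R]_n).
Local Notation mu := (@lebesgueRn R n).
Hypotheses (pA : posdefmx A) (pB : posdefmx B).

(** The first bound is enforced by truncation; the second then holds everywhere because the
    transform is continuous. *)
Lemma decay_representative (a b : R) f : 0 < a -> inL2 f -> gaussian_decay a A f ->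
  gaussian_decay b B (fourier f) ->
  exists g C D, [/\ cmeas g, {ae mu, forall x, f x = g x}, 0 <= C /\ 0 <= D,
    forall x, cabs (g x) <= C * expR (- a * dotv (A *m x) x) &
    forall xi, cabs (ft g xi) <= D * expR (- b * dotv (B *m xi) xi)].
Proof.
move=> a0 f2 [C C0 fC] [D D0 fD]; have mf := inL2_cmeas f2.
have mh : measurable_fun setT (fun x : 'cV[R]_n => C * expR (- a * dotv (A *m x) x)).
  by apply: measurable_funM; [exact: measurable_cst|exact: measurable_gauss].
have h0 (x : 'cV[R]_n) : 0 <= C * expR (- a * dotv (A *m x) x).
  by rewrite mulr_ge0 ?expR_ge0 ?ltW.
have [g [mg gC fg]] := truncate_ae mf mh h0 fC.
exists g, C, (D / ft_cst R n); split=> //.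
  by split; [exact: ltW|rewrite divr_ge0 ?(ltW D0)// ltW// ft_cst_gt0].
apply: (ft_decay_everywhere pA a0 (ltW C0) mg gC).
apply: filterS fD => xi; rewrite /fourier.
rewrite (_ : cintegral _ = cint mu (fun x => g x * expNi (dotv x xi)))//.
have mE : cmeas (fun x => expNi (dotv x xi)) by apply: cmeas_expNi; exact: measurable_dotv.
by apply: cint_ae; [exact: cmeasM|exact: cmeasM|apply: filterS fg => x /= ->].
Qed.

Lemma quad_line (eta w : 'cV[R]_n) (t : R) :
  2 * t * dotv (B *m eta) w + t ^+ 2 * dotv (B *m w) w <=
  dotv (B *m (eta + t *: w)) (eta + t *: w).
Proof.
have := (posdef_semi pB).2 eta.
rewrite mulmxDr -scalemxAr !(dotvDl, dotvDr, dotvZl, dotvZr) (dotv_sym w eta pB.1); lra.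
Qed.

(** On every line of direction [v] the transform decays faster than the critical Gaussian, so
    [modulated_gauss] vanishes for every [eta]: it is the Fourier transform of [f] times a
    positive Gaussian. *)
Lemma hardy_uniqueness (c : R) (v : 'cV[R]_n) f : 0 < c ->
  dotv (invmx A *m v) v < 4 * c ^+ 2 * dotv (B *m v) v ->
  inL2 f -> gaussian_decay c A f -> gaussian_decay c B (fourier f) -> ae_null f.
Proof.
move=> c0 vAB f2 fA fB.
have [g [C [D [mg fg [C0 D0] gC gD]]]] := decay_representative c0 f2 fA fB.
have v0 : v != 0.
  by apply: contraTneq vAB => ->; rewrite !dotv0r mulr0 ltxx.
set p := dotv (invmx A *m v) v in vAB; have p0 : 0 < p := (posdef_inv pA).2 v v0.
pose t := Num.sqrt (4 * c / p).
have t2 : t ^+ 2 = 4 * c / p by rewrite sqr_sqrtr// divr_ge0 ?mulr_ge0 ?ltW.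
pose w := t *: v.
have wA : dotv (invmx A *m w) w = 4 * c.
  rewrite /w -scalemxAr dotvZl dotvZr -/p mulrA -expr2 t2; field; exact: lt0r_neq0.
set q := dotv (B *m w) w; have cq1 : 1 < c * q.
  rewrite /q /w -scalemxAr dotvZl dotvZr (mulrA t) -expr2 t2.
  rewrite (_ : c * _ = (4 * c ^+ 2 * dotv (B *m v) v) / p); last by field; exact: lt0r_neq0.
  by rewrite ltr_pdivlMr// mul1r.
pose d := (c * q - 1) / 2; have d0 : 0 < d by rewrite /d; lra.
have b1 : 1 < c * q - d by rewrite /d; lra.
have H eta : cint mu (fun x => (g x * cexp (- 2%:C%C * (dotv x w ^+ 2 / 4)%:C%C)) * expNi (dotv x eta)) = 0.
  pose m := dotv (B *m eta) w.
  have Fb s : cabs (slice_transform g w eta s) <=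
      (D * expR (c ^+ 2 * m ^+ 2 / d)) * expR (- (c * q - d) * dotv s s).
    rewrite (le_trans (gD _))// -mulrA -expRD ler_wpM2l// ler_expR.
    have := quad_line eta w (s 0 0); rewrite -/m -/q dotv1E -expr2.
    move: (s 0 0) => r H; have {}H := ler_wpM2l (ltW c0) H.
    have := mulr_ge0 (ltW d0) (sqr_ge0 (r + c * m / d)).
    rewrite (_ : d * _ = d * r ^+ 2 + 2 * c * m * r + c ^+ 2 * m ^+ 2 / d); last first.
      by field; rewrite gt_eqF.
    move: H; nra.
  have E0 : 0 <= D * expR (c ^+ 2 * m ^+ 2 / d) by rewrite mulr_ge0 ?expR_ge0.
  have := modulated_gauss_eq0 pA c0 C0 E0 mg gC wA b1 Fb (ltr_nat R 1 2).
  by move=> <-; apply: eq_cint => x; rewrite mulrAC.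
have ig : cintegrable mu (fun x => g x * cexp (- 2%:C%C * (dotv x w ^+ 2 / 4)%:C%C)).
  apply: (cintegrable_le (h := fun x => C * expR (- c * dotv (A *m x) x))).
  - apply: cmeasM => //; apply: cmeas_cexp; apply: cmeasM; first exact: cmeas_cst.
    apply: cmeas_real; apply: measurable_funM; last exact: measurable_cst.
    by apply: measurable_funX; exact: measurable_dotv.
  - by apply: rintegrableZ; exact: rintegrable_gauss.
  - move=> x; rewrite cabsM cabs_cexp -rmorphN -rmorphM /=.
    rewrite -[leRHS]mulr1 ler_pM ?cabs_ge0 ?expR_ge0 ?gC// -expR0 ler_expR mulNr oppr_le0.
    by rewrite mulr_ge0// divr_ge0// sqr_ge0.
have g0 := fourier_injective ig H.
apply: (@filterS2 _ (almost_everywhere mu) _ _ _ _ _ fg g0) => x -> /eqP.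
by rewrite mulf_eq0 -!cabs_eq0 cabs_cexp [expR _ == 0]gt_eqF ?expR_gt0// orbF cabs_eq0 => /eqP.
Qed.

End HardyUniqueness.

Section GaussianExamples.
Variables (R : realType) (n : nat).
Local Notation mu := (@lebesgueRn R n).

Lemma inL2_gauss_bound (A : 'M[R]_n) (c C : R) f : posdefmx A -> 0 < c -> cmeas f ->
  (forall x, cabs (f x) <= C * expR (- c * dotv (A *m x) x)) -> inL2 f.
Proof.
move=> pA c0 mf fC; apply/inL2P; split=> //.
apply: (rintegrable_le (g := fun x => C ^+ 2 * expR (- (2 * c) * dotv (A *m x) x))).
- by apply: measurable_funX; exact: cmeas_cabs.
- by apply: rintegrableZ; apply: rintegrable_gauss; rewrite ?mulr_gt0.
move=> x; rewrite ger0_norm ?sqr_ge0//.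
have -> : C ^+ 2 * expR (- (2 * c) * dotv (A *m x) x) = (C * expR (- c * dotv (A *m x) x)) ^+ 2.
  by rewrite exprMn [expR _ ^+ 2]expr2 -expRD; congr (_ * expR _); ring.
by rewrite lerXn2r ?nnegrE ?cabs_ge0// (le_trans (cabs_ge0 _) (fC x)).
Qed.

Definition gaussian (P : 'M[R]_n) (x : 'cV[R]_n) : R[i] :=
  (expR (- 2^-1 * dotv (P *m x) x))%:C%C.

Lemma cmeas_gaussian P : cmeas (gaussian P).
Proof. by apply: cmeas_real; exact: measurable_gauss. Qed.

Lemma cabs_gaussian P x : cabs (gaussian P x) = expR (- 2^-1 * dotv (P *m x) x).
Proof. by rewrite cabs_real ger0_norm ?expR_ge0. Qed.

Lemma inL2_gaussian P : posdefmx P -> inL2 (gaussian P).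
Proof.
move=> pP; apply: (@inL2_gauss_bound P 2^-1 1) => //; first exact: cmeas_gaussian.
by move=> x; rewrite cabs_gaussian mul1r.
Qed.

Lemma gaussian_neq0 P : ~ ae_null (gaussian P).
Proof.
move=> [N [mN N0 HN]]; have : (mu setT <= mu N)%E.
  apply: le_measure; rewrite ?inE//; apply: subset_trans HN => x _ /= /eqP.
  by rewrite -cabs_eq0 cabs_gaussian gt_eqF ?expR_gt0.
by rewrite N0 leNgt lebesgueRn_setT.
Qed.

(** The transform is explicit: a Gaussian of matrix [P^-1]. *)
Lemma gaussian_decay_fourier P (B : 'M[R]_n) (b : R) : posdefmx P ->
  (forall xi, b * dotv (B *m xi) xi <= 2^-1 * dotv (invmx P *m xi) xi) ->
  gaussian_decay b B (fourier (gaussian P)).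
Proof.
move=> pP H; have M0 := @gauss_mass_gt0 R n P pP.
set M := (\int[_]_x _)%R in M0.
exists (ft_cst R n * M); first by rewrite mulr_gt0// ft_cst_gt0.
apply: aeW => xi; rewrite cabs_fourier -mulrA ler_wpM2l ?(ltW (ft_cst_gt0 R n))//.
rewrite /ft gauss_fourier// cabs_real ger0_norm ?mulr_ge0 ?expR_ge0 ?(ltW M0)//.
by rewrite ler_wpM2l ?(ltW M0)// ler_expR !mulNr lerN2.
Qed.

End GaussianExamples.

Section SharpThreshold.
Variables (R : realType) (n : nat) (A B : 'M[R]_n).
Hypotheses (n0 : (1 <= n)%N) (pA : posdefmx A) (pB : posdefmx B).

Let ratio (v : 'cV[R]_n) := dotv (B *m v) v / dotv (invmx A *m v) v.
Let S := [set ratio v | v in [set v | v != 0]].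

Let has_sup_ratio : has_sup S.
Proof.
split.
  exists (ratio (delta_mx (Ordinal n0) 0)), (delta_mx (Ordinal n0) 0) => //=.
  by apply/eqP => /colP/(_ (Ordinal n0)); rewrite !mxE !eqxx => /eqP; rewrite oner_eq0.
have [e e0 He] := posdef_lower (posdef_inv pA).
have [c c0 Hc] := semiposdef_upper (posdef_semi pB).
exists (c / e) => _ [v /= v0 <-]; have p0 := (posdef_inv pA).2 v v0.
rewrite /ratio ler_pdivrMr// (le_trans (Hc v))// -mulrA ler_wpM2l//.
by rewrite mulrC ler_pdivlMr// mulrC.
Qed.

(** The threshold comes from the supremum [beta] of [<B v, v> / <A^-1 v, v>]. Uniqueness holds
    for every rate [c] with [4 c^2 beta > 1]; in the case of equality the Gaussian of matrix [2
    c A] satisfies both bounds. *)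
Lemma sharp_threshold : ~ semiposdefmx (invmx B - A) -> exists2 lam0 : R, 0 < lam0 &
  (forall f : 'cV[R]_n -> R[i], inL2 f ->
     (exists lam : R, [/\ lam < lam0, gaussian_decay (2^-1 - lam) A f &
        gaussian_decay (2^-1 - lam) B (fourier f)]) -> ae_null f) /\
  (exists f : 'cV[R]_n -> R[i], [/\ inL2 f, ~ ae_null f, gaussian_decay (2^-1 - lam0) A f &
     gaussian_decay (2^-1 - lam0) B (fourier f)]).
Proof.
move=> nAB; pose beta := sup S.
have beta_ub v : v != 0 -> dotv (B *m v) v <= beta * dotv (invmx A *m v) v.
  move=> v0; rewrite -ler_pdivrMr ?(posdef_inv pA).2//.
  by apply: (sup_upper_bound has_sup_ratio); exists v.
have [x xneg] : exists x, dotv ((invmx B - A) *m x) x < 0.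
  apply: contrapT => H; apply: nAB; split.
    by rewrite linearB /= (posdef_inv pB).1 pA.1.
  by move=> x; rewrite leNgt; apply/negP => xn; apply: H; exists x.
have x0 : x != 0 by apply: contraTneq xneg => ->; rewrite dotv0r ltxx.
(* Cauchy-Schwarz for the pair [A x], [x] *)
have beta1 : 1 < beta.
  move: xneg; rewrite mulmxBl dotvDl dotvNl subr_lt0 => xneg.
  have b0 := (posdef_inv pB).2 x x0; have a0 := pA.2 x x0.
  have w0 : A *m x != 0.
    by apply: contraTneq a0 => ->; rewrite dotv0l ltxx.
  have := beta_ub _ w0; rewrite mulKmx ?posdef_unit// (dotvC x).
  have := posdef_CS (A *m x) x pB; set a := dotv (A *m x) x in a0 xneg *.
  set b := dotv (invmx B *m x) x in b0 xneg *; set q := dotv (B *m (A *m x)) _ => H1 H2.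
  have q0 : a < q.
    rewrite -(ltr_pM2r b0); apply: lt_le_trans H1.
    by rewrite expr2 ltr_pM2l.
  by rewrite -(ltr_pM2r a0) mul1r (lt_le_trans q0).
have beta0 : 0 < beta by rewrite (lt_trans _ beta1).
pose c0 := (2 * Num.sqrt beta)^-1.
have sb1 : 1 < Num.sqrt beta by rewrite -[ltLHS]sqrtr1 ltr_sqrt.
have c0gt : 0 < c0 by rewrite invr_gt0; lra.
have c02 : 4 * c0 ^+ 2 = beta^-1.
  by rewrite /c0 exprVn exprMn sqr_sqrtr ?(ltW beta0)//; field; rewrite gt_eqF.
have c0lt : c0 < 2^-1 by rewrite ltf_pV2 ?posrE//; lra.
exists (2^-1 - c0); first by rewrite subr_gt0.
have -> : 2^-1 - (2^-1 - c0) = c0 by ring.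
split.
  move=> f f2 [lam [laml fA fB]]; set c := 2^-1 - lam in fA fB.
  have cc0 : c0 < c by rewrite /c; lra.
  have cgt : 0 < c by rewrite (lt_trans c0gt).
  have : (4 * c ^+ 2)^-1 < sup S.
    rewrite -/beta -[beta]invrK ltf_pV2 ?posrE ?invr_gt0 ?mulr_gt0 ?exprn_gt0// -c02.
    by rewrite ltr_pM2l// ltr_pXn2r ?nnegrE ?ltW.
  case/(sup_gt has_sup_ratio.1) => _ [v /= v0 <-].
  have p0 := (posdef_inv pA).2 v v0.
  rewrite /ratio ltr_pdivlMr// mulrC ltr_pdivrMr ?mulr_gt0 ?exprn_gt0// mulrC => vAB.
  exact: (hardy_uniqueness pA pB cgt vAB f2 fA fB).
exists (gaussian ((2 * c0) *: A)); split.
- by apply: inL2_gaussian; exact: posdef_half.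
- exact: gaussian_neq0.
- exists 1 => //; apply: aeW => y; rewrite cabs_gaussian mul1r -scalemxAl dotvZl ler_expR.
  by rewrite -subr_ge0 (_ : _ - _ = 0)//; field.
- apply: gaussian_decay_fourier => [|xi]; first exact: posdef_half.
  rewrite invmxZ ?posdef_unit//; last exact: posdef_half.
  rewrite -scalemxAl dotvZl.
  have [->|xi0] := eqVneq xi 0; first by rewrite !dotv0r !mulr0.
  have := beta_ub xi xi0; have -> : beta = (4 * c0 ^+ 2)^-1 by rewrite c02 invrK.
  rewrite mulrC ler_pdivlMr ?mulr_gt0 ?exprn_gt0// => H.
  rewrite -(ler_pM2r (mulr_gt0 (ltr0Sn R 3) c0gt)).
  rewrite [leRHS](_ : _ = dotv (invmx A *m xi) xi); last by field; rewrite gt_eqF.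
  by apply: le_trans H; rewrite -subr_ge0 (_ : _ - _ = 0)//; ring.
Qed.

End SharpThreshold.

(** * Hermite coefficients along an axis *)

Section HermiteOnAxis.
Variables (R : realType) (n : nat) (i : 'I_n).

Definition hermite_step (p : {poly R}) : {poly R} := p^`() - 2%:P * 'X * p.

(** [(-1)^m] times the physicists' Hermite polynomial. *)
Definition hermite_poly m : {poly R} := iter m hermite_step 1.

Lemma deriv_hermite_poly m : (hermite_poly m.+1)^`() = (- (2 * m.+1%:R))%:P * hermite_poly m.
Proof.
elim: m => [|m IH].
  rewrite /hermite_poly /= /hermite_step derivC sub0r mulr1 derivN derivM derivC derivX.
  by rewrite mul0r add0r !mulr1 polyCN.
have E : hermite_poly m.+2 = (hermite_poly m.+1)^`() - 2%:P * 'X * hermite_poly m.+1 by [].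
have E1 : hermite_poly m.+1 = (hermite_poly m)^`() - 2%:P * 'X * hermite_poly m by [].
rewrite E derivB derivM (derivM 2%:P) derivC derivX mul0r add0r mulr1 {1}IH derivM derivC mul0r add0r.
rewrite [X in _ - (_ + 2%:P * 'X * X)]IH.
rewrite -(natr1 m.+1) (_ : - (2 * (m.+1%:R + 1)) = - (2 * m.+1%:R) - 2 :> R); last by ring.
rewrite polyCB mulrBl E1; move: (hermite_poly m)^`() (hermite_poly m) (- (2 * m.+1%:R))%:P => a b k.
by ring.
Qed.

Lemma partial_poly_gauss (p : {poly R}) :
  partial i (fun y : 'cV[R]_n => p.[y i 0] * expR (- dotv y y)) =
  fun y => (hermite_step p).[y i 0] * expR (- dotv y y).
Proof.
apply/funext => x; rewrite /partial.
pose q : {poly R} := - 'X^2 - (dotv x x - x i 0 ^+ 2)%:P.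
pose phi (s : R) := p.[s] * expR q.[s].
have E : is_derive (x i 0) 1 (fun s => expR q.[s]) (expR q.[x i 0] * q^`().[x i 0]).
  by apply: (@is_derive1_comp _ expR (horner q) (x i 0)).
have D := is_deriveM (is_derive_poly p (x i 0)) E.
have quad (h : R) : dotv (h *: delta_mx i 0 + x) (h *: delta_mx i 0 + x) = - q.[h + x i 0].
  rewrite !(dotvDl, dotvDr, dotvZl, dotvZr) dotv_delta (dotvC _ x) !dotv_delta mxE !eqxx mulr1.
  by rewrite /q hornerD hornerN hornerXn hornerN hornerC; ring.
have x0 : dotv x x = - q.[x i 0] by have := quad 0; rewrite scale0r !add0r.
transitivity ('D_1 phi (x i 0)).
  rewrite /derive; apply: (congr1 (fun F => lim (F @ (0 : R)^'))); apply/funext => h /=.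
  rewrite (_ : h%:A = h :> R); last exact: mulr1.
  by rewrite quad x0 !opprK !mxE !eqxx mulr1.
rewrite (@derive_val _ _ _ _ _ _ _ D) x0 opprK !scaleRE.
have q'E : q^`().[x i 0] = - (2 * x i 0).
  by rewrite /q derivB derivN derivXn derivC subr0 hornerN hornerMn hornerX mulr_natl.
rewrite q'E /hermite_step hornerD hornerN !hornerM hornerC hornerX.
by move: (expR _) p^`().[x i 0] p.[x i 0] => a b c; ring.
Qed.

Definition axis_index m : {ffun 'I_n -> nat} := [ffun j => if j == i then m else 0%N].

Lemma mlength_axis m : mlength (axis_index m) = m.
Proof.
rewrite /mlength (bigD1 i)//= ffunE eqxx big1 ?addn0// => j ji.
by rewrite ffunE (negPf ji).
Qed.

Lemma mfactorial_axis m : mfactorial (axis_index m) = m`!.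
Proof.
rewrite /mfactorial (bigD1 i)//= ffunE eqxx big1 ?muln1// => j ji.
by rewrite ffunE (negPf ji).
Qed.

Lemma mpartial_axis m : mpartial (axis_index m) (fun y : 'cV[R]_n => expR (- dotv y y)) =
  fun y => (hermite_poly m).[y i 0] * expR (- dotv y y).
Proof.
have iterE : iter m (partial i) (fun y : 'cV[R]_n => expR (- dotv y y)) =
    fun y => (hermite_poly m).[y i 0] * expR (- dotv y y).
  elim: m => [|m IH] /=; first by apply/funext => y; rewrite hornerC mul1r.
  by rewrite IH partial_poly_gauss.
have aux (g : 'cV[R]_n -> R) s : uniq s ->
    foldr (fun j => iter (axis_index m j) (partial j)) g s =
    if i \in s then iter m (partial i) g else g.
  elim: s => //= j s IH /andP[js us]; rewrite ffunE inE IH// [i == j]eq_sym.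
  by have [ji|//] := eqVneq j i; rewrite /= -ji (negPf js).
by rewrite -iterE /mpartial aux ?enum_uniq// mem_enum.
Qed.

Definition axis_cst (A : 'M[R]_n) m : R := (\det A) `^ 4^-1 * (pi `^ (- (n%:R / 4)) *
  ((2 ^ m * m`!)%N%:R) `^ (- 2^-1)).

(** Along the axis [i] the skewed Hermite functions are one-dimensional. *)
Lemma skewed_hermite_axis (A : 'M[R]_n) m x : semiposdefmx A ->
  skewed_hermite A (axis_index m) x = (-1) ^+ m * axis_cst A m *
  ((hermite_poly m).[dotv x (sqrtmx A *m delta_mx i 0)] * expR (- 2^-1 * dotv (A *m x) x)).
Proof.
move=> /sqrtmxP[[ST _] SS]; rewrite /skewed_hermite /hermite mlength_axis mfactorial_axis mpartial_axis.
have -> : (sqrtmx A *m x) i 0 = dotv x (sqrtmx A *m delta_mx i 0).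
  by rewrite -dotv_delta dotvMl ST.
have <- : dotv (sqrtmx A *m x) (sqrtmx A *m x) = dotv (A *m x) x.
  by rewrite -{3}SS -mulmxA [RHS]dotvMl ST.
set y := sqrtmx A *m x; rewrite (_ : - 2^-1 * dotv y y = 2^-1 * dotv y y - dotv y y); last by field.
by rewrite expRD /axis_cst; ring.
Qed.

End HermiteOnAxis.

Section GaussianHermiteIntegrals.
Variables (R : realType) (n : nat) (P : 'M[R]_n) (w : 'cV[R]_n).
Local Notation mu := (@lebesgueRn R n).
Hypothesis pP : posdefmx P.
Let E (x : 'cV[R]_n) := expR (- 2^-1 * dotv (P *m x) x).
Let M0 := (\int[mu]_x E x)%R.
Let kappa := dotv (invmx P *m w) w.

Definition gauss_poly (p : {poly R}) : R := (\int[mu]_x (E x * p.[dotv x w]))%R.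

Lemma rintegrable_gauss_poly p : rintegrable mu (fun x => E x * p.[dotv x w]).
Proof.
under eq_fun do rewrite horner_coef mulr_sumr; apply: rintegrable_sum => j _.
under eq_fun do rewrite mulrCA; apply: rintegrableZ.
exact: rintegrable_gauss_moment.
Qed.

Lemma gauss_polyD p q : gauss_poly (p + q) = gauss_poly p + gauss_poly q.
Proof.
rewrite /gauss_poly; under eq_Rintegral do rewrite hornerD mulrDr.
by rewrite rintD//; exact: rintegrable_gauss_poly.
Qed.

Lemma gauss_polyZ (c : R) p : gauss_poly (c%:P * p) = c * gauss_poly p.
Proof.
rewrite /gauss_poly; under eq_Rintegral do rewrite hornerM hornerC mulrCA.
by rewrite rintZ//; exact: rintegrable_gauss_poly.
Qed.

Lemma gauss_polyXn m : gauss_poly 'X^m =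
  if odd m then 0 else M0 * (kappa / 2) ^+ m./2 * m`!%:R / (m./2)`!%:R.
Proof.
by rewrite -(gauss_moment w pP); apply: eq_Rintegral => x _; rewrite hornerXn.
Qed.

(** Integration by parts against a Gaussian, read off the moments. *)
Lemma gauss_poly_stein p : gauss_poly ('X * p) = kappa * gauss_poly p^`().
Proof.
have mono m : gauss_poly ('X * 'X^m) = kappa * gauss_poly ('X^m)^`().
  rewrite -exprS derivXn -mulr_natl -polyC_natr gauss_polyZ.
  case: m => [|m]; first by rewrite gauss_polyXn /= mul0r mulr0.
  rewrite /= !gauss_polyXn /= negbK.
  have := odd_double_half m; case: (odd m) => /=; first by rewrite !mulr0.
  rewrite add0n; move: (m./2) => k mk; rewrite -mk !factS !natrM exprS.
  have -> : (k.*2.+2)%:R = 2 * (k%:R + 1) :> R by rewrite -addn2 -mul2n natrD natrM; ring.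
  have -> : (k.*2.+1)%:R = 2 * k%:R + 1 :> R by rewrite -addn1 -mul2n natrD natrM.
  have -> : k.+1%:R = k%:R + 1 :> R by rewrite -addn1 natrD.
  have f0 : k`!%:R != 0 :> R by rewrite pnatr_eq0 -lt0n fact_gt0.
  have k0 : k%:R + 1 != 0 :> R by rewrite gt_eqF// ltr_wpDl.
  move: (k.*2`!%:R : R) ((kappa / 2) ^+ k) (k`!%:R : R) f0 k0 => a b f f0 k0.
  by field; rewrite f0 k0.
rewrite -(coefK p) poly_def.
apply: (big_ind (fun q : {poly R} => gauss_poly ('X * q) = kappa * gauss_poly q^`())).
- have z : gauss_poly 0 = 0 by have := gauss_polyZ 0 0; rewrite mulr0 mul0r.
  by rewrite mulr0 deriv0 z mulr0.
- by move=> q r Hq Hr; rewrite mulrDr derivD !gauss_polyD Hq Hr mulrDr.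
- by move=> j _; rewrite -mul_polyC mulrCA derivM derivC mul0r add0r !gauss_polyZ mono mulrCA.
Qed.

(** Stein's identity turns the recursion of the Hermite polynomials into a two-step recursion
    between their integrals. *)
Lemma gauss_hermite_step m : gauss_poly (hermite_poly R m.+2) =
  (2 * kappa - 1) * (2 * m.+1%:R) * gauss_poly (hermite_poly R m).
Proof.
have -> : hermite_poly R m.+2 = (hermite_poly R m.+1)^`() + (- 2)%:P * ('X * hermite_poly R m.+1).
  by rewrite /= {1}/hermite_step polyCN mulNr mulrA.
rewrite gauss_polyD gauss_polyZ gauss_poly_stein deriv_hermite_poly gauss_polyZ; ring.
Qed.

Lemma gauss_hermite_even m : gauss_poly (hermite_poly R m.*2) =
  M0 * (2 * kappa - 1) ^+ m * (m.*2)`!%:R / m`!%:R.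
Proof.
elim: m => [|m IH].
  rewrite !expr0 !fact0 divr1 !mulr1 /gauss_poly; apply: eq_Rintegral => x _.
  by rewrite hornerC mulr1.
rewrite doubleS gauss_hermite_step IH !factS !natrM exprS.
have -> : (m.*2.+2)%:R = 2 * (m%:R + 1) :> R by rewrite -addn2 -mul2n natrD natrM; ring.
have -> : m.+1%:R = m%:R + 1 :> R by rewrite -addn1 natrD.
have f0 : m`!%:R != 0 :> R by rewrite pnatr_eq0 -lt0n fact_gt0.
have k0 : m%:R + 1 != 0 :> R by rewrite gt_eqF// ltr_wpDl.
move: (m.*2`!%:R : R) ((2 * kappa - 1) ^+ m) (m`!%:R : R) f0 (m.*2.+1%:R : R) k0 => a b f f0 d k0.
by field; rewrite f0 k0.
Qed.

End GaussianHermiteIntegrals.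

Section SlowHermite.
Variables (R : realType) (n : nat) (A B : 'M[R]_n).
Local Notation mu := (@lebesgueRn R n).
Hypotheses (pA : posdefmx A) (pB : posdefmx B).
Hypotheses (AB : B <> invmx A) (sAB : semiposdefmx (invmx B - A)).
Let P := invmx B + A.
Let S := sqrtmx A.

Let pP : posdefmx P.
Proof. by apply: posdefD; [exact: posdef_inv|exact: posdef_semi]. Qed.

Let axis_var i : R := dotv (invmx P *m (S *m delta_mx i 0)) (S *m delta_mx i 0).

(** If every variance were [1/2] then the semidefinite matrix [1 - 2 S P^-1 S] would have zero
    diagonal, hence vanish, forcing [P = 2 A]. *)
Lemma axis_var_neq_half : exists i, 2 * axis_var i - 1 != 0.
Proof.
have [[ST S0] SS] := sqrtmxP (posdef_semi pA); rewrite -/S in ST S0 SS.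
have uP := posdef_unit pP; have [PT _] := pP.
apply: contrapT => H.
pose M := 1%:M - 2 *: (S *m (invmx P *m S)).
have ME x : dotv (M *m x) x = dotv x x - 2 * dotv (invmx P *m (S *m x)) (S *m x).
  rewrite /M mulmxBl dotvDl mul1mx dotvNl -scalemxAl dotvZl -!mulmxA.
  by rewrite [dotv (S *m _) x]dotvMl ST.
have pM : semiposdefmx M.
  split.
    by rewrite /M linearB /= linearZ /= trmx1 !trmx_mul trmx_inv PT ST mulmxA.
  move=> x; rewrite ME; pose y := invmx P *m (S *m x); rewrite -/y.
  have Py : P *m y = S *m x by rewrite mulKVmx.
  set q := dotv y (S *m x).
  have q1 : 2 * dotv (S *m y) (S *m y) <= q.
    have := sAB.2 y; rewrite mulmxBl dotvDl dotvNl subr_ge0 => H1.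
    rewrite /q -Py (dotvC y) /P mulmxDl dotvDl.
    have -> : dotv (S *m y) (S *m y) = dotv (A *m y) y by rewrite -SS -mulmxA [RHS]dotvMl ST.
    by move: H1; lra.
  have q2 : q ^+ 2 <= dotv (S *m y) (S *m y) * dotv x x.
    have -> : q = dotv (1%:M *m (S *m y)) x by rewrite mul1mx dotvMl ST.
    have := @semiposdef_CS R n 1%:M (S *m y) x; rewrite !mul1mx; apply.
    by split=> [|z]; rewrite ?trmx1// mul1mx dotvv_ge0.
  have q0 : 0 <= q by apply: le_trans q1; rewrite mulr_ge0 ?dotvv_ge0.
  have x0 := dotvv_ge0 x; move: (dotv x x) (dotv (S *m y) (S *m y)) x0 q1 q2 => X Y X0 q1 q2.
  rewrite subr_ge0; have [->|qn] := eqVneq q 0; first by rewrite mulr0.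
  have qp : 0 < q by rewrite lt_neqAle eq_sym qn.
  rewrite -(ler_pM2r qp); apply: (@le_trans _ _ (2 * (Y * X))); first by rewrite -mulrA -expr2 ler_pM2l.
  by rewrite mulrA mulrC ler_wpM2l.
have M0 : M = 0.
  apply: (semiposdef_diag0 pM) => i; rewrite ME -/(axis_var i) dotv_delta mxE !eqxx.
  apply/eqP; apply: contrapT => Hi; apply: H; exists i; apply/negP => Hi2; apply: Hi.
  by rewrite subr_eq0 eq_sym -subr_eq0.
have uS : S \in unitmx.
  have := posdef_unit pA; rewrite -SS !unitmxE det_mulmx unitrM => /andP[].
  by [].
have E : 1%:M = 2 *: (S *m (invmx P *m S)) by apply/eqP; rewrite -subr_eq0; apply/eqP.
have E3 : 2 *: (invmx P *m S) = invmx S by rewrite -[LHS](mulKmx uS) -scalemxAr -E mulmx1.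
have PA : P = 2 *: A.
  by rewrite -[LHS]mulmx1 -(mulVmx uS) -E3 mulmxA -scalemxAr mulKVmx// -scalemxAl SS.
apply: AB; apply: (can_inj invmxK); rewrite invmxK.
by move: PA; rewrite scaler_nat mulr2n /P => /addIr.
Qed.

Lemma hermite_coef_gaussian i m : hermite_coef A (gaussian (invmx B)) (axis_index i m) =
  ((-1) ^+ m * axis_cst A m * gauss_poly P (S *m delta_mx i 0) (hermite_poly R m))%:C%C.
Proof.
rewrite /hermite_coef /innerL2 -/(cint mu _).
transitivity (cint mu (fun x => ((-1) ^+ m * axis_cst A m *
    (expR (- 2^-1 * dotv (P *m x) x) * (hermite_poly R m).[dotv x (S *m delta_mx i 0)]))%:C%C)).
  apply: eq_cint => x; rewrite conjc_real /gaussian skewed_hermite_axis; last exact: posdef_semi.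
  rewrite -rmorphM /=; congr (_%:C%C).
  rewrite /P mulmxDl dotvDl mulrDr expRD -/S.
  by move: (expR _) (expR _) (axis_cst A m) ((-1) ^+ m) (hermite_poly R m).[_] => a b c d e; ring.
by rewrite cint_real rintZ//; exact: rintegrable_gauss_poly.
Qed.

Lemma sqr_fact_le m : (m`! * m`! <= (m.*2)`!)%N.
Proof.
elim: m => // m IH; rewrite doubleS !factS mulnACA [leqRHS]mulnA.
by apply: leq_mul => //; apply: leq_mul; rewrite ltnS; lia.
Qed.

(** On an axis of variance [kappa] different from [1/2] the coefficient of order [2 m] is at
    least a constant times [|kappa - 1/2|^m]; [h] is chosen so that the quotient still grows
    like [2^m]. *)
Lemma slow_hermite_bound : exists i (h K : R), [/\ 0 < h, 0 < K &
  forall m, K * 2 ^+ m <=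
    cabs (hermite_coef A (gaussian (invmx B)) (axis_index i m.*2)) / h ^+ m.*2].
Proof.
have [i ri] := axis_var_neq_half; set r := 2 * axis_var i - 1 in ri.
have r0 : 0 < `|r| by rewrite normr_gt0.
pose h := Num.sqrt (`|r| / 4).
have h0 : 0 < h by rewrite sqrtr_gt0 divr_gt0.
have h2 : h ^+ 2 = `|r| / 4 by rewrite sqr_sqrtr// divr_ge0// ltW.
pose D := (\det A) `^ 4^-1 * pi `^ (- (n%:R / 4)).
have det0 : 0 < \det A.
  have [_ SS] := sqrtmxP (posdef_semi pA); have := posdef_unit pA.
  rewrite -SS unitmxE det_mulmx unitfE -expr2 => u.
  by rewrite lt_neqAle eq_sym u sqr_ge0.
have D0 : 0 < D by rewrite mulr_gt0// powR_gt0 ?pi_gt0.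
pose M0 := (\int[mu]_x expR (- 2^-1 * dotv (P *m x) x))%R.
have M00 : 0 < M0 by exact: gauss_mass_gt0.
exists i, h, (D * M0); split=> //; first exact: mulr_gt0.
move=> m; rewrite hermite_coef_gaussian cabs_real normrM normrM normrX normrN1 expr1n mul1r.
rewrite gauss_hermite_even// -/(axis_var i) -/r -/M0.
pose s := Num.sqrt ((m.*2)`!%:R : R).
have F0 : 0 < (m.*2)`!%:R :> R by rewrite ltr0n fact_gt0.
have s0 : 0 < s by rewrite sqrtr_gt0.
have s2 : s ^+ 2 = (m.*2)`!%:R by rewrite sqr_sqrtr// ltW.
have ms : m`!%:R <= s.
  rewrite -ler_sqr ?nnegrE ?ler0n//; last exact: ltW.
  by rewrite s2 expr2 -natrM ler_nat sqr_fact_le.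
have aE : axis_cst A m.*2 = D / (2 ^+ m * s).
  rewrite /axis_cst mulrA -/D powRN powR12_sqrt ?ler0n// natrM sqrtrM ?ler0n// natrX.
  have -> : Num.sqrt ((2 : R) ^+ m.*2) = 2 ^+ m by rewrite -muln2 exprM sqrtr_sqr ger0_norm// exprn_ge0.
  by [].
have f0 : 0 < m`!%:R :> R by rewrite ltr0n fact_gt0.
have ax : 0 < D / (2 ^+ m * s) by rewrite divr_gt0// mulr_gt0// exprn_gt0.
rewrite aE (ger0_norm (ltW ax)).
rewrite !normrM normfV normrX (ger0_norm (ltW M00)) (ger0_norm (ltW f0)) (ger0_norm (ltW F0)) -s2 -mul2n exprM h2.
have p2 : 0 < (2 : R) ^+ m by rewrite exprn_gt0.
have rm : 0 < `|r| ^+ m by rewrite exprn_gt0.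
rewrite expr_div_n (_ : (4 : R) = 2 * 2); last by ring.
rewrite exprMn.
move: (2 ^+ m) (`|r| ^+ m) (m`!%:R : R) p2 rm f0 ms => a b f a0 b0 f0 fs.
rewrite (_ : _ / (b / (a * a)) = D * M0 * a * (s / f)); last first.
  by field; rewrite ?gt_eqF.
apply: ler_peMr; first by apply: ltW; apply: mulr_gt0 => //; exact: mulr_gt0.
by rewrite ler_pdivlMr// mul1r.
Qed.

End SlowHermite.

(** * Functions with both decay bounds, and slowness *)

Lemma ereal_sup_pinftyP (R : realType) (T : Type) (u : T -> R) :
  ereal_sup [set (u a)%:E | a in [set: T]] = +oo%E <-> forall M : R, exists a, M <= u a.
Proof.
split=> [sup_u M|H].
  apply: contrapT => H; suff : (ereal_sup [set (u a)%:E | a in [set: T]] <= M%:E)%E.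
    by rewrite sup_u leye_eq.
  apply: ge_ereal_sup => _ [a _ <-]; rewrite lee_fin leNgt; apply/negP => Ma.
  by apply: H; exists a; exact: ltW.
apply/eqyP => M _; have [a Ma] := H M.
by apply: (@le_trans _ _ (u a)%:E); [rewrite lee_fin|apply: ereal_sup_ubound; exists a].
Qed.

Section Admissible.
Variables (R : realType) (n : nat) (A B : 'M[R]_n).
Local Notation mu := (@lebesgueRn R n).
Hypotheses (pA : posdefmx A).
Let EA (x : 'cV[R]_n) := expR (- 2^-1 * dotv (A *m x) x).

Let iEA : rintegrable mu EA. Proof. exact: rintegrable_gauss. Qed.

(** The two decay bounds without slowness. The first one holds at every point, so that
    admissible functions are stable under linear combinations without a change of
    representative. *)
Definition admissible (f : 'cV[R]_n -> R[i]) := [/\ cmeas f,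
  exists C : R, forall x, cabs (f x) <= C * expR (- 2^-1 * dotv (A *m x) x) &
  gaussian_decay 2^-1 B (fourier f)].

Lemma admissible_inL2 f : admissible f -> inL2 f.
Proof. by move=> [mf [C fC] _]; exact: (inL2_gauss_bound pA _ mf fC). Qed.

Lemma admissible_decay f : admissible f -> gaussian_decay 2^-1 A f.
Proof.
move=> [mf [C fC] _]; exists (`|C| + 1); first by rewrite ltr_wpDl.
apply: aeW => x; rewrite (le_trans (fC x))// ler_wpM2r ?expR_ge0//.
by rewrite (le_trans (ler_norm C))// lerDl.
Qed.

Lemma admissible_fourier f xi : admissible f -> cintegrable mu (fun x => f x * expNi (dotv x xi)).
Proof.
move=> [mf [C fC] _]; apply: (@cintegrable_le _ _ _ _ _ (fun x => C * EA x)).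
- by apply: cmeasM => //; apply: cmeas_expNi; exact: measurable_dotv.
- exact: rintegrableZ.
- by move=> x; rewrite cabsM cabs_expNi mulr1.
Qed.

Lemma gaussian_decayD (c : R) (M : 'M[R]_n) f g (a : R[i]) : gaussian_decay c M f ->
  gaussian_decay c M g -> gaussian_decay c M (fun x => f x + a * g x).
Proof.
move=> [C C0 fC] [D D0 gD]; exists (C + cabs a * D); first by rewrite ltr_wpDr// mulr_ge0 ?cabs_ge0 ?ltW.
apply: filterS2 fC gD => x fx gx; rewrite (le_trans (cabsD _ _))// mulrDl lerD//.
by rewrite cabsM -mulrA ler_wpM2l ?cabs_ge0.
Qed.

Lemma admissibleD f g (a : R[i]) : admissible f -> admissible g ->
  admissible (fun x => f x + a * g x).
Proof.
move=> hf hg; have [mf [C fC] Ff] := hf; have [mg [D gD] Fg] := hg; split.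
- by apply: cmeasD => //; apply: cmeasM => //; exact: cmeas_cst.
- exists (C + cabs a * D) => x; rewrite (le_trans (cabsD _ _))// mulrDl lerD//.
  by rewrite cabsM -mulrA ler_wpM2l ?cabs_ge0.
have -> : fourier (fun x => f x + a * g x) = fun xi => fourier f xi + a * fourier g xi.
  apply/funext => xi; rewrite /fourier mulrCA -mulrDr; congr (_ * _).
  rewrite -/(cint mu _) -/(cint mu (fun x => f x * _)) -/(cint mu (fun x => g x * _)).
  rewrite -cintZ; last exact: admissible_fourier.
  rewrite -cintD; [|exact: admissible_fourier|apply: cintegrableZ; exact: admissible_fourier].
  by apply: eq_cint => x; rewrite mulrDl mulrA.
exact: gaussian_decayD.
Qed.

Lemma hermite_coef_admissible f i m : admissible f -> cintegrable mu
  (fun x => f x * ((skewed_hermite A (axis_index i m) x)%:C%C)^*%C).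
Proof.
move=> [mf [C fC] _]; pose v : 'cV[R]_n := sqrtmx A *m delta_mx i 0.
pose p := hermite_poly R m.
have [k E] : exists k, forall x, skewed_hermite A (axis_index i m) x = k * (p.[dotv x v] * EA x).
  by exists ((-1) ^+ m * axis_cst A m) => x; apply: skewed_hermite_axis; exact: posdef_semi.
have mE : measurable_fun setT (fun x => k * (p.[dotv x v] * EA x)).
  apply: measurable_funM; first exact: measurable_cst.
  apply: rintegrable_meas (mu) _ _.
  by have := rintegrable_gauss_poly v pA p; under eq_fun do rewrite mulrC.
have A2 : posdefmx (2 *: A) by exact: posdefZ.
have E2 x : EA x * EA x = expR (- 2^-1 * dotv ((2 *: A) *m x) x).
  by rewrite /EA -expRD -scalemxAl dotvZl; congr expR; field.
apply: (@cintegrable_le _ _ _ _ _ (fun x => (C * `|k|) * `|EA x * EA x * p.[dotv x v]|)).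
- by apply: cmeasM => //; under eq_fun do rewrite conjc_real E; exact: cmeas_real.
- apply: rintegrableZ; apply: rintegrable_norm.
  by under eq_fun do rewrite E2; exact: rintegrable_gauss_poly.
move=> x; rewrite conjc_real cabsM cabs_real E !normrM (ger0_norm (expR_ge0 _)).
have := fC x; rewrite -/(EA x); have := expR_ge0 (- 2^-1 * dotv (A *m x) x); rewrite -/(EA x).
move: (cabs (f x)) (EA x) `|k| `|p.[dotv x v]| (normr_ge0 k) (normr_ge0 p.[dotv x v]) => a e b c b0 c0 e0 ae.
rewrite (_ : C * b * _ = C * e * (b * (c * e))); last by ring.
by apply: ler_wpM2r => //; rewrite !mulr_ge0.
Qed.

Lemma hermite_coefD f g (a : R[i]) i m : admissible f -> admissible g ->
  hermite_coef A (fun x => f x + a * g x) (axis_index i m) =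
  hermite_coef A f (axis_index i m) + a * hermite_coef A g (axis_index i m).
Proof.
move=> hf hg; rewrite /hermite_coef /innerL2.
rewrite -/(cint mu _) -/(cint mu (fun x => f x * _)) -/(cint mu (fun x => g x * _)).
rewrite -cintZ; last exact: hermite_coef_admissible.
rewrite -cintD; [|exact: hermite_coef_admissible|apply: cintegrableZ; exact: hermite_coef_admissible].
by apply: eq_cint => x; rewrite mulrDl mulrA.
Qed.

End Admissible.

Section SlowGaussian.
Variables (R : realType) (n : nat) (A B : 'M[R]_n).
Local Notation mu := (@lebesgueRn R n).
Hypotheses (pA : posdefmx A) (pB : posdefmx B).
Hypotheses (AB : B <> invmx A) (sAB : semiposdefmx (invmx B - A)).

Let pBI : posdefmx (invmx B). Proof. exact: posdef_inv. Qed.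

Lemma admissible_gaussian : admissible A B (gaussian (invmx B)).
Proof.
split; first exact: cmeas_gaussian.
  exists 1 => x; rewrite cabs_gaussian mul1r ler_expR !mulNr lerN2 ler_pM2l//.
  by have := sAB.2 x; rewrite mulmxBl dotvDl dotvNl subr_ge0.
by apply: gaussian_decay_fourier => // xi; rewrite invmxK.
Qed.

(** Slowness is not a linear condition, but it can be forced by adding an arbitrarily small
    multiple of one slow function. *)
Lemma slow_perturbation f (e : R) : admissible A B f -> 0 < e ->
  exists2 c : R, 0 <= c <= e & slow_hermite A B (fun x => f x + c%:C%C * gaussian (invmx B) x).
Proof.
move=> hf e0.
have [i [h [K [h0 K0 HK]]]] := slow_hermite_bound pA pB AB sAB.
have hg c : admissible A B (fun x => f x + c%:C%C * gaussian (invmx B) x).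
  by apply: admissibleD => //; exact: admissible_gaussian.
pose u c a := cabs (hermite_coef A (fun x => f x + c%:C%C * gaussian (invmx B) x) a) / h ^+ mlength a.
have slow c : (forall M, exists a, M <= u c a) ->
    slow_hermite A B (fun x => f x + c%:C%C * gaussian (invmx B) x).
  move=> Hu; split; [exact: (admissible_inL2 pA)|exact: admissible_decay|by case: (hg c)|].
  by exists h => //; apply/(ereal_sup_pinftyP (u c)).
have [H0|H0] := pselect (forall M, exists a, M <= u 0 a).
  by exists 0; rewrite ?lexx ?ltW//; exact: slow.
exists e; rewrite ?lexx ?andbT ?ltW//; apply: slow => M.
have [M1 HM1] : exists M1, forall a, u 0 a < M1.
  apply: contrapT => H1; apply: H0 => M'; apply: contrapT => H2; apply: H1; exists M' => a.
  by rewrite ltNge; apply/negP => Ha; apply: H2; exists a.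
have eK : 0 < e * K by exact: mulr_gt0.
have [m Hm] : exists m : nat, (M + M1) / (e * K) <= 2 ^+ m.
  exists (Num.bound `|(M + M1) / (e * K)|).
  rewrite (le_trans (ler_norm _))// (le_trans (ltW (archi_boundP (normr_ge0 _))))//.
  by rewrite -natrX ler_nat ltnW// ltn_expl.
exists (axis_index i m.*2); rewrite /u.
have := HM1 (axis_index i m.*2); have := HK m; rewrite ler_pdivrMr// in Hm.
have coefE c := hermite_coefD pA c%:C%C i m.*2 hf admissible_gaussian.
rewrite /u !coefE.
rewrite mlength_axis rmorph0 mul0r addr0.
have hm : 0 < h ^+ m.*2 by rewrite exprn_gt0.
move: (hermite_coef A f _) (hermite_coef A _ _) => p q Hq Hp.
have := cabsB (p + e%:C%C * q) p; rewrite addrAC subrr add0r cabsM cabs_real ger0_norm ?(ltW e0)// => tri.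
apply: (@le_trans _ _ (e * (cabs q / h ^+ m.*2) - cabs p / h ^+ m.*2)).
  have : e * (K * 2 ^+ m) <= e * (cabs q / h ^+ m.*2) by rewrite ler_pM2l.
  move: Hp Hm; rewrite (_ : 2 ^+ m * (e * K) = e * (K * 2 ^+ m)); last by ring.
  move: (cabs p / _) (e * (K * _)) (e * (cabs q / _)) => a b c; lra.
by rewrite mulrA -mulrBl ler_pM2r ?invr_gt0// lerBlDr.
Qed.

Lemma slow_hermite_nontrivial : exists2 f, slow_hermite A B f & ~ ae_null f.
Proof.
have [c /andP[c0 _] Vc] := slow_perturbation admissible_gaussian ltr01.
exists (fun x => gaussian (invmx B) x + c%:C%C * gaussian (invmx B) x) => // f0.
apply: (@gaussian_neq0 _ _ (invmx B)); apply: filterS f0 => x /eqP.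
rewrite -{1}[gaussian _ x]mul1r -mulrDl mulf_eq0 => /orP[|/eqP//].
by rewrite -(rmorph1 (real_complex R)) -rmorphD fmorph_eq0 gt_eqF// ltr_wpDr.
Qed.

End SlowGaussian.

(** * Density in the definite case *)

Section DenseCase.
Variables (R : realType) (n : nat) (A B : 'M[R]_n).
Local Notation mu := (@lebesgueRn R n).
Hypotheses (pA : posdefmx A) (pB : posdefmx B).

(** Cauchy-Schwarz for [A], between [B *m y] and [y]. *)
Lemma posdef_inv_gap : posdefmx (invmx B - A) -> posdefmx (invmx A - B).
Proof.
move=> [_ pBA]; have [AT _] := pA; have [BT B0] := pB; split=> [|y y0].
  by rewrite linearB /= trmx_inv AT BT.
rewrite mulmxBl dotvDl dotvNl subr_gt0.
have x0 : B *m y != 0.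
  by apply: contraNneq y0 => By0; rewrite -(mulKmx (posdef_unit pB) y) By0 mulmx0.
have := pBA _ x0; rewrite mulmxBl dotvDl dotvNl subr_gt0 mulKmx ?posdef_unit// => lt1.
have CS := posdef_CS (B *m y) y pA; have q0 := B0 y y0; have k0 := (posdef_inv pA).2 y y0.
rewrite (dotvC y) in lt1.
rewrite -(ltr_pM2l q0) -expr2; apply: le_lt_trans CS _.
by rewrite ltr_pM2r.
Qed.

Hypothesis pAB : posdefmx (invmx A - B).

(** A character translates the transform, a Gaussian of matrix [A^-1]; the excess [A^-1 - B]
    absorbs the translation. *)
Lemma admissible_shift y : admissible A B (fun x => gaussian A x * expNi (dotv x y)).
Proof.
have cA := @cabs_gaussian R n A; split.
- by apply: cmeasM; [exact: cmeas_gaussian|apply: cmeas_expNi; exact: measurable_dotv].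
- by exists 1 => x; rewrite cabsM cabs_expNi mulr1 cA mul1r.
pose M := (\int[mu]_x expR (- 2^-1 * dotv (A *m x) x))%R.
have M0 : 0 < M by exact: gauss_mass_gt0.
pose z := invmx A *m y; pose kp := dotv (invmx (invmx A - B) *m z) z.
exists (ft_cst R n * M * expR (2^-1 * kp)); first by rewrite !mulr_gt0 ?ft_cst_gt0 ?expR_gt0.
apply: aeW => xi; rewrite cabs_fourier.
have -> : ft (fun x => gaussian A x * expNi (dotv x y)) xi =
    (M * expR (- 2^-1 * dotv (invmx A *m (xi + y)) (xi + y)))%:C%C.
  rewrite -gauss_fourier//; apply: eq_cint => x.
  by rewrite -mulrA -expNiD dotvDr [dotv x xi + _]addrC.
rewrite cabs_real ger0_norm ?mulr_ge0 ?expR_ge0 ?(ltW M0)// -!mulrA.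
rewrite ler_pM2l ?ft_cst_gt0// ler_pM2l// -expRD ler_expR.
have [AIT AI0] := posdef_semi (posdef_inv pA).
have CS := posdef_CS xi z pAB; have k0 := (posdef_semi (posdef_inv pAB)).2 z.
have q0 := (posdef_semi pAB).2 xi.
have -> : dotv (invmx A *m (xi + y)) (xi + y) = dotv ((invmx A - B) *m xi) xi +
    dotv (B *m xi) xi + 2 * dotv xi z + dotv (invmx A *m y) y.
  rewrite mulmxBl dotvDl dotvNl subrK mulmxDr dotvDl !dotvDr -/z.
  rewrite (dotv_sym xi y AIT) -/z (dotvC z xi); ring.
have y0 := AI0 y; move: CS; rewrite -/kp in k0 *.
move: (dotv (_ *m xi) xi) q0 (dotv (B *m xi) xi) (dotv xi z) (dotv _ y) y0 kp k0.
move=> a a0 b c d d0 k k0 CS.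
have : - (2 * c) <= a + k.
  apply: le_trans (ler_norm _) _; rewrite -ler_sqr ?nnegrE ?addr_ge0//.
  rewrite real_normK ?num_real//; apply: (@le_trans _ _ (4 * (a * k))).
    by rewrite sqrrN exprMn (_ : 2 ^+ 2 = 4 :> R) ?ler_pM2l//; ring.
  by rewrite -subr_ge0 (_ : _ - _ = (a - k) ^+ 2) ?sqr_ge0//; ring.
lra.
Qed.

Lemma admissible_trigpoly s : admissible A B (fun x => gaussian A x * trigpoly s x).
Proof.
elim: s => [|p s IH].
  have := admissibleD pA (-1) (admissible_shift 0) (admissible_shift 0).
  rewrite (_ : (fun x => _) = (fun x => gaussian A x * trigpoly [::] x))//.
  by apply/funext => x; rewrite mulN1r subrr /trigpoly big_nil mulr0.
have := admissibleD pA p.1 IH (admissible_shift p.2).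
rewrite (_ : (fun x => _) = (fun x => gaussian A x * trigpoly (p :: s) x))//.
by apply/funext => x; rewrite /trigpoly big_cons mulrDr addrC mulrCA.
Qed.

(** Truncating [g / gaussian A] at a high level changes [g] only where it is large compared
    with [gaussian A]. *)
Lemma bounded_multiple_approx g (e : R) : inL2 g -> 0 < e -> exists2 k, cbounded k &
  rintegrable mu (fun x => cabs (gaussian A x * k x - g x) ^+ 2) /\
  (\int[mu]_x (cabs (gaussian A x * k x - g x) ^+ 2))%R < e.
Proof.
move=> /inL2P[mg ig] e0; pose G x := g x * (gaussian A x)^-1.
have mG : cmeas G.
  apply: cmeasM => //; under eq_fun do rewrite /gaussian -fmorphV -expRN.
  apply: cmeas_real; apply: measurable_expR_comp.
  by apply: measurable_funN; apply: measurable_funM; [exact: measurable_cst|exact: measurable_quad].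
have GE x : gaussian A x * G x = g x.
  by rewrite /G mulrCA divff ?mulr1// -cabs_eq0 cabs_gaussian gt_eqF ?expR_gt0.
pose T (j : nat) := [set x | cabs (G x) <= j%:R].
have mT j : measurable (T j).
  have := cmeas_cabs mG measurableT (measurable_itv `]-oo, j%:R]%R); rewrite setTI.
  by congr measurable; apply/seteqP; split=> x /=; rewrite /T /= in_itv.
pose k j x := G x * (\1_(T j) x)%:C%C.
have mk j : cmeas (k j) by apply: cmeasM => //; apply: cmeas_real; exact: measurable_indic.
have bk j : cbounded (k j).
  split=> //; exists j%:R => x; rewrite /k cabsM cabs_real indicE.
  have [/set_mem xT|_] := boolP (x \in T j); first by rewrite normr1 mulr1.
  by rewrite normr0 mulr0.
pose r j x := cabs (gaussian A x * k j x - g x) ^+ 2.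
have mr j : measurable_fun setT (r j).
  apply: measurable_funX; apply: cmeas_cabs; under eq_fun do rewrite -[- g _]mulN1r.
  apply: cmeasD; first by apply: cmeasM => //; exact: cmeas_gaussian.
  by apply: cmeasM => //; exact: cmeas_cst.
have r0 j x : cabs (G x) <= j%:R -> r j x = 0.
  by move=> H; rewrite /r /k indicE mem_set//= mulr1 GE subrr cabs0 expr0n.
have rle j x : 0 <= r j x <= cabs (g x) ^+ 2.
  rewrite sqr_ge0 /r /k indicE; have [_|_] := boolP (x \in T j).
    by rewrite mulr1 GE subrr cabs0 expr0n sqr_ge0.
  by rewrite !mulr0 sub0r cabsN lexx.
have cvr x : r j x @[j --> \oo] --> 0.
  apply: cvg_near_cst; exists (Num.bound (cabs (G x))) => // j /= Nj; apply: r0.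
  by rewrite (le_trans (ltW (archi_boundP (cabs_ge0 _))))// ler_nat.
have [j Hj] := rint_dominated_small mr ig rle cvr e0.
exists (k j) => //; split=> //; apply: (rintegrable_le (mr j) ig) => x.
by have /andP[r1 r2] := rle j x; rewrite ger0_norm.
Qed.

Hypotheses (AB : B <> invmx A) (sAB : semiposdefmx (invmx B - A)).

(** [g] is approximated by [gaussian A] times a bounded function, then by [gaussian A] times a
    trigonometric polynomial, and the result is made slow by a small perturbation. *)
Lemma slow_hermite_dense : dense_in_L2 (slow_hermite A B).
Proof.
move=> g gL2 e e0; have [mg ig] := (inL2P g).1 gL2.
have e2 : 0 < e ^+ 2 / 16 by rewrite divr_gt0 ?exprn_gt0.
have [k bk [ir Hr]] := bounded_multiple_approx gL2 e2.
pose w x := expR (- 1 * dotv (A *m x) x).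
have w0 x : 0 <= w x by exact: expR_ge0.
have iw : rintegrable mu w by exact: rintegrable_gauss.
have [_ /(_ _ e2)[s Hs]] := approximable_bounded w0 iw bk.
have iws := rintegrable_wnorm2 w0 iw (cboundedB bk (cbounded_trigpoly s)).
have [mf0 if0] := (inL2P _).1 (inL2_gaussian (posdef_inv pB)).
pose I0 := (\int[mu]_x (cabs (gaussian (invmx B) x) ^+ 2))%R.
have I00 : 0 <= I0 by apply: rint_ge0 => x; exact: sqr_ge0.
pose ep := e / (4 * Num.sqrt (I0 + 1)).
have sI : 0 < Num.sqrt (I0 + 1) by rewrite sqrtr_gt0 ltr_wpDl.
have ep0 : 0 < ep by rewrite divr_gt0 ?mulr_gt0.
have [c /andP[c0 cep] Vc] := slow_perturbation pA pB AB sAB (admissible_trigpoly s) ep0.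
exists (fun x => gaussian A x * trigpoly s x + c%:C%C * gaussian (invmx B) x) => //.
set f := (fun x => _ + _) in Vc *.
have [fL2 _ _ _] := Vc; have mf := inL2_cmeas fL2.
pose r x := cabs (gaussian A x * k x - g x) ^+ 2.
pose q x := w x * cabs (k x - trigpoly s x) ^+ 2.
pose p x := cabs (gaussian (invmx B) x) ^+ 2.
have le x : cabs (f x - g x) ^+ 2 <= 2 * q x + (4 * r x + 4 * c ^+ 2 * p x).
  have -> : f x - g x = gaussian A x * (trigpoly s x - k x) +
      ((gaussian A x * k x - g x) + c%:C%C * gaussian (invmx B) x) by rewrite /f; ring.
  apply: le_trans (sqr_cabsD _ _) _; apply: lerD.
    rewrite cabsM cabs_distC exprMn cabs_gaussian (_ : expR _ ^+ 2 = w x)//.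
    by rewrite expr2 -expRD /w; congr expR; field.
  rewrite (_ : 4 * r x + _ = 2 * (2 * r x + 2 * (c ^+ 2 * p x))); last by ring.
  rewrite ler_pM2l//; apply: le_trans (sqr_cabsD _ _) _.
  by rewrite cabsM cabs_real exprMn ger0_norm.
have ip : rintegrable mu (fun x => 4 * r x + 4 * c ^+ 2 * p x).
  by apply: rintegrableD; exact: rintegrableZ.
have iH : rintegrable mu (fun x => 2 * q x + (4 * r x + 4 * c ^+ 2 * p x)).
  by apply: rintegrableD => //; exact: rintegrableZ.
have ifg : rintegrable mu (fun x => cabs (f x - g x) ^+ 2).
  apply: (rintegrable_le _ iH) => [|x]; last by rewrite ger0_norm ?sqr_ge0.
  apply: measurable_funX; apply: cmeas_cabs; under eq_fun do rewrite -[- g _]mulN1r.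
  by apply: cmeasD => //; apply: cmeasM => //; exact: cmeas_cst.
rewrite L2norm_lt//; apply: le_lt_trans (rint_le ifg iH le) _.
rewrite rintD//; last exact: rintegrableZ.
rewrite rintD//; try exact: rintegrableZ.
rewrite !rintZ//.
have c2 : c ^+ 2 * (I0 + 1) <= e ^+ 2 / 16.
  have -> : e ^+ 2 / 16 = ep ^+ 2 * (I0 + 1).
    have sI2 : Num.sqrt (I0 + 1) ^+ 2 = I0 + 1 by rewrite sqr_sqrtr// addr_ge0.
    by rewrite -sI2 /ep; move: (Num.sqrt _) sI => t t0; field; rewrite gt_eqF.
  by rewrite ler_wpM2r ?addr_ge0// ler_sqr ?nnegrE ?(ltW ep0).
have c20 := sqr_ge0 c; rewrite /wnorm2 -/q in Hs; rewrite -/r in Hr; rewrite -/I0.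
move: (e ^+ 2) (c ^+ 2) (\int[_]_x q x)%R (\int[_]_x r x)%R e2 Hs Hr c2 c20 => E C Q S e2 Hs Hr c2 c20.
have -> : 4 * C * I0 = 4 * (C * I0) by ring.
move: c2; rewrite mulrDr mulr1; move: (C * I0) => X c2; lra.
Qed.

End DenseCase.

(** * An annihilator in the degenerate case *)

Section FourthDifference.
Variable R : realType.

Definition fourth_difference : seq R := [:: 1; -4; 6; -4; 1].

Lemma fourth_difference_monomial i : (i < 4)%N ->
  \sum_(j < 5) fourth_difference`_j * (j.+2%:R : R) ^+ i = 0.
Proof.
by case: i => [|[|[|[|//]]]] _; rewrite !big_ord_recl big_ord0 /= /bump /= ?expr0 ?expr1; ring.
Qed.

Lemma fourth_difference_cubic (Q : {poly R[i]}) : (size Q <= 4)%N ->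
  \sum_(j < 5) (fourth_difference`_j)%:C%C * Q.[(j.+2%:R : R)%:C%C] = 0.
Proof.
move=> sQ; under eq_bigr do rewrite (horner_coef_wide _ sQ) mulr_sumr.
rewrite exchange_big big1 // => i _ /=.
transitivity (Q`_i * (\sum_(j < 5) fourth_difference`_j * (j.+2%:R : R) ^+ i)%:C%C).
  rewrite rmorph_sum mulr_sumr; apply: eq_bigr => j _.
  by rewrite mulrCA rmorphM rmorphXn.
by rewrite fourth_difference_monomial// rmorph0 mulr0.
Qed.

(** These weights insert the factor of [modulated_gauss_rational] at [u = 2, ..., 6], so that a
    combination of values of [modulated_gauss] becomes a fourth difference of a cubic. *)
Definition profile_weight (j : nat) : R :=
  fourth_difference`_j * ((1 + j.+2%:R) ^+ 4 / Num.sqrt (1 + j.+2%:R)).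

Definition profile (s : R) : R := \sum_(j < 5) profile_weight j * expR (- j.+2%:R * s).

(** In the variable [y = exp (- s)] the profile is [y ^+ 2] times a polynomial with nonzero
    constant coefficient. *)
Lemma profile_neq0 : exists2 s : R, 0 <= s & profile s != 0.
Proof.
apply: contrapT => H.
have z (s : R) : 0 <= s -> profile s = 0.
  by move=> s0; apply/eqP; apply: contrapT => /negP Hs; apply: H; exists s.
pose p : {poly R[i]} := \poly_(j < 5) (profile_weight j)%:C%C.
have p0 : p = 0.
  apply: (@poly_half_order R 5 p 0) => //; first exact: size_poly.
  move=> y y0 y1; rewrite mul0r le_eqVlt cabs_eq0; apply/orP; left; apply/eqP.
  have ly : 0 <= - ln y by rewrite oppr_ge0 ln_le0// ltW.
  have : profile (- ln y) = y ^+ 2 * \sum_(j < 5) profile_weight j * y ^+ j.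
    rewrite mulr_sumr; apply: eq_bigr => j _.
    by rewrite mulrNN expRM_natl lnK ?posrE// [RHS]mulrCA -(exprD y 2 j).
  rewrite z// => /esym/eqP; rewrite mulf_eq0 expf_eq0 (gt_eqF y0) andbF /= => /eqP S0.
  rewrite horner_poly; transitivity ((\sum_(j < 5) profile_weight j * y ^+ j)%:C%C).
    rewrite rmorph_sum; apply: eq_bigr => j _.
    by rewrite [RHS]rmorphM -rmorphXn.
  by rewrite S0.
have := congr1 (fun q : {poly R[i]} => q`_0) p0.
rewrite coef_poly coef0 /= => /eqP; rewrite fmorph_eq0 /profile_weight /= mul1r.
have three : 0 < 1 + 2 :> R by rewrite addr_gt0.
by rewrite gt_eqF// divr_gt0 ?exprn_gt0 ?sqrtr_gt0.
Qed.

Lemma profile_bound : exists2 L : R, 0 <= L & forall s, 0 <= s -> `|profile s| <= L * expR (- 2 * s).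
Proof.
exists (\sum_(j < 5) `|profile_weight j|); first by apply: sumr_ge0.
move=> s s0; rewrite /profile mulr_suml (le_trans (ler_norm_sum _ _ _))//.
apply: ler_sum => j _; rewrite normrM ler_wpM2l// ger0_norm ?expR_ge0// ler_expR !mulNr lerN2.
by rewrite ler_wpM2r// ler_nat.
Qed.

Lemma measurable_profile d (T : measurableType d) (h : T -> R) : measurable_fun setT h ->
  measurable_fun setT (fun x => profile (h x)).
Proof.
move=> mh; apply: measurable_sum => j; apply: measurable_funM; first exact: measurable_cst.
by apply: measurable_expR_comp; apply: measurable_funM => //; exact: measurable_cst.
Qed.

End FourthDifference.

Section Degenerate.
Variables (R : realType) (n : nat) (A B : 'M[R]_n) (v : 'cV[R]_n).
Local Notation mu := (@lebesgueRn R n).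
Hypotheses (pA : posdefmx A) (pB : posdefmx B).
Hypotheses (vAB : invmx B *m v = A *m v) (v2 : dotv (A *m v) v = 2).
Let w := A *m v.
Let S (x : 'cV[R]_n) : R := profile (dotv x w ^+ 2 / 4).

Let Sbound : exists2 L : R, 0 <= L & forall x, `|S x| <= L * expR (- 2^-1 * dotv x w ^+ 2).
Proof.
have [L L0 HL] := profile_bound R; exists L => // x.
have s0 : 0 <= dotv x w ^+ 2 / 4 by rewrite divr_ge0 ?sqr_ge0.
apply: le_trans (HL _ s0) _; rewrite ler_wpM2l// ler_expR le_eqVlt; apply/orP; left.
by apply/eqP; field.
Qed.

Let mS : measurable_fun setT S.
Proof.
apply: measurable_profile; apply: measurable_funM; last exact: measurable_cst.
by apply: measurable_funX; exact: measurable_dotv.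
Qed.

Section Annihilation.
Variables (f : 'cV[R]_n -> R[i]) (C D : R).
Hypotheses (mf : cmeas f) (C0 : 0 <= C) (D0 : 0 <= D).
Hypothesis fC : forall x, cabs (f x) <= C * expR (- 2^-1 * dotv (A *m x) x).
Hypothesis fD : forall xi, cabs (ft f xi) <= D * expR (- 2^-1 * dotv (B *m xi) xi).

(** On the lines [eta + t w] with [eta] orthogonal to [v] the decay of the transform is exactly
    critical, so that [modulated_gauss] is governed by a cubic. *)
Lemma slice_annihilated eta : dotv eta v = 0 ->
  cint mu (fun x => f x * expNi (dotv x eta) * (S x)%:C%C) = 0.
Proof.
move=> etav.
have half0 : 0 < 2^-1 :> R by rewrite invr_gt0.
have wA : dotv (invmx A *m w) w = 4 * 2^-1.
  by rewrite mulKmx ?posdef_unit// dotvC v2; field.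
have Bw : B *m w = v by rewrite /w -vAB mulKVmx ?posdef_unit.
have slice t : cabs (slice_transform f w eta t) <= D * expR (- dotv t t).
  apply: le_trans (fD (eta + t 0 0 *: w)) _; rewrite ler_wpM2l// ler_expR.
  rewrite mulmxDr -scalemxAr Bw !(dotvDl, dotvDr, dotvZl, dotvZr) (dotvC v eta) etav.
  have [BT B0] := posdef_semi pB.
  have -> : dotv (B *m eta) w = 0 by rewrite (dotv_sym _ _ BT) Bw dotvC.
  have -> : dotv v w = 2 by rewrite dotvC.
  rewrite dotv1E; have := B0 eta; move: (dotv _ eta) (t 0 0) => b s b0; nra.
have [Q sQ HQ] := modulated_gauss_rational pA half0 C0 D0 mf fC wA slice.
rewrite -[RHS](fourth_difference_cubic sQ).
have -> : (fun x => f x * expNi (dotv x eta) * (S x)%:C%C) = (fun x => \sum_(j < 5)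
    (profile_weight R j)%:C%C * (f x * expNi (dotv x eta) *
       cexp (- (j.+2%:R : R)%:C%C * (dotv x w ^+ 2 / 4)%:C%C))).
  apply/funext => x; rewrite /S /profile rmorph_sum mulr_sumr; apply: eq_bigr => j _.
  by rewrite -[in RHS]rmorphN -[in RHS]rmorphM cexp_real [RHS]mulrCA -[in RHS]rmorphM.
have ij (j : 'I_5) : cintegrable mu (fun x => f x * expNi (dotv x eta) *
       cexp (- (j.+2%:R : R)%:C%C * (dotv x w ^+ 2 / 4)%:C%C)).
  apply: (cintegrable_le (h := fun x => C * expR (- 2^-1 * dotv (A *m x) x))).
  - apply: cmeasM; first by apply: cmeasM => //; apply: cmeas_expNi; exact: measurable_dotv.
    apply: cmeas_cexp; apply: cmeasM; first exact: cmeas_cst.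
    apply: cmeas_real; apply: measurable_funM; last exact: measurable_cst.
    by apply: measurable_funX; exact: measurable_dotv.
  - by apply: rintegrableZ; exact: rintegrable_gauss.
  move=> x; rewrite -rmorphN -rmorphM cexp_real !cabsM cabs_expNi mulr1 cabs_real.
  rewrite ger0_norm ?expR_ge0// -[leRHS]mulr1; apply: ler_pM => //; rewrite ?cabs_ge0 ?expR_ge0//.
  by rewrite -[leRHS]expR0 ler_expR mulNr oppr_le0 mulr_ge0// divr_ge0 ?sqr_ge0.
rewrite cint_sum => [|j _]; last exact: cintegrableZ.
apply: eq_bigr => j _; rewrite cintZ//.
rewrite -HQ; last by rewrite ltr1n.
by rewrite mulrA -rmorphM.
Qed.

End Annihilation.

(** The projection along [v] onto the hyperplane orthogonal to [w]. *)
Let Pi (x : 'cV[R]_n) := x - (dotv x w / 2) *: v.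

Let G (x : 'cV[R]_n) := S x * expR (- 2^-1 * dotv (Pi x) (Pi x)).

Let dotvw : dotv v w = 2. Proof. by rewrite dotvC. Qed.

Let PiE x eta : dotv eta (Pi x) = dotv x (eta - (dotv eta v / 2) *: w).
Proof. by rewrite /Pi !(dotvDr, dotvNr, dotvZr) (dotvC eta x); field. Qed.

Let quad_lower : exists2 K : R, 0 < K &
  forall x, K * dotv x x <= dotv x w ^+ 2 + dotv (Pi x) (Pi x).
Proof.
pose k := 2 + dotv v v; have k0 : 0 < k by rewrite ltr_wpDr ?dotvv_ge0.
exists k^-1; first by rewrite invr_gt0.
move=> x; rewrite mulrC ler_pdivrMr//.
have -> : dotv x x = dotv (Pi x) (Pi x) + dotv x w * dotv (Pi x) v + dotv x w ^+ 2 / 4 * dotv v v.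
  have -> : dotv x x = dotv (Pi x + (dotv x w / 2) *: v) (Pi x + (dotv x w / 2) *: v) by rewrite subrK.
  move: (Pi x) (dotv x w) => z t; rewrite !(dotvDl, dotvDr, dotvZl, dotvZr) (dotvC v z).
  by move: (dotv z v) => a; field.
have H : 0 <= dotv (Pi x - (dotv x w / 2) *: v) (Pi x - (dotv x w / 2) *: v) by exact: dotvv_ge0.
move: (Pi x) (dotv x w) H (dotvv_ge0 v) (dotvv_ge0 (Pi x)) => z t.
rewrite !(dotvDl, dotvDr, dotvNl, dotvNr, dotvZl, dotvZr) (dotvC v z) /k.
move: (dotv z v) (dotv z z) (dotv v v) => a p V H V0 p0.
have H1 : t * a <= p + t ^+ 2 / 4 * V.
  by move: H; rewrite -subr_ge0 => H; rewrite -subr_ge0; apply: le_trans H _; rewrite le_eqVlt; apply/orP; left; apply/eqP; field.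
have t0 := sqr_ge0 t; have tV : 0 <= t ^+ 2 * V by exact: mulr_ge0.
have pV : 0 <= p * V by exact: mulr_ge0.
move: H1 tV pV; rewrite mulrDl !mulrDr (_ : t ^+ 2 / 4 * V = t ^+ 2 * V / 4); last by field.
move: (t ^+ 2 * V) (p * V) (t ^+ 2) t0 (t * a) => q r s s0 u; lra.
Qed.

Let mPi : measurable_fun setT (fun x => dotv (Pi x) (Pi x)).
Proof.
have E x : dotv (Pi x) (Pi x) = dotv x x - dotv x w * dotv x v + dotv x w ^+ 2 * (dotv v v / 4).
  by rewrite /Pi !(dotvDl, dotvDr, dotvNl, dotvNr, dotvZl, dotvZr) (dotvC v x); field.
have mw := measurable_dotv w; have mv := measurable_dotv v.
under eq_fun do rewrite E; apply: measurable_funD.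
  by apply: measurable_funB; [exact: measurable_dotvv|exact: measurable_funM].
by apply: measurable_funM; [exact: measurable_funX|exact: measurable_cst].
Qed.

Let mG : measurable_fun setT G.
Proof.
apply: measurable_funM => //; apply: measurable_expR_comp.
by apply: measurable_funM => //; exact: measurable_cst.
Qed.

Let Gbound : exists P (L : R), posdefmx P /\ 0 <= L /\
  forall x, `|G x| <= L * expR (- 2^-1 * dotv (P *m x) x).
Proof.
have [K K0 HK] := quad_lower; have [L L0 HL] := Sbound.
exists K%:M, L; split; first exact: posdef_scalar.
split=> // x; rewrite /G normrM (ger0_norm (expR_ge0 _)).
apply: (@le_trans _ _ (L * expR (- 2^-1 * dotv x w ^+ 2) * expR (- 2^-1 * dotv (Pi x) (Pi x)))).
  by rewrite ler_wpM2r ?expR_ge0.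
rewrite -mulrA -expRD ler_wpM2l// ler_expR mul_scalar_mx dotvZl -mulrDr !mulNr lerN2.
by rewrite ler_pM2l// invr_gt0.
Qed.

Lemma annihilator_inL2 : inL2 (fun x => (G x)%:C%C).
Proof.
have [P [L [pP [L0 HL]]]] := Gbound.
apply: (inL2_gauss_bound (A := P) (c := 2^-1) (C := L)) pP _ _ _; [by rewrite invr_gt0|exact: cmeas_real|].
by move=> x; rewrite cabs_real.
Qed.

Lemma annihilator_neq0 : (\int[mu]_x (cabs (G x)%:C%C ^+ 2))%R != 0.
Proof.
apply/eqP => G0; have [_ iG] := (inL2P _).1 annihilator_inL2.
have ae0 := rint_eq0_ae iG (fun x => sqr_ge0 _) G0.
have cS : continuous (fun x => S x ^+ 2).
  have cS1 : continuous S.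
    apply: (@continuous_sumr R n 5 (fun j x => profile_weight R j * expR (- j.+2%:R * (dotv x w ^+ 2 / 4)))).
    move=> j; pose q (y : 'cV[R]_n) := - j.+2%:R / 4 * dotv ((w *m w^T) *m y) y.
    have cq : continuous q.
      by move=> y; exact: cvgM (cvg_cst _) (@continuous_quad R n (w *m w^T) y).
    have ce : continuous (fun y => expR (q y)).
      by move=> y; exact: (continuous_comp (cq y) (@continuous_expR R _)).
    rewrite (_ : (fun x => _) = fun x => profile_weight R j * expR (q x)); last first.
      apply/funext => y; congr (_ * expR _).
      rewrite /q -mulmxA [w^T *m y]mx11_scalar -dotvE mul_mx_scalar dotvZl (dotvC w y).
      by move: (j.+2%:R : R) (dotv y w) => a b; field.
    by move=> x; exact: cvgM (cvg_cst _) (ce x).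
  by move=> x; exact: cvgM (cS1 x) (cS1 x).
have S0 x : S x ^+ 2 <= 0.
  apply: (ae_le_everywhere cS); apply: filterS ae0 => y /eqP.
  rewrite sqrf_eq0 cabs_real normr_eq0 /G mulf_eq0 (gt_eqF (expR_gt0 _)) orbF => /eqP ->.
  by rewrite expr0n.
have [s s0 /negP] := profile_neq0 R; apply.
have w0 : 0 < dotv w w.
  rewrite lt_neqAle dotvv_ge0 andbT eq_sym dotvv_eq0; apply/eqP => w00.
  by move: dotvw; rewrite w00 dotv0r; lra.
pose x := (2 * Num.sqrt s / dotv w w) *: w.
have xs : dotv x w ^+ 2 / 4 = s.
  by rewrite /x dotvZl mulfVK ?gt_eqF// exprMn sqr_sqrtr//; field.
by have := S0 x; rewrite /S xs => H; rewrite -sqrf_eq0 eq_le H sqr_ge0.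
Qed.

(** Superposition of slices: [exp (- |Pi x|^2 / 2)] is a Gaussian average of characters whose
    frequencies are orthogonal to [v]. *)
Lemma annihilator_orthogonal f (C D : R) : cmeas f -> 0 <= C -> 0 <= D ->
  (forall x, cabs (f x) <= C * expR (- 2^-1 * dotv (A *m x) x)) ->
  (forall xi, cabs (ft f xi) <= D * expR (- 2^-1 * dotv (B *m xi) xi)) ->
  cint mu (fun x => f x * (G x)%:C%C) = 0.
Proof.
move=> mf C0 D0 fC fD.
have p1 : posdefmx (1%:M : 'M[R]_n) by exact: posdef_scalar.
pose e (y : 'cV[R]_n) := expR (- 2^-1 * dotv (1%:M *m y) y).
pose M := (\int[mu]_y e y)%R; have M0 : 0 < M by exact: gauss_mass_gt0.
have ie : rintegrable mu e by apply: rintegrable_gauss => //; rewrite invr_gt0.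
have me : measurable_fun setT e by exact: rintegrable_meas ie.
have [L L0 SL] := Sbound.
have SL' x : `|S x| <= L.
  apply: le_trans (SL x) _; rewrite -[leRHS]mulr1 ler_wpM2l// -expR0 ler_expR.
  by rewrite mulNr oppr_le0 mulr_ge0 ?invr_ge0 ?sqr_ge0.
have pairing x : cint mu (fun y => (e y)%:C%C * expNi (dotv y (Pi x))) =
    (M * expR (- 2^-1 * dotv (Pi x) (Pi x)))%:C%C.
  by rewrite gauss_fourier// invmx1 mul1mx.
have ip x : cintegrable mu (fun y => (e y)%:C%C * expNi (dotv y (Pi x))).
  apply: cintegrable_le ie _ => [|y].
    by apply: cmeasM; [exact: cmeas_real|apply: cmeas_expNi; exact: measurable_dotv].
  by rewrite cabsM cabs_expNi mulr1 cabs_real ger0_norm ?expR_ge0.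
pose k (p : 'cV[R]_n * 'cV[R]_n) : R[i] :=
  f p.1 * (S p.1)%:C%C * ((e p.2)%:C%C * expNi (dotv p.2 (Pi p.1))).
have mdot : measurable_fun setT (fun p : 'cV[R]_n * 'cV[R]_n => dotv p.2 p.1).
  apply: measurable_sum => i; apply: measurable_funM.
    by apply: (measurableT_comp (measurable_coord i)); exact: measurable_snd.
  by apply: (measurableT_comp (measurable_coord i)); exact: measurable_fst.
have mk : cmeas k.
  apply: cmeasM.
    apply: cmeasM; first by apply: cmeas_comp mf _; exact: measurable_fst.
    by apply: cmeas_real; apply: (measurableT_comp mS); exact: measurable_fst.
  apply: cmeasM.
    by apply: cmeas_real; apply: (measurableT_comp me); exact: measurable_snd.
  apply: cmeas_expNi; under eq_fun do rewrite /Pi dotvDr dotvNr dotvZr.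
  apply: measurable_funB => //; apply: measurable_funM.
    apply: measurable_funM; last exact: measurable_cst.
    by apply: (measurableT_comp (measurable_dotv w)); exact: measurable_fst.
  by apply: (measurableT_comp (measurable_dotv v)); exact: measurable_snd.
have iA : rintegrable mu (fun x => C * L * expR (- 2^-1 * dotv (A *m x) x)).
  by apply: rintegrableZ; apply: rintegrable_gauss => //; rewrite invr_gt0.
have bk x y : cabs (k (x, y)) <= C * L * expR (- 2^-1 * dotv (A *m x) x) * e y.
  rewrite /k /= !cabsM cabs_expNi mulr1 !cabs_real (ger0_norm (expR_ge0 _)).
  rewrite ler_wpM2r ?expR_ge0// mulrAC; apply: ler_pM => //; exact: cabs_ge0.
have sw := cfubini mk iA ie bk.
have E1 : cint mu (fun x => cint mu (fun y => k (x, y))) =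
    M%:C%C * cint mu (fun x => f x * (G x)%:C%C).
  have ifG : cintegrable mu (fun x => f x * (G x)%:C%C).
    have mfG : cmeas (fun x => f x * (G x)%:C%C) by apply: cmeasM mf _; exact: cmeas_real.
    apply: cintegrable_le mfG iA _ => x.
    rewrite cabsM cabs_real mulrAC; apply: ler_pM (fC x) _; [exact: cabs_ge0|exact: normr_ge0|].
    apply: le_trans (SL' x); rewrite /G normrM (ger0_norm (expR_ge0 _)) -[leRHS]mulr1.
    apply: ler_wpM2l; first exact: normr_ge0.
    by rewrite -expR0 ler_expR mulNr oppr_le0 mulr_ge0 ?invr_ge0 ?dotvv_ge0.
  rewrite -cintZ; last exact: ifG.
  apply: eq_cint => x; transitivity (f x * (S x)%:C%C * (M * expR (- 2^-1 * dotv (Pi x) (Pi x)))%:C%C).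
    by rewrite -pairing -(cintZ _ (ip x)).
  rewrite [RHS]mulrCA -[LHS]mulrA; congr (_ * _); rewrite -rmorphM -[in RHS]rmorphM /G.
  by congr (_%:C%C); rewrite mulrCA.
have E2 : cint mu (fun y => cint mu (fun x => k (x, y))) = 0.
  transitivity (cint mu (fun=> 0%:C%C : R[i])); last by rewrite cint_real rint0.
  apply: eq_cint => y; pose z := y - (dotv y v / 2) *: w.
  have zv : dotv z v = 0.
    by rewrite /z dotvDl dotvNl dotvZl (dotvC w) dotvw; field.
  have H := slice_annihilated mf C0 D0 fC fD zv.
  transitivity (cint mu (fun x => (e y)%:C%C * (f x * expNi (dotv x z) * (S x)%:C%C))).
    by apply: eq_cint => x; rewrite /k /= PiE -/z; ring.
  have mfz : cmeas (fun x => f x * expNi (dotv x z) * (S x)%:C%C).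
    apply: cmeasM; last exact: cmeas_real.
    by apply: cmeasM mf _; apply: cmeas_expNi; exact: measurable_dotv.
  have ifz : cintegrable mu (fun x => f x * expNi (dotv x z) * (S x)%:C%C).
    apply: cintegrable_le mfz iA _ => x; rewrite !cabsM cabs_expNi mulr1 cabs_real mulrAC.
    by apply: ler_pM (fC x) (SL' x); [exact: cabs_ge0|exact: normr_ge0].
  by rewrite (cintZ _ ifz) H mulr0.
have := etrans (esym E1) (etrans sw E2); move: (cint mu _) => I.
move: M M0 {pairing E1} => M M0 /eqP; rewrite mulf_eq0 fmorph_eq0 (gt_eqF M0) /=.
by move/eqP.
Qed.

(** [G] is nonzero and orthogonal to the whole set, so elements of the set stay at distance at
    least its norm from it. *)
Lemma slow_hermite_not_dense : ~ dense_in_L2 (slow_hermite A B).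
Proof.
pose g x : R[i] := (G x)%:C%C; have gL2 : inL2 g := annihilator_inL2.
have [mg ig] := (inL2P g).1 gL2.
pose I := (\int[mu]_x (cabs (g x) ^+ 2))%R.
have I0 : 0 < I by rewrite lt_neqAle eq_sym annihilator_neq0 rint_ge0// => x; exact: sqr_ge0.
move=> /(_ g gL2 (Num.sqrt I)); rewrite sqrtr_gt0 => /(_ I0) [f [fL2 fA fB _]].
have half0 : 0 < 2^-1 :> R by rewrite invr_gt0.
have [f' [C [D [mf' ff' [C0 D0] fC fD]]]] := decay_representative pA half0 fL2 fA fB.
have [mf if2] := (inL2P f).1 fL2.
have mm : cmeas (fun x => f x - g x).
  under eq_fun do rewrite -[- g _]mulN1r.
  by apply: cmeasD => //; apply: cmeasM => //; exact: cmeas_cst.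
have fg0 : cint mu (fun x => f x * g x) = 0.
  rewrite -(annihilator_orthogonal mf' C0 D0 fC fD); apply: cint_ae; [exact: cmeasM|exact: cmeasM|].
  by apply: filterS ff' => x ->.
have ifg : cintegrable mu (fun x => f x * g x).
  apply: (cintegrable_le (h := fun x => cabs (f x) ^+ 2 + cabs (g x) ^+ 2)).
  - exact: cmeasM.
  - exact: rintegrableD.
  move=> x; rewrite cabsM; have := sqr_ge0 (cabs (f x) - cabs (g x)).
  have := cabs_ge0 (f x); have := cabs_ge0 (g x).
  move: (cabs (f x)) (cabs (g x)) => a b; nra.
have E x : cabs (f x - g x) ^+ 2 = cabs (f x) ^+ 2 + cabs (g x) ^+ 2 - 2 * complex.Re (f x * g x).
  by rewrite !sqr_cabs !(cReD, cImD, cReN, cImN) /g cReMr /=; ring.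
have iR := ifg.1.
have i2 : rintegrable mu (fun x => cabs (f x - g x) ^+ 2).
  under eq_fun do rewrite E.
  by apply: rintegrableB; [exact: rintegrableD|exact: rintegrableZ].
rewrite L2norm_lt ?sqrtr_gt0// sqr_sqrtr ?(ltW I0)//.
under eq_Rintegral do rewrite E.
rewrite rintB; [|exact: rintegrableD|exact: rintegrableZ].
rewrite rintD// rintZ//.
have -> : (\int[mu]_x complex.Re (f x * g x))%R = 0.
  by move: fg0 => /(congr1 (@complex.Re R)).
rewrite mulr0 subr0 -/I gtrDr ltNge rint_ge0// => x; exact: sqr_ge0.
Qed.

End Degenerate.

(** * Hardy's theorem for a pair of matrices *)

(** A null vector [v] of [B^-1 - A], normalised by [<A v, v> = 2], leads to the degenerate
    case. *)
Lemma dense_posdef (R : realType) n (A B : 'M[R]_n) : posdefmx A -> posdefmx B ->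
  semiposdefmx (invmx B - A) -> dense_in_L2 (slow_hermite A B) -> posdefmx (invmx B - A).
Proof.
move=> pA pB sAB dense; apply: contrapT => npd.
have [v v0 Mv] := semiposdef_degenerate sAB npd.
have q0 := pA.2 v v0; pose s := Num.sqrt (2 / dotv (A *m v) v).
apply: (@slow_hermite_not_dense R n A B (s *: v)) => //.
  by rewrite -!scalemxAr; congr (_ *: _); apply/eqP; rewrite -subr_eq0 -mulmxBl Mv.
rewrite -scalemxAr dotvZl dotvZr mulrA -expr2 sqr_sqrtr ?divr_ge0 ?ltW//.
by rewrite divfK ?gt_eqF.
Qed.

Theorem theorem3p8 (R : realType) (d : nat) (A B : 'M[R]_d)
    (hd : (1 <= d)%N) (hA : posdefmx A) (hB : posdefmx B)
    (hAB : B <> invmx A) :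
  (~ semiposdefmx (invmx B - A) ->
     exists2 lam0 : R, 0 < lam0 &
       (forall f : 'cV[R]_d -> R[i], inL2 f ->
          (exists lam : R, [/\ lam < lam0,
             gaussian_decay (2^-1 - lam) A f &
             gaussian_decay (2^-1 - lam) B (fourier f)]) ->
          ae_null f) /\
       (exists f : 'cV[R]_d -> R[i], [/\ inL2 f, ~ ae_null f,
          gaussian_decay (2^-1 - lam0) A f &
          gaussian_decay (2^-1 - lam0) B (fourier f)])) /\
  (semiposdefmx (invmx B - A) ->
     (exists2 f, slow_hermite A B f & ~ ae_null f) /\
     (dense_in_L2 (slow_hermite A B) <-> posdefmx (invmx B - A))).
Proof.
split=> [nsd|sAB]; first exact: sharp_threshold.
split; first exact: slow_hermite_nontrivial.
split=> [|pd]; first exact: dense_posdef.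
by apply: slow_hermite_dense => //; exact: posdef_inv_gap.
Qed.
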